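(* Let $(X,d,\mathfrak m)$ be a complete and separable length metric space equipped with a finite non-negative Borel measure $\mathfrak m$ with $\operatorname{supp}\mathfrak m=X$, let $I\subset\mathbb R$ be a closed, possibly unbounded, interval, and let $w_d,w_{\mathfrak m}:I\to[0,+\infty)$ be continuous functions with $\{w_d=0\}\subset\{w_{\mathfrak m}=0\}$. Let $(X_w,d_w,\mathfrak m_w)$ be the warped product of $I$ and $X$ with respect to $w_d,w_{\mathfrak m}$. Then $W^{1,2}(X_w)\subset\mathsf{BL}(X_w)$.
   Context: **Sobolev functions.** Let $(Z,d,\mathfrak m)$ be a complete separable metric space with a non-negative Radon measure. A probability measure $\pi$ on $C([0,1],Z)$ is a *test plan* if there is $C>0$ with $(e_t)_\sharp\pi\le C\mathfrak m$ for all $t\in[0,1]$ (where $e_t(\gamma)=\gamma_t$), $\pi$ is concentrated on $AC^2([0,1],Z)$, and $\int_0^1\int|\dot\gamma_t|^2\,d\pi(\gamma)\,dt<\infty$, where $|\dot\gamma_t|$ is the metric speed. A Borel function $f:Z\to\mathbb R$ belongs to the Sobolev class $S^2(Z)$ if there is a non-negative $G\in L^2(Z,\mathfrak m)$ with $$\int|f(\gamma_1)-f(\gamma_0)|\,d\pi(\gamma)\le\int\int_0^1G(\gamma_s)|\dot\gamma_s|\,ds\,d\pi(\gamma)\quad\text{for every test plan }\pi.$$ The $\mathfrak m$-a.e. minimal such $G$ exists, is denoted $|\mathrm Df|$ or $|\mathrm D f|_Z$, and is called the minimal weak upper gradient. $W^{1,2}(Z):=S^2(Z)\cap L^2(Z,\mathfrak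 m)$. **Warped product.** For a curve $\gamma=(\gamma^I,\gamma^X):[0,1]\to I\times X$ with $\gamma^I,\gamma^X$ absolutely continuous, put $l_w[\gamma]:=\int_0^1\sqrt{|\dot\gamma^I_t|^2+w_d^2(\gamma^I_t)|\dot\gamma^X_t|^2}\,dt$. For $p,q\in I\times X$ let $d_w(p,q)$ be the infimum of $l_w[\gamma]$ over such curves with $\gamma_0=p$, $\gamma_1=q$. This is a pseudo-metric; identifying points at $d_w$-distance $0$ and completing gives the metric space $(X_w,d_w)$, $X_w:=I\times_wX$. With $\pi:I\times X\to X_w$ the natural map, $\mathfrak m_w:=\pi_*\big((w_{\mathfrak m}\mathcal L^1|_I)\times\mathfrak m\big)$. Functions on $X_w$ are written as functions of $(t,x)\in I\times X$ (via composition with $\pi$, whose image has $\mathfrak m_w$-negligible complement). Put $f^{(x)}(t):=f(t,x)$ and $f^{(t)}(x):=f(t,x)$. **Beppo Levi space.** $\mathsf{BL}(X_w)$ is the set of $f\in L^2(X_w,\mathfrak m_w)$ such that (i) for $\mathfrak m$-a.e. $x\in X$, $f^{(x)}\in W^{1,2}(I,w_{\mathfrak m}\mathcal L^1)$ (the Sobolev space of $I$ with Euclidean distance and measure $w_{\mathfrak m}\mathcal L^1|_I$); (ii) for $w_{\mathfrak m}\mathcal L^1$-a.e. $t\in I$, $f^{(t)}\in W^{1,2}(X)$; (iii) the function $|\mathrm Df|_w(t,x):=\sqrt{w_d^{-2}(t)|\mathrm Df^{(t)}|_X^2(x)+|\mathrm Df^{(x)}|_I^2(t)}$ belongs to $L^2(X_w,\mathfrak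 m_w)$, where $|\mathrm Df^{(x)}|_I$ is the minimal weak upper gradient in $(I,w_{\mathfrak m}\mathcal L^1)$. *)

(* Defs.v *)
From HB Require Import structures.
From mathcomp Require Import all_boot all_order all_algebra.
From mathcomp Require Import all_classical all_reals all_analysis.

Set Implicit Arguments.
Unset Strict Implicit.
Unset Printing Implicit Defensive.

Import Order.TTheory GRing.Theory Num.Theory.
Import numFieldNormedType.Exports.

Local Open Scope classical_set_scope.
Local Open Scope ring_scope.

(* Measurable types of the library are pointed, so metric measure spaces are
   taken nonempty. *)
#[short(type="pmetricType")]
HB.structure Definition PointedMetric (K : numDomainType) :=
  {M of Metric K M & isPointed M}.

#[short(type="completeMetricType")]
HB.structure Definition CompleteMetric (K : numDomainType) :=
  {M of Metric K M & Complete M}.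

Definition borel (T : ptopologicalType) := g_sigma_algebraType (@open T).

Definition separable (T : topologicalType) :=
  exists2 D : set T, countable D & dense D.

(* All measures below that are built from others (restriction to a subtype,
   density, pushforward) are kept as plain set functions: the library's
   integral, negligible sets and product measure accept those. *)
Section measure_tools.
Context d (T : measurableType d) (R : realType).
Implicit Types (mu : set T -> \bar R) (f : T -> R).

Definition L2 mu : set (T -> R) :=
  [set f : T -> R | measurable_fun setT f /\ (\int[mu]_z (f z ^+ 2)%:E < +oo)%E].

Definition density_measure f mu : set T -> \bar R :=
  fun A => (\int[mu]_(z in A) (f z)%:E)%E.

End measure_tools.

Definition msupport (R : realType) (T : ptopologicalType)
    (mu : set (borel T) -> \bar R) : set T :=
  [set x | forall U : set T, open U -> U x -> (0 < mu U)%E].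

Section closed_intervals.
Variable R : realType.

Record closed_interval := ClosedInterval {
  citv :> set R ;
  citv_itv : is_interval citv ;
  citv_closed : closed citv ;
  citv_nonempty : citv !=set0 }.

Definition itv_type (I : closed_interval) : Type := set_type I.

Variable I : closed_interval.

HB.instance Definition _ := PseudoMetric.on (itv_type I).

Let dist (s t : itv_type I) : R := `|set_val t - set_val s|.

Let dist_ge0 s t : 0 <= dist s t. Proof. exact: normr_ge0. Qed.

Let dist_positivity s t : dist s t = 0 -> s = t.
Proof.
by move=> /normr0_eq0/eqP; rewrite subr_eq0 => /eqP ts; apply/val_inj/esym.
Qed.

Let ballEdist (s : itv_type I) e : ball s e = [set t | dist s t < e].
Proof. by rewrite predeqE => t /=; rewrite /dist distrC. Qed.

HB.instance Definition _ := PseudoMetric_isMetric.Build R (itv_type I)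
  dist_ge0 dist_positivity ballEdist.

HB.instance Definition _ := isPointed.Build (itv_type I)
  (exist _ (projT1 (cid (citv_nonempty I)))
           (mem_set (projT2 (cid (citv_nonempty I))))).

Definition leb : set (borel (itv_type I)) -> \bar R :=
  fun A => lebesgue_measure ((set_val : itv_type I -> R) @` A).

End closed_intervals.

Section unit_interval.
Variable R : realType.

Let unit_nonempty : (`[0, 1]%classic : set R) !=set0.
Proof. by exists 0; rewrite /= in_itv /= lexx ler01. Qed.

Let unit_closed : closed (`[0, 1]%classic : set R).
Proof. exact: interval_closed. Qed.

Let unit_is_interval : is_interval (`[0, 1]%classic : set R).
Proof. exact: interval_is_interval. Qed.

Definition unit_interval : closed_interval R :=
  ClosedInterval unit_is_interval unit_closed unit_nonempty.

Definition unit_itv := itv_type unit_interval.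
HB.instance Definition _ := PointedMetric.on unit_itv.

Lemma mem_unit0 : (0 : R) \in citv unit_interval.
Proof. by rewrite inE /= in_itv /= lexx ler01. Qed.

Lemma mem_unit1 : (1 : R) \in citv unit_interval.
Proof. by rewrite inE /= in_itv /= lexx ler01. Qed.

Definition i0 : unit_itv := exist _ 0 mem_unit0.
Definition i1 : unit_itv := exist _ 1 mem_unit1.

Definition leb01 : set (borel unit_itv) -> \bar R := @leb R unit_interval.

Definition unit_le (s t : unit_itv) : bool :=
  (set_val s : R) <= (set_val t : R).

End unit_interval.
Arguments i0 {R}.
Arguments i1 {R}.
Arguments leb01 {R}.

Section curves.
Context (R : realType) (Z : pmetricType R).
Implicit Types gamma : unit_itv R -> Z.

(* The metric derivative, as an upper limit within [0, 1] so that it is defined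
   for every t; along an absolutely continuous curve the limit exists a.e. *)
Definition speed gamma (t : unit_itv R) : \bar R :=
  limf_esup (fun s : unit_itv R =>
    (mdist (gamma t) (gamma s) / mdist t s)%:E) (dnbhs t).

(* AC^p([0, 1], Z) *)
Definition abs_cont (p : nat) gamma : Prop :=
  exists g : borel (unit_itv R) -> R,
    [/\ forall t, 0 <= g t, measurable_fun setT g,
        (\int[leb01]_t (g t ^+ p)%:E < +oo)%E &
        forall s t, unit_le s t ->
          ((mdist (gamma s) (gamma t))%:E <=
           \int[leb01]_(r in [set r | unit_le s r && unit_le r t])
             (g r)%:E)%E].

Definition curve_length gamma : \bar R :=
  ereal_sup [set l | exists (n : nat) (tau : nat -> unit_itv R),
    (forall k, unit_le (tau k) (tau k.+1)) /\
    l = (\sum_(k < n) mdist (gamma (tau k)) (gamma (tau k.+1)))%:E].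

Definition length_space : Prop :=
  forall x y : Z, (mdist x y)%:E = ereal_inf [set l |
    exists gamma, [/\ continuous gamma, gamma i0 = x, gamma i1 = y &
                      l = curve_length gamma]].

(* C([0, 1], Z) with the topology of uniform convergence *)
Definition Cpath := continuousType (unit_itv R) Z.

HB.instance Definition _ := Choice.on Cpath.
HB.instance Definition _ := Topological.copy Cpath
  (initial_topology
    ((fun gamma : Cpath => gamma : unit_itv R -> Z)
      : Cpath -> {uniform unit_itv R -> Z})).

Let cst_path_continuous : continuous (fun _ : unit_itv R => point : Z).
Proof. by move=> t; exact: cst_continuous. Qed.

HB.instance Definition _ := isPointed.Build Cpath
  (mkcts cst_path_continuous).

End curves.
Arguments Cpath {R} Z.
Arguments length_space {R} Z.

Section sobolev.
Context (R : realType) (Z : pmetricType R).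
Variable mu : set (borel Z) -> \bar R.

Definition test_plan (P : probability (borel (Cpath Z)) R) : Prop :=
  [/\ exists C : R, 0 < C /\
        forall (t : unit_itv R) (A : set (borel Z)), measurable A ->
          (pushforward P (fun gamma : borel (Cpath Z) =>
             (gamma : Cpath Z) t : borel Z) A <= C%:E * mu A)%E,
      {ae P, forall gamma : Cpath Z, abs_cont 2 gamma} &
      (\int[leb01]_t \int[P]_gamma
         (speed (gamma : Cpath Z) t ^+ 2) < +oo)%E].

Definition weak_upper_gradient (f G : borel Z -> R) : Prop :=
  [/\ forall z, 0 <= G z, L2 mu G &
      forall P, test_plan P ->
        (\int[P]_gamma
           `|f ((gamma : Cpath Z) i1) - f ((gamma : Cpath Z) i0)|%:E <=
         \int[P]_gamma \int[leb01]_s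
           ((G ((gamma : Cpath Z) s))%:E * speed (gamma : Cpath Z) s))%E].

Definition minimal_weak_upper_gradient (f G : borel Z -> R) : Prop :=
  weak_upper_gradient f G /\
  forall G', weak_upper_gradient f G' -> {ae mu, forall z, G z <= G' z}.

Definition S2 : set (borel Z -> R) :=
  [set f | measurable_fun setT f /\ exists G, weak_upper_gradient f G].

Definition W12 : set (borel Z -> R) := S2 `&` L2 mu.

End sobolev.

Section warped_product.
Context (R : realType) (X : pmetricType R) (I : closed_interval R).
Variables (wd wm : itv_type I -> R).

Definition warped_length (gI : unit_itv R -> itv_type I)
    (gX : unit_itv R -> X) : \bar R :=
  (\int[leb01]_t
    sqrte (speed gI t ^+ 2 + (wd (gI t) ^+ 2)%:E * speed gX t ^+ 2))%E.

Definition warped_dist (p q : itv_type I * X) : \bar R :=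
  ereal_inf [set l | exists gI gX,
    [/\ abs_cont 1 gI, abs_cont 1 gX, (gI i0, gX i0) = p, (gI i1, gX i1) = q &
        l = warped_length gI gX]].

(* (Xw, pr) is the completion of the metric quotient of
   (I * X, warped_dist); it is unique up to isometry. *)
Definition is_warped_product (Xw : completeMetricType R)
    (pr : itv_type I * X -> Xw) : Prop :=
  (forall p q, (mdist (pr p) (pr q))%:E = warped_dist p q) /\
  dense (range pr).

Definition weighted_leb : set (borel (itv_type I)) -> \bar R :=
  density_measure (wm : borel (itv_type I) -> R) (@leb R I).

Variable m : set (borel X) -> \bar R.

Definition prod_measure
    : set (borel (itv_type I) * borel X)%type -> \bar R :=
  (weighted_leb \x m)%E.

Section projection.
Variables (Xw : completeMetricType R) (pr : itv_type I * X -> Xw).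

Definition warped_measure : set (borel Xw) -> \bar R :=
  pushforward prod_measure
    (pr : (borel (itv_type I) * borel X)%type -> borel Xw).

(* Minimal weak upper gradients are defined up to null sets, separately for
   each section of f: the last condition asks for jointly measurable
   representatives DI, DX of all of them, and for an element of L^2 of the
   warped product corresponding to |Df|_w. *)
Definition BL : set (borel Xw -> R) :=
  [set f | [/\ L2 warped_measure f,
    {ae m, forall x : X, W12 weighted_leb (fun t => f (pr (t, x)))},
    {ae weighted_leb, forall t : itv_type I, W12 m (fun x => f (pr (t, x)))} &
    exists (DI DX : (borel (itv_type I) * borel X)%type -> R)
           (Dfw : borel Xw -> R),
      [/\ measurable_fun setT DI /\ measurable_fun setT DX,
          {ae m, forall x : X, minimal_weak_upper_gradient weighted_leb
             (fun t => f (pr (t, x))) (fun t => DI (t, x))},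
          {ae weighted_leb, forall t : itv_type I,
             minimal_weak_upper_gradient m
               (fun x => f (pr (t, x))) (fun x => DX (t, x))},
          L2 warped_measure Dfw &
          {ae prod_measure, forall p : itv_type I * X,
             Dfw (pr p) =
             Num.sqrt ((wd p.1) ^- 2 * DX p ^+ 2 + DI p ^+ 2)}]]].

End projection.
End warped_product.

(* Main.v *)
(** Horizontal and vertical sections are the same situation: a family of maps
    [iota _ y : Z -> V] indexed by [y : Y] with [iota _ y] Lipschitz of constant
    [c y], where [muV] disintegrates over [nu] into images of [mu]. Given a test
    plan [M] on [Z], lift it to [V] with [y] distributed uniformly over a set of
    finite positive measure on which [c] is bounded; testing a weak upper gradient
    [G] of [f] on all these lifts shows that, for almost every [y], the function
    [f (iota _ y)] satisfies the inequality of [M] with gradient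
    [c y * G (iota _ y)]. Countably many plans decide whether a function is a weak
    upper gradient, so almost every section of [f] is Sobolev.

    Minimal weak upper gradients of the sections have to be jointly measurable.
    They are the elements of least L^2 norm among the solutions of countably many
    constraints; choosing measurably from a countable dense family nearly optimal
    solutions gives a sequence which converges by the parallelogram identity. An
    element of least norm is a.e. minimal because weak upper gradients are stable
    under minimum; this is proved curve by curve, approximating the set where one
    of them is smaller by finite unions of dyadic intervals.

    For the warped product, [mdist (pr (t, x)) (pr (s, x)) <= |t - s|], and
    [mdist (pr (t, x)) (pr (t, y)) <= wd t * d(x, y)] since [X] is a length space.
    So [DI <= G] and [DX <= wd * G], which makes |Df|_w square integrable; it
    descends to [Xw] because [pr] is injective with Borel inverse on [{wd > 0}]. *)

From HB Require Import structures.
Require Import Defs.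
From mathcomp Require Import all_boot all_order all_algebra.
From mathcomp Require Import all_classical all_reals all_analysis.
From mathcomp Require Import measurable_realfun ring lra.
Import Order.TTheory GRing.Theory Num.Theory.
Import numFieldNormedType.Exports.
Local Open Scope classical_set_scope.
Local Open Scope ring_scope.
Set Implicit Arguments.
Unset Strict Implicit.
Unset Printing Implicit Defensive.

(** * Borel sets and Lebesgue measure on closed intervals *)

(** Two obstacles of measurability shape the proof. Neither the space of curves nor [Xw] comes with
    a countable base, so an open subset of a product is measurable only because the other factor
    ([0, 1], I or X) has one. And [abs_cont 2] quantifies over majorants; it is replaced by the
    Borel condition [good_curve], which mentions the metric speed alone. The two agree on curves of
    finite energy because the speed, although a mere upper limit, bounds distances; this is proved
    by covering images in the line. Plans are finite measures rather than probabilities, since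
    restrictions and lifts of plans do not keep total mass 1. The reduction to countably many plans
    puts no topology on plans: under a bound on mass, compression and energy, both sides of the
    inequality are uniformly continuous in f and G for the L^2 distance, so the separability of L^2
    suffices. Working curve by curve needs the inequality on subsegments of almost every curve; it
    comes from the integrated one by testing on clamped curves. *)

Lemma continuous_borel (S T : ptopologicalType) (f : S -> T) :
  continuous f -> measurable_fun [set: borel S] (f : borel S -> borel T).
Proof.
move=> cf; apply: (@measurability _ _ (borel S) (borel T) setT f (@open T)) => //.
move=> _ [U oU <-]; rewrite setTI; apply: sub_sigma_algebra.
by move/continuousP : cf; apply.
Qed.

Lemma continuous_borel_real (R : realType) (T : ptopologicalType) (f : T -> R) :
  continuous f -> measurable_fun [set: borel T] (f : borel T -> R).
Proof.
move=> cf; apply: (measurability _ (RGenOpens.measurableE R)) => //.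
move=> _ [_ [a [b ->]] <-]; rewrite setTI; apply: sub_sigma_algebra.
by move/continuousP : cf; apply; exact: interval_open.
Qed.

Definition countable_base (T : topologicalType) (B : nat -> set T) :=
  (forall i, open (B i)) /\
  forall U z, open U -> U z -> exists i, B i z /\ B i `<=` U.

(** A countable generator of the Borel sets is what makes L^2 separable, through
    [finite_measure_approx]. *)
Lemma countable_base_borel (T : ptopologicalType) (B : nat -> set T) :
  countable_base B -> @measurable _ (borel T) = <<s range B >>.
Proof.
move=> [oB bB]; rewrite /measurable /=; apply/seteqP; split.
  apply: smallest_sub; first exact: smallest_sigma_algebra.
  move=> U oU.
  have -> : U = \bigcup_(i in [set i | B i `<=` U]) B i.
    apply/seteqP; split=> [z Uz|z [i /= iU Biz]]; last exact: iU.
    by have [i [Biz BiU]] := bB _ _ oU Uz; exists i.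
  rewrite bigcup_mkcond.
  have [s0 _ sU] := @smallest_sigma_algebra _ setT (range B).
  apply: sU => i; case: ifPn => _; last exact: s0.
  by apply: sub_sigma_algebra; exists i.
apply: smallest_sub; first exact: smallest_sigma_algebra.
by move=> _ [i _ <-]; apply: sub_sigma_algebra; exact: oB.
Qed.

Lemma open_borel (T : ptopologicalType) (U : set T) :
  open U -> measurable (U : set (borel T)).
Proof. by move=> oU; apply: sub_sigma_algebra. Qed.

Lemma closed_borel (T : ptopologicalType) (U : set T) :
  closed U -> measurable (U : set (borel T)).
Proof.
by move=> cU; rewrite -[U]setCK; apply: measurableC; apply: open_borel; exact: closed_openC.
Qed.

(** If V i is the largest open set whose product with B i lies in U, these products exhaust U. A
    countable base of one factor is enough, so the other may be a space of curves. *)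
Lemma open_prod_borel (S T : ptopologicalType) (B : nat -> set T) (U : set (S * T)%type) :
  countable_base B -> open U ->
  measurable (U : set (borel S * borel T)%type).
Proof.
move=> [oB bB] oU.
pose V i := \bigcup_(W in [set W : set S | open W /\ W `*` B i `<=` U]) W.
have -> : U = \bigcup_i (V i `*` B i).
  apply/seteqP; split=> [[s t] Ust|[s t] [i _ [/= [W [oW WU] Ws] Bt]]]; last first.
    exact: (WU (s, t)).
  have : nbhs (s, t) U by exact: open_nbhs_nbhs.
  move=> [[W1 W2] /= [W1s W2t]] W12.
  move: W2t; rewrite nbhsE => -[W2' [oW2' W2't] W2'W2].
  have [i [Bt BW2']] := bB _ _ oW2' W2't.
  exists i => //; split => //=.
  move: W1s; rewrite nbhsE => -[W1' [oW1' W1's] W1'W1].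
  exists W1' => //=; split => //.
  by move=> [x y] [/= W1x Biy]; apply: W12; split => //=; [exact: W1'W1|apply/W2'W2/BW2'].
apply: (@bigcupT_measurable _ (borel S * borel T)%type) => i.
apply: (@measurableX _ _ (borel S) (borel T)).
  by apply: open_borel; apply: bigcup_open => W [].
exact: open_borel.
Qed.

Section interval_borel.
Context (R : realType) (I : closed_interval R).

Lemma itv_distE (s t : itv_type I) : mdist s t = `|set_val t - set_val s|.
Proof. by []. Qed.

Lemma itv_val (s : itv_type I) : citv I (set_val s).
Proof. exact: set_valP. Qed.

Definition itv_mk (r : R) (h : citv I r) : itv_type I := exist _ r (mem_set h).

Lemma itv_mkE r h : set_val (@itv_mk r h) = r :> R.
Proof. by []. Qed.

Lemma itv_val_inj (s t : itv_type I) : set_val s = set_val t -> s = t.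
Proof. by move=> /val_inj. Qed.

Lemma set_val_continuous : continuous (set_val : itv_type I -> R).
Proof.
exact: initial_continuous. Qed.

Lemma itv_open_preimage (U : set (itv_type I)) :
  open U -> exists2 V : set R, open V & U = set_val @^-1` V.
Proof. by move=> [V oV <-]; exists V. Qed.

Lemma set_val_image_preimage (V : set R) :
  (set_val : itv_type I -> R) @` (set_val @^-1` V) = V `&` citv I.
Proof.
apply/seteqP; split=> [_ [s Vs <-]|r [Vr Ir]]; first by split => //; exact: itv_val.
by exists (itv_mk Ir).
Qed.

Lemma citv_measurable : measurable (citv I).
Proof. exact: (is_interval_measurable (@citv_itv R I)). Qed.

(** [leb] measures images in the line, so its additivity rests on images of Borel sets being
    Borel. *)
Lemma set_val_measurable_image (A : set (borel (itv_type I))) :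
  measurable A -> measurable ((set_val : itv_type I -> R) @` A).
Proof.
pose G : set (set (borel (itv_type I))) :=
  [set A | measurable ((set_val : itv_type I -> R) @` A)].
suff : (@measurable _ (borel (itv_type I))) `<=` G by apply.
apply: smallest_sub.
  split.
  - by rewrite /G /= image_set0.
  - move=> B GB; rewrite /G /= setTD.
    have -> : set_val @` (~` B) = citv I `\` (set_val @` B).
      apply/seteqP; split.
        move=> _ [s nBs <-]; split; first exact: itv_val.
        by move=> [t Bt /itv_val_inj ts]; apply: nBs; rewrite -ts.
      move=> r [Ir nBr]; exists (itv_mk Ir) => // Bs; apply: nBr.
      by exists (itv_mk Ir).
    by apply: measurableD; [exact: citv_measurable|exact: GB].
  - move=> F GF; rewrite /G /= image_bigcup.
    by apply: bigcup_measurable => i _; exact: GF.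
move=> U /itv_open_preimage[V oV ->]; rewrite /G /= set_val_image_preimage.
by apply: measurableI; [exact: open_measurable|exact: citv_measurable].
Qed.

Let leb0 : @leb R I set0 = 0%E.
Proof. by rewrite /leb image_set0 measure0. Qed.

Let leb_ge0 (A : set (borel (itv_type I))) : (0 <= leb A)%E.
Proof. exact: measure_ge0. Qed.

Let leb_semi_sigma_additive : semi_sigma_additive (@leb R I).
Proof.
move=> F mF tF mUF; rewrite /leb image_bigcup.
apply: measure_semi_sigma_additive.
- by move=> i; exact: set_val_measurable_image.
- move/trivIsetP : tF => tF; apply/trivIsetP => i j _ _ ij.
  rewrite -subset0 => r [[s Fis <-] [t Fjt /itv_val_inj ts]].
  by have := tF i j Logic.I Logic.I ij; rewrite -subset0 => /(_ s); apply; split => //; rewrite -ts.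
- by rewrite -image_bigcup; exact: set_val_measurable_image.
Qed.

HB.instance Definition _ := isMeasure.Build _ (borel (itv_type I)) R
  (@leb R I) leb0 leb_ge0 leb_semi_sigma_additive.

Let leb_sigma_finite : sigma_finite setT (@leb R I).
Proof.
exists (fun n : nat => (set_val : itv_type I -> R) @^-1` [set x | `|x| <= n%:R]).
  apply/esym/seteqP; split => // s _.
  exists (Num.truncn `|set_val s|).+1 => //=.
  by have /real_truncnS_gt/ltW := num_real `|set_val s : R|.
move=> n; split.
  apply: closed_borel.
  rewrite (_ : [set x : R | _] = closed_ball_ Num.Def.normr 0 n%:R); last first.
    by apply/seteqP; split=> x /=; rewrite /closed_ball_ /= sub0r normrN.
  have /continuous_closedP := set_val_continuous; apply; exact: closed_closed_ball_.
rewrite /leb; apply: (@le_lt_trans _ _ (lebesgue_measure (`[- n%:R, n%:R]%classic : set R))).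
  apply: le_outer_measure.
  by move=> _ [s /= sn <-]; rewrite in_itv /= -ler_norml.
by rewrite lebesgue_measure_itv /=; case: ifPn => _; rewrite -?EFinB ?ltry.
Qed.

HB.instance Definition _ := Measure_isSigmaFinite.Build _ (borel (itv_type I)) R
  (@leb R I) leb_sigma_finite.

End interval_borel.

Section unit_interval_theory.
Context (R : realType).
Implicit Types (r : R) (s t : unit_itv R).

Lemma clip_unit r : citv (unit_interval R) (Num.min 1 (Num.max 0 r)).
Proof. by rewrite /= in_itv /= le_min ler01 le_max lexx ge_min lexx. Qed.

Definition clip r : unit_itv R := itv_mk (clip_unit r).

Lemma unit_ge0 t : 0 <= set_val t :> R.
Proof. by have := itv_val t; rewrite /= in_itv /= => /andP[]. Qed.

Lemma unit_le1 t : set_val t <= 1 :> R.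
Proof. by have := itv_val t; rewrite /= in_itv /= => /andP[]. Qed.

Lemma clipE r : 0 <= r <= 1 -> set_val (clip r) = r.
Proof. by move=> /andP[r0 r1]; rewrite /clip itv_mkE max_r // min_r. Qed.

Lemma clipK t : clip (set_val t) = t.
Proof. by apply: itv_val_inj; rewrite clipE // unit_ge0 unit_le1. Qed.

Lemma clip_lip (r r' : R) : `|set_val (clip r) - set_val (clip r')| <= `|r - r'|.
Proof.
rewrite /clip !itv_mkE /Num.min /Num.max.
by do 4 case: ifPn; rewrite -?leNgt => *; rewrite ler_norml; apply/andP; split;
   have := ler_norm (r - r'); have := ler_norm (r' - r); rewrite (distrC r'); lra.
Qed.

Lemma clip_continuous : continuous clip.
Proof.
move=> r; apply/cvg_ballP => e e0; near=> x.
apply: (@le_lt_trans _ _ `|r - x|); first exact: clip_lip.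
by near: x; apply: cvgr_dist_lt => //; exact: cvg_id.
Unshelve. all: by end_near. Qed.

HB.instance Definition _ := Measure.on (@leb01 R).

Lemma leb01T : leb01 [set: borel (unit_itv R)] = 1%E :> \bar R.
Proof.
rewrite /leb01 /leb (_ : _ @` _ = `[0, 1]%classic); last first.
  apply/seteqP; split=> [_ [s _ <-]|r h]; first exact: (itv_val s).
  by exists (@itv_mk R (unit_interval R) r h).
by rewrite lebesgue_measure_itv /= lte_fin ltr01 -EFinB subr0.
Qed.

HB.instance Definition _ := Measure_isProbability.Build _ (borel (unit_itv R)) R
  (@leb01 R) leb01T.

End unit_interval_theory.

Lemma archi_lt (R : realType) (e : R) : 0 < e -> exists n : nat, n.+1%:R^-1 < e.
Proof.
move=> e0; exists (Num.truncn e^-1).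
rewrite invf_plt ?posrE ?ltr0n //.
exact: (truncnS_gt e^-1).
Qed.

Lemma continuous_subZ (R : realType) (T : topologicalType) (f h : T -> R) (q : R) :
  continuous f -> continuous h -> continuous (fun x => f x - q * h x).
Proof.
by move=> cf ch x; apply: cvgB; [exact: cf|apply: cvgM; [exact: cvg_cst|exact: ch]].
Qed.

Section mdist_continuity.
Context (R : realType) (Z : pmetricType R).

Lemma mdist_lip (x y x' y' : Z) : `|mdist x y - mdist x' y'| <= mdist x x' + mdist y y'.
Proof.
rewrite ler_norml; apply/andP; split.
  have := metric_triangle x' x y'; have := metric_triangle x y y'.
  rewrite (metric_sym x' x); lra.
have := metric_triangle x x' y; have := metric_triangle x' y' y.
rewrite (metric_sym y' y); lra.
Qed.

Lemma mdist_continuousl (T : topologicalType) (f h : T -> Z) :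
  continuous f -> continuous h -> continuous (fun t => mdist (f t) (h t) : R).
Proof.
move=> cf ch t; apply/cvgrPdist_lt => e e0; near=> s.
rewrite (le_lt_trans (mdist_lip _ _ _ _)) //.
rewrite [e]splitr ltrD //.
- have : ball (f t) (e / 2) (f s).
    by near: s; apply: cf; apply: nbhsx_ballx; rewrite divr_gt0.
  by rewrite ballEmdist.
- have : ball (h t) (e / 2) (h s).
    by near: s; apply: ch; apply: nbhsx_ballx; rewrite divr_gt0.
  by rewrite ballEmdist.
Unshelve. all: by end_near. Qed.

Lemma mball_open (x : Z) (e : R) : open (ball x e).
Proof.
rewrite ballEmdist.
have /continuousP/(_ _ (@open_lt R e)) : continuous (fun y : Z => mdist x y : R).
  by apply: (@mdist_continuousl _ (fun=> x) id); [exact: cst_continuous|move=> y].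
by [].
Qed.

End mdist_continuity.

(** * Countable bases and dense sequences *)

Lemma separable_countable_base (R : realType) (X : pmetricType R) :
  separable X -> exists B : nat -> set X, countable_base B.
Proof.
move=> [D cD dD].
have [f fE] : exists f : nat -> X, D `<=` range f.
  move: cD => /pfcard_geP[D0|[f]].
    by exists (fun=> point); rewrite D0.
  by exists f => x /(@surj _ _ _ _ f)[n _ <-]; exists n.
pose B (i : nat) := if unpickle i is Some (n, k)
  then ball (f n) (k.+1%:R^-1 : R) else set0.
exists B; split.
  move=> i; rewrite /B; case: unpickle => [[n k]|]; last exact: open0.
  exact: mball_open.
move=> U z oU Uz.
have /nbhs_ballP[e /= e0 zeU] : nbhs z U by exact: open_nbhs_nbhs.
have [k ke] : exists k : nat, k.+1%:R^-1 < e / 2 by apply: archi_lt; rewrite divr_gt0.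
have [x [zx Dx]] : ball z (k.+1%:R^-1 : R) `&` D !=set0.
  apply: dD; first by exists z; apply: ballxx; rewrite invr_gt0.
  exact: mball_open.
have [n _ fn] := fE _ Dx.
exists (pickle (n, k)); rewrite /B pickleK fn; split.
  exact: ball_sym.
move=> y xy; apply: zeU.
rewrite [e]splitr; apply: (@ball_triangle _ _ x); apply: le_ball; try exact: zx; try exact: xy; exact: ltW.
Qed.

Lemma itv_countable_base (R : realType) (I : closed_interval R) :
  exists B : nat -> set (itv_type I), countable_base B.
Proof.
pose B (i : nat) : set (itv_type I) := if unpickle i is Some (q, k)
  then set_val @^-1` ball (ratr q : R) (k.+1%:R^-1 : R) else set0.
exists B; split.
  move=> i; rewrite /B; case: unpickle => [[q k]|]; last exact: open0.
  by have /continuousP := @set_val_continuous R I; apply; apply: ball_open; rewrite invr_gt0.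
move=> U z oU Uz.
have /nbhs_ballP[e /= e0 zeU] : nbhs z U by exact: open_nbhs_nbhs.
have [k ke] : exists k : nat, k.+1%:R^-1 < e / 2 by apply: archi_lt; rewrite divr_gt0.
have [q] := @rat_in_itvoo R (set_val z) (set_val z + k.+1%:R^-1) ltac:(by rewrite ltrDl invr_gt0).
rewrite in_itv /= => /andP[zq qz].
exists (pickle (q, k)); rewrite /B pickleK; split.
  change (`|ratr q - set_val z| < k.+1%:R^-1).
  rewrite ger0_norm ?subr_ge0; last exact: ltW.
  by rewrite ltrBlDl.
move=> y yq; apply: zeU.
have {}yq : `|ratr q - set_val y| < k.+1%:R^-1 := yq.
change (`|set_val z - set_val y| < e).
rewrite (le_lt_trans (ler_distD (ratr q) _ _)) // [e]splitr ltrD //; last exact: lt_trans ke.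
rewrite ltr0_norm ?subr_lt0 // opprB (lt_trans _ ke) //.
by rewrite ltrBlDl.
Qed.

Lemma base_dense (T : ptopologicalType) (B : nat -> set T) :
  countable_base B -> exists d : nat -> T, forall U t, open U -> U t -> exists i, U (d i).
Proof.
move=> [oB bB].
exists (fun i => get (B i)) => U t oU Ut.
have [i [Bt BU]] := bB _ _ oU Ut.
by exists i; apply: BU; apply: (@getPex _ (B i)); exists t.
Qed.

Lemma ltr_succ (R : realType) (a : R) : a < a + 1.
Proof. by rewrite ltrDl. Qed.

Lemma rat_between (R : realType) (x : R) (L : \bar R) : (x%:E < L)%E ->
  exists q : rat, x <= ratr q /\ ((ratr q)%:E < L)%E.
Proof.
case: L => [l| |] //; rewrite ?lte_fin.
  move=> xl; have [q] := rat_in_itvoo xl; rewrite in_itv /= => /andP[h1 h2].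
  by exists q; rewrite lte_fin; split => //; exact: ltW.
move=> _; have [q] := rat_in_itvoo (ltr_succ x); rewrite in_itv /= => /andP[h1 h2].
by exists q; split; [exact: ltW|rewrite ltry].
Qed.

Lemma ltrD_of_sub (R : realType) (k p c : R) : k < p - c -> c + k < p.
Proof. lra. Qed.

Lemma subr_gt0W (R : realType) (k p : R) : k < p -> 0 < p - k.
Proof. lra. Qed.

(** * Functions measurable in one variable and continuous in the other *)

Section caratheodory.
Context (R : realType) (dA : measure_display) (A : measurableType dA) (T : ptopologicalType).
Variables (B : nat -> set T) (phi : A * borel T -> R).
Hypothesis bB : countable_base B.
Hypothesis phi_meas : forall t, measurable_fun setT (fun a => phi (a, t)).
Hypothesis phi_cont : forall a, continuous (fun t : T => phi (a, t)).

(** The set where phi exceeds c is a countable union of rectangles. On B i, continuity in t reduces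
    a lower bound with a margin to the points d j of a dense sequence, where it is a countable
    conjunction of measurable conditions on a. *)
Lemma caratheodory_measurable : measurable_fun setT phi.
Proof.
have [d dd] := base_dense bB.
apply: (measurability _ (RGenOInfty.measurableE R)) => //.
move=> _ [_ [c ->] <-]; rewrite setTI.
pose S i k := \bigcap_(j in [set j | B i (d j)]) [set a | c + k.+1%:R^-1 <= phi (a, d j)].
have -> : phi @^-1` `]c, +oo[%classic = \bigcup_i \bigcup_k (S i k `*` B i).
  apply/seteqP; split=> [[a t]|[a t]].
    rewrite /= in_itv /= andbT => ct.
    have [k kc] : exists k : nat, k.+1%:R^-1 < (phi (a, t) - c) / 1 by apply: archi_lt; lra.
    rewrite divr1 in kc.
    have := @phi_cont a; move/continuousP => /(_ _ (@open_gt R (c + k.+1%:R^-1))) oU.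
    have [i [Bt BU]] := bB.2 _ t oU (ltrD_of_sub kc).
    exists i => //; exists k => //; split => //= j Bij; apply/ltW.
    exact: BU.
  move=> [i _ [k _ [/= Sa Bt]]]; rewrite in_itv /= andbT.
  have h : c + k.+1%:R^-1 <= phi (a, t).
    rewrite leNgt; apply/negP => pc.
    have := @phi_cont a; move/continuousP => /(_ _ (@open_lt R (c + k.+1%:R^-1))) oU.
    have [j [Bj /= pj]] := dd (B i `&` _) t (openI (bB.1 i) oU) (conj Bt pc).
    by have := Sa j Bj; rewrite /= leNgt pj.
  by rewrite (lt_le_trans _ h) // ltrDl invr_gt0.
apply: bigcupT_measurable => i; apply: bigcupT_measurable => k.
apply: measurableX; last by apply: open_borel; exact: bB.1.
rewrite /S bigcap_mkcond; apply: bigcapT_measurable => j; case: ifPn => _ //.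
rewrite -[X in measurable X]setTI.
have := @phi_meas (d j) measurableT _ (measurable_itv `[c + k.+1%:R^-1, +oo[).
congr (measurable (_ `&` _)).
by apply/seteqP; split=> a /=; rewrite in_itv /= andbT.
Qed.

End caratheodory.

Lemma measurable_distance_to (dA : measure_display) (A : measurableType dA)
    (R : realType) (Z : pmetricType R) (f : A -> Z) :
  (forall U : set Z, open U -> measurable (f @^-1` U)) ->
  measurable_fun setT (f : A -> borel Z).
Proof.
move=> h; apply: (@measurability _ _ A (borel Z) setT f (@open Z)) => //.
by move=> _ [U oU <-]; rewrite setTI; exact: h.
Qed.

(** * Joint measurability of evaluation and of the metric speed *)

Section evaluation.
Context (R : realType) (Z : pmetricType R).
Implicit Types (g : Cpath Z) (s t : unit_itv R).

Lemma Cpath_continuous g : continuous (g : unit_itv R -> Z).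
Proof. exact: cts_fun. Qed.

Lemma Cpath_nbhs g (P : set (Cpath Z)) :
  nbhs g P <-> exists2 e : R, 0 < e &
    [set h : Cpath Z | forall t, mdist (g t) (h t) < e] `<=` P.
Proof.
split.
  move=> [Q [[W oW <-] Wg] WP].
  have /uniform_nbhs[E [entE EW]] : nbhs ((g : unit_itv R -> Z) : {uniform unit_itv R -> Z}) W.
    by apply: open_nbhs_nbhs.
  move: entE; rewrite -entourage_ballE => -[e /= e0 eE].
  exists e => // h gh; apply: WP; apply: EW => t _; apply: eE => /=.
  by rewrite ballEmdist /=; exact: gh.
move=> [e e0 eP].
have nb : nbhs ((g : unit_itv R -> Z) : {uniform unit_itv R -> Z})
    [set h : {uniform unit_itv R -> Z} | forall t, [set: unit_itv R] t -> ball (g t) e (h t)].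
  apply/uniform_nbhs; exists [set xy | ball xy.1 e xy.2]; split => //.
  by rewrite -entourage_ballE; exists e.
move: nb; rewrite nbhsE => -[W [oW Wg] WU].
exists ((fun gamma : Cpath Z => gamma : unit_itv R -> Z) @^-1` W).
split; [by exists W|by []|].
by move=> h /= Wh; apply: eP => t; have := WU _ Wh t Logic.I; rewrite ballEmdist.
Qed.

Lemma eval_continuous t : continuous (fun g : Cpath Z => g t).
Proof.
move=> g W /nbhs_ballP[e /= e0 eW]; apply/Cpath_nbhs; exists e => // h /(_ t) gh.
by apply: eW; rewrite ballEmdist.
Qed.

Lemma eval_measurable t :
  measurable_fun [set: borel (Cpath Z)] (fun g : borel (Cpath Z) => (g : Cpath Z) t : borel Z).
Proof. exact: (continuous_borel (@eval_continuous t)). Qed.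

Lemma joint_eval_measurable : measurable_fun setT
  (fun p : borel (Cpath Z) * borel (unit_itv R) => (p.1 : Cpath Z) p.2 : borel Z).
Proof.
have [B bB] := itv_countable_base (unit_interval R).
have [d dd] := base_dense bB.
apply: measurable_distance_to => U oU.
(* Curves that keep a margin larger than 1/(k+1) inside U during B i. Uniformly close curves keep a
   margin too, so a given curve lies in the interior of such a set; interiors are open, hence
   Borel. *)
pose V i k : set (Cpath Z) := \bigcup_(e in [set e : R | 0 < e])
  [set g : Cpath Z | forall t, B i t -> ball (g t) (k.+1%:R^-1 + e) `<=` U].
rewrite (_ : _ @^-1` _ = \bigcup_i \bigcup_k ((V i k)^° `*` B i)).
  apply: bigcupT_measurable => i; apply: bigcupT_measurable => k.
  apply: measurableX; apply: open_borel; [exact: open_interior|exact: bB.1].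
apply/seteqP; split=> [[g t]|[g t]] /=.
  move=> Ugt.
  have /nbhs_ballP[e /= e0 eU] : nbhs (g t) U by exact: open_nbhs_nbhs.
  have [k ke] : exists k : nat, k.+1%:R^-1 < e / 4 by apply: archi_lt; rewrite divr_gt0.
  have nb : nbhs t ((g : unit_itv R -> Z) @^-1` (ball (g t) (e / 4))^°).
    apply: Cpath_continuous; apply: open_nbhs_nbhs; split; first exact: open_interior.
    by apply: nbhsx_ballx; rewrite divr_gt0.
  move: nb; rewrite nbhsE => -[W [oW Wt] WU].
  have [i [Bt BW]] := bB.2 _ _ oW Wt.
  exists i => //; exists k => //; split => //=.
  rewrite /interior /=; apply/Cpath_nbhs; exists (e / 4); first by rewrite divr_gt0.
  move=> h gh; exists (e / 4); first by rewrite /= divr_gt0.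
  move=> s Bs z hz; apply: eU.
  have : ball (g t) (e / 4) (g s) by apply: interior_subset; apply: WU; apply: BW.
  have h2 : ball (g s) (e / 4) (h s) by rewrite ballEmdist; exact: gh.
  move=> h3; apply: le_ball (ball_triangle h3 (ball_triangle h2 hz)).
  have aux (k' e' : R) : k' < e' / 4 -> e' / 4 + (e' / 4 + (k' + e' / 4)) <= e' by lra.
  exact: aux.
move=> [i _ [k _ [/interior_subset [e /= e0 h] Bt]]].
by apply: (h _ Bt); apply: ballxx; rewrite addr_gt0.
Qed.

Lemma joint_mdist_measurable s : measurable_fun setT
  (fun p : borel (Cpath Z) * borel (unit_itv R) =>
     mdist ((p.1 : Cpath Z) p.2) ((p.1 : Cpath Z) s) : R).
Proof.
have [B bB] := itv_countable_base (unit_interval R).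
apply: (caratheodory_measurable bB) => [t|g] /=.
  by apply: continuous_borel_real; apply: mdist_continuousl; exact: eval_continuous.
apply: mdist_continuousl; first exact: Cpath_continuous.
exact: cst_continuous.
Qed.

End evaluation.

Section speed_theory.
Context (R : realType) (Z : pmetricType R).
Implicit Types (g : unit_itv R -> Z) (s t : unit_itv R).

Lemma dnbhs_unitP t (V : set (unit_itv R)) : dnbhs t V <->
  exists n : nat, forall s, s != t -> `|set_val s - set_val t| < n.+1%:R^-1 -> V s.
Proof.
split.
  move=> /nbhs_ballP[e /= e0 eV].
  have [n ne] := archi_lt e0.
  exists n => s st snt; apply: eV => //.
  by rewrite ballEmdist /=; apply: lt_trans ne; exact: snt.
move=> [n nV]; apply/nbhs_ballP; exists n.+1%:R^-1; first by rewrite /= invr_gt0.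
by move=> s; rewrite ballEmdist /= => ts st; exact: nV.
Qed.

Lemma dnbhs_unit_proper t : ~ dnbhs t set0.
Proof.
move=> /dnbhs_unitP[n nV].
(* The shift 1/(n+2) is below 1/(n+1) and at most 1/2, so moving away from the nearer end stays in
   the unit interval. *)
pose r : R := if set_val t < 2^-1 then set_val t + n.+2%:R^-1 else set_val t - n.+2%:R^-1.
have n0 : 0 < n.+2%:R^-1 :> R by rewrite invr_gt0.
have n2 : n.+2%:R^-1 <= 2^-1 :> R by rewrite lef_pV2 ?posrE ?ltr0n // ler_nat.
have nn : n.+2%:R^-1 < n.+1%:R^-1 :> R by rewrite ltf_pV2 ?posrE ?ltr0n // ltr_nat.
have t0 := unit_ge0 t; have t1 := unit_le1 t.
have aux (v k : R) : 0 < k -> k <= 2^-1 -> 0 <= v -> v <= 1 ->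
    0 <= (if v < 2^-1 then v + k else v - k) <= 1.
  by case: ifPn; rewrite -?leNgt => *; apply/andP; split; lra.
have r01 : 0 <= r <= 1 by exact: aux.
have rt : `|r - set_val t| = n.+2%:R^-1.
  rewrite /r; case: ifPn => _; first by rewrite addrAC subrr add0r gtr0_norm.
  by rewrite addrAC subrr add0r normrN gtr0_norm.
apply: (nV (clip r)); last by rewrite clipE // rt.
apply/eqP => /(congr1 set_val); rewrite clipE // => rt'.
by move: rt; rewrite rt' subrr normr0 => /esym/eqP; rewrite gt_eqF.
Qed.

Lemma speed_ge0 g t : (0 <= speed g t)%E.
Proof.
apply: limf_esup_ge0; first exact: dnbhs_unit_proper.
by move=> s; rewrite lee_fin divr_ge0 // mdist_ge0.
Qed.

(** Rational slopes turn the upper limit into a countable union of local Lipschitz conditions. The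
    measurability of the speed and the later comparisons of speeds all rest on this form. *)
Lemma speed_lt g t (c : \bar R) : (speed g t < c)%E <->
  exists q : rat, ((ratr q)%:E < c)%E /\ exists n : nat, forall s,
    `|set_val s - set_val t| < n.+1%:R^-1 ->
    mdist (g t) (g s) <= ratr q * `|set_val s - set_val t|.
Proof.
split.
  rewrite /speed /limf_esup => /ereal_inf_lt[_ [V tV <-] Vc].
  have V0 : V !=set0.
    by apply/set0P/negP => /eqP V0; apply: (@dnbhs_unit_proper t); rewrite -V0.
  have [q [Vq qc]] : exists q : rat, (ereal_sup
      [set ((mdist (g t) (g s) / mdist t s)%:E) | s in V] < (ratr q)%:E)%E /\ ((ratr q)%:E < c)%E.
    set S := ereal_sup _ in Vc *.
    have S0 : (0 <= S)%E.
      have [s Vs] := V0; apply: ereal_sup_ge; exists (mdist (g t) (g s) / mdist t s)%:E.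
        by exists s.
      by rewrite lee_fin divr_ge0 // mdist_ge0.
    case: S Vc S0 => [a| |] //=; case: c => [c| |] //=.
    - rewrite lte_fin => ac _.
      have [q] := rat_in_itvoo ac; rewrite in_itv /= => /andP[? ?].
      by exists q; rewrite !lte_fin.
    - move=> _ _; have [q] := @rat_in_itvoo R a (a + 1) (ltr_succ a).
      by rewrite in_itv /= => /andP[? ?]; exists q; rewrite lte_fin ltry.
  exists q; split => //.
  have /dnbhs_unitP[n nV] := tV.
  exists n => s sn; have [->|st] := eqVneq s t.
    by rewrite mdistxx subrr normr0 mulr0.
  have ts0 : 0 < `|set_val s - set_val t|.
    by rewrite normr_gt0 subr_eq0; apply: contra st => /eqP /itv_val_inj ->.
  rewrite -ler_pdivrMr // -lee_fin; apply: le_trans (ltW Vq).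
  by apply: ereal_sup_ubound; exists s => //; exact: nV.
move=> [q [qc [n h]]]; apply: le_lt_trans qc.
rewrite /speed /limf_esup.
apply: (@le_trans _ _ (ereal_sup [set (mdist (g t) (g s) / mdist t s)%:E |
   s in [set s | s != t /\ `|set_val s - set_val t| < n.+1%:R^-1]])).
  apply: ereal_inf_lbound; eexists; last by reflexivity.
  by apply/dnbhs_unitP; exists n.
apply: ge_ereal_sup => _ [s [st sn] <-].
rewrite lee_fin ler_pdivrMr ?mdist_gt0 1?eq_sym //; exact: h.
Qed.

End speed_theory.

Section speed_measurability.
Context (R : realType) (Z : pmetricType R).
Implicit Types (g : Cpath Z) (s t : unit_itv R).

Let M := (borel (Cpath Z) * borel (unit_itv R))%type.

Definition slow_near (q : R) (n : nat) (g : unit_itv R -> Z) : set (unit_itv R) :=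
  [set t | forall s, `|set_val s - set_val t| < n.+1%:R^-1 ->
    mdist (g t) (g s) <= q * `|set_val s - set_val t|].

Lemma set_val_dist_continuous s : continuous (fun t : unit_itv R => `|set_val s - set_val t| : R).
Proof.
have h : continuous (fun t : unit_itv R => mdist t s : R).
  by apply: mdist_continuousl; [move=> ?|exact: cst_continuous].
exact: h.
Qed.

Lemma slow_near_measurable (q : R) n :
  measurable ([set p | slow_near q n (p.1 : Cpath Z) p.2] : set M).
Proof.
have [B bB] := itv_countable_base (unit_interval R).
have [d dd] := base_dense bB.
(* Along a continuous curve both sides of the condition are continuous in s, so s may run over a
   dense sequence. *)
have -> : [set p : M | slow_near q n (p.1 : Cpath Z) p.2] = \bigcap_j
    ([set p : M | n.+1%:R^-1 <= `|set_val (d j) - set_val p.2| ] `|`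
     [set p : M | mdist ((p.1 : Cpath Z) p.2) ((p.1 : Cpath Z) (d j)) -
                  q * `|set_val (d j) - set_val p.2| <= 0]).
  apply/seteqP; split=> [[g t] /= h j _|[g t] /= h s st].
    have [?|?] := leP n.+1%:R^-1 `|set_val (d j) - set_val t|; first by left.
    by right; rewrite /= subr_le0; exact: h.
  rewrite leNgt; apply/negP => qs.
  pose F (x : unit_itv R) : R := mdist (g t) (g x) - q * `|set_val x - set_val t|.
  have dc : continuous (fun x : unit_itv R => `|set_val x - set_val t| : R).
    have h' : continuous (fun x : unit_itv R => mdist t x : R).
      by apply: mdist_continuousl; [exact: cst_continuous|move=> ?].
    exact: h'.
  have cF : continuous F.
    apply: continuous_subZ => //.
    apply: mdist_continuousl; [exact: cst_continuous|exact: Cpath_continuous].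
  have /continuousP/(_ _ (@open_gt R 0)) oF := cF.
  have /continuousP/(_ _ (@open_lt R n.+1%:R^-1)) oD := dc.
  have [j [/= Fj dj]] := dd _ s (openI oF oD) (conj (subr_gt0W qs) st).
  have [/=|/=] := h j Logic.I; first by rewrite leNgt dj.
  by rewrite leNgt Fj.
apply: bigcapT_measurable => j; apply: measurableU.
  have m1 : measurable_fun setT (fun p : M => `|set_val (d j) - set_val p.2| : R).
    apply: (measurableT_comp (f := fun t : borel (unit_itv R) => `|set_val (d j) - set_val t| : R)).
      by apply: continuous_borel_real; exact: set_val_dist_continuous.
    exact: measurable_snd.
  have := m1 measurableT _ (measurable_itv `[n.+1%:R^-1, +oo[).
  rewrite setTI; congr (measurable _).
  by apply/seteqP; split=> p /=; rewrite in_itv /= andbT.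
have m1 : measurable_fun setT (fun p : M => mdist ((p.1 : Cpath Z) p.2) ((p.1 : Cpath Z) (d j)) -
                  q * `|set_val (d j) - set_val p.2| : R).
  apply: measurable_funB; first exact: joint_mdist_measurable.
  apply: measurable_funM => //.
  apply: (measurableT_comp (f := fun t : borel (unit_itv R) => `|set_val (d j) - set_val t| : R)).
    by apply: continuous_borel_real; exact: set_val_dist_continuous.
  exact: measurable_snd.
have := m1 measurableT _ (measurable_itv `]-oo, 0]).
by rewrite setTI; congr (measurable _).
Qed.

Lemma speed_measurable : measurable_fun setT (fun p : M => speed (p.1 : Cpath Z) p.2).
Proof.
apply: (measurability _ (ErealGenInftyO.measurableE R)) => //.
move=> _ [_ [r ->] <-]; rewrite setTI.
have -> : (fun p : M => speed (p.1 : Cpath Z) p.2) @^-1` `]-oo, r%:E[%classic =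
   \bigcup_(q in [set q : rat | ratr q < r]) \bigcup_n [set p : M | slow_near (ratr q) n (p.1 : Cpath Z) p.2].
  apply/seteqP; split=> p /=.
    rewrite in_itv /= => /speed_lt[q [qr [n h]]].
    by exists q; [rewrite /= -lte_fin|exists n].
  move=> [q /= qr [n _ h]]; rewrite in_itv /=; apply/speed_lt; exists q.
  by rewrite lte_fin; split => //; exists n.
rewrite bigcup_mkcond; apply: bigcupT_measurable_rat => q; case: ifPn => _ //.
by apply: bigcupT_measurable => n; exact: slow_near_measurable.
Qed.

End speed_measurability.

Lemma continuous_compT (S T U : topologicalType) (f : S -> T) (g : T -> U) :
  continuous f -> continuous g -> continuous (fun x => g (f x)).
Proof. by move=> cf cg x; apply: continuous_comp; [exact: cf|exact: cg]. Qed.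

(** * Outer bounds for the measure of subsets of the line *)

Section covering.
Context (R : realType).
Implicit Types (A B : set R) (r : \bar R).

(** An upper bound on outer measure with a Borel witness: the sets in question are images of Borel
    sets, which need not be Borel. *)
Definition covered B r := exists C : set R,
  [/\ measurable C, B `<=` C & (lebesgue_measure C <= r)%E].

Lemma covered_le B r r' : (r <= r')%E -> covered B r -> covered B r'.
Proof. by move=> rr' [C [mC BC Cr]]; exists C; split => //; exact: le_trans rr'. Qed.

Lemma covered_bigcup (B : nat -> set R) (r : nat -> \bar R) :
  (forall i, covered (B i) (r i)) -> covered (\bigcup_i B i) (\sum_(0 <= i <oo) r i).
Proof.
move=> /choice[C hC]; exists (\bigcup_i C i).
have mC i : measurable (C i) by have [] := hC i.
split; first exact: bigcupT_measurable.
  by apply: subset_bigcup => i _; have [] := hC i.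
apply: le_trans; first by apply: generalized_Boole_inequality => //; exact: bigcupT_measurable.
by apply: lee_nneseries => // i _; have [] := hC i.
Qed.

Lemma covered_setU A B r r' : covered A r -> covered B r' -> covered (A `|` B) (r + r').
Proof.
move=> [C [mC AC Cr]] [D [mD BD Dr]]; exists (C `|` D); split.
- exact: measurableU.
- exact: setUSS.
- by apply: le_trans (leeD Cr Dr); exact: measureU2.
Qed.

Lemma covered_diam B r : (0 <= r)%E ->
  (forall x y, B x -> B y -> (`|x - y|%:E <= r)%E) -> covered B r.
Proof.
have [->|/set0P[z Bz]] := eqVneq B set0.
  by move=> r0 _; exists set0; split=> //; rewrite measure0.
case: r => [r| |] // r0 h; last by exists setT; split => //; rewrite leey.
have h' x y : B x -> B y -> x <= y + r.
  move=> Bx By; rewrite -lerBlDl; apply: le_trans (ler_norm _) _.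
  by rewrite -lee_fin; exact: h.
have ub : has_ubound B by exists (z + r) => x Bx; exact: h'.
have lb : has_lbound B by exists (z - r) => x Bx; rewrite lerBlDr; exact: h'.
exists `[inf B, sup B]%classic; split => //.
  by move=> x Bx; rewrite /= in_itv /= ge_inf //= ub_le_sup.
rewrite lebesgue_measure_itv /=; case: ifPn => _ //.
rewrite -EFinB lee_fin lerBlDr -lerBlDl.
apply: lb_le_inf; first by exists z.
by move=> x Bx; rewrite lerBlDr; apply: ge_sup; [exists z|move=> y By; exact: h'].
Qed.

End covering.

(** * The metric speed controls distances along absolutely continuous curves *)

Section segments.
Context (R : realType).
Implicit Types (s t : unit_itv R).
Let T := borel (unit_itv R).

Definition seg s t : set T := [set r | unit_le s r && unit_le r t].

Lemma segE s t : seg s t = set_val @^-1` `[set_val s, set_val t]%classic.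
Proof. by apply/seteqP; split=> r /=; rewrite in_itv. Qed.

Lemma measurable_seg s t : measurable (seg s t).
Proof.
rewrite segE; apply: closed_borel.
have /continuous_closedP := @set_val_continuous R (unit_interval R); apply.
exact: interval_closed.
Qed.

Lemma leb01_seg s t : unit_le s t -> leb01 (seg s t) = (set_val t - set_val s)%:E.
Proof.
rewrite /unit_le => st; rewrite segE /leb01 /leb set_val_image_preimage.
rewrite (_ : _ `&` _ = `[set_val s, set_val t]%classic); last first.
  apply/seteqP; split=> [r []//|r rst]; split => //.
  move: rst; rewrite /= !in_itv /= => /andP[sr rt].
  by rewrite (le_trans (unit_ge0 s) sr) (le_trans rt (unit_le1 t)).
rewrite lebesgue_measure_itv /= lte_fin.
by have [|] := ltP; [rewrite EFinB|move=> ts; have -> : set_val t = set_val s; [apply/eqP; rewrite eq_le ts st|rewrite subrr]].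
Qed.

Lemma integral_seg_cst s t (c : R) : unit_le s t ->
  (\int[leb01]_(r in seg s t) c%:E = (c * (set_val t - set_val s))%:E)%E.
Proof.
move=> st; rewrite EFinM -leb01_seg //.
exact: (integral_cst (@leb01 R) (measurable_seg s t) c%:E).
Qed.

Lemma unit_le_total s t : unit_le s t \/ unit_le t s.
Proof. by rewrite /unit_le; case: (leP (set_val s : R) (set_val t)) => [|/ltW]; [left|right]. Qed.

Definition seg_closed (J : set T) := forall s t, J s -> J t -> seg s t `<=` J.

(** Outer regularity puts A in an open set of nearly the same measure, and the [J i] are the
    components of that open set; being intervals, they contain the segment between any two of their
    points. *)
Lemma leb01_cover (A : set T) (d : R) : measurable A -> 0 < d ->
  exists J : nat -> set T, [/\ forall i, measurable (J i), forall i, seg_closed (J i),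
    trivIset setT J, A `<=` \bigcup_i J i & (leb01 ((\bigcup_i J i) `\` A) < d%:E)%E].
Proof.
move=> mA d0.
have mD := set_val_measurable_image mA.
have Dfin : (lebesgue_measure ((set_val : unit_itv R -> R) @` A) < +oo)%E.
  apply: (@le_lt_trans _ _ (leb01 [set: T])); last by rewrite leb01T ltry.
  apply: (@le_measure _ _ _ (@leb01 R)); rewrite ?inE //.
have [U [oU DU Ud]] := lebesgue_regularity_outer mD Dfin d0.
exists (fun i => set_val @^-1` (open_disjoint_itv oU i)); split.
- move=> i; apply: open_borel.
  have /continuousP := @set_val_continuous R (unit_interval R); apply.
  exact: open_disjoint_itv_open.
- move=> i s t Js Jt; rewrite segE => r /=; rewrite in_itv /= => srt.
  exact: (open_disjoint_itv_is_interval Js Jt).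
- apply/trivIsetP => i j _ _ ij.
  have /trivIsetP/(_ i j Logic.I Logic.I ij) := @open_disjoint_itv_trivIset R U oU.
  by rewrite -!subset0 => h r [/= ri rj]; apply: (h (set_val r)).
- by move=> r Ar; rewrite -preimage_bigcup -open_disjoint_itv_bigcup; apply: DU; exists r.
- rewrite -preimage_bigcup -open_disjoint_itv_bigcup.
  apply: le_lt_trans Ud; rewrite /leb01 /leb; apply: le_outer_measure.
  move=> _ [r [Ur Ar] <-]; split => // -[r' Ar' /itv_val_inj rr']; apply: Ar.
  by rewrite -rr'.
Qed.

Lemma abs_cont_integral (a : T -> R) (e : R) : (forall t, 0 <= a t) -> measurable_fun setT a ->
  (\int[leb01]_t (a t)%:E < +oo)%E -> 0 < e ->
  exists d : R, 0 < d /\ forall A, measurable A -> (leb01 A < d%:E)%E ->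
    (\int[leb01]_(t in A) (a t)%:E < e%:E)%E.
Proof.
move=> a0 ma ia e0.
have iaf : (leb01 : set T -> \bar R).-integrable setT (EFin \o a).
  apply/integrableP; split; first exact/measurable_EFinP.
  by under eq_integral do rewrite /= ger0_norm //.
have [d [d0 hd]] := integral_normr_continuous iaf e0.
exists d; split => // A mA Ad.
have := hd _ mA Ad; rewrite -lte_fin; apply: le_lt_trans.
rewrite /Rintegral fineK.
  by apply: ge0_le_integral => //; [move=> *; rewrite lee_fin|exact/measurable_funTS/measurable_EFinP|
    apply/measurable_funTS/measurable_EFinP/measurableT_comp => //|move=> t _; rewrite lee_fin ler_norm].
rewrite ge0_fin_numE; last by apply: integral_ge0 => *; rewrite lee_fin.
apply: le_lt_trans ia.
under eq_integral do rewrite ger0_norm //.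
by apply: ge0_subset_integral => //; [exact/measurable_EFinP|move=> *; rewrite lee_fin].
Qed.

(** On a component J of a tight cover of F, the image of the part of F in J has diameter at most the
    integral of a over J, since segments with ends in J stay in J. The part of the cover outside F
    costs at most e. *)
Lemma covered_image (phi : T -> R) (a : T -> R) (F : set T) (e : R) :
  (forall t, 0 <= a t) -> measurable_fun setT a -> (\int[leb01]_t (a t)%:E < +oo)%E ->
  measurable F -> (forall s t, F s -> F t -> unit_le s t ->
    (`|phi s - phi t|%:E <= \int[leb01]_(r in seg s t) (a r)%:E)%E) ->
  0 < e -> covered (phi @` F) (\int[leb01]_(r in F) (a r)%:E + e%:E)%E.
Proof.
move=> a0 ma ia mF h e0.
have maE : measurable_fun setT (EFin \o a) by exact/measurable_EFinP.
have [d [d0 hd]] := abs_cont_integral a0 ma ia e0.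
have [J [mJ cJ tJ FJ Jd]] := leb01_cover mF d0.
have mUJ : measurable (\bigcup_i J i) by exact: bigcupT_measurable.
apply: (@covered_le _ _ (\sum_(0 <= i <oo) \int[leb01]_(r in J i) (a r)%:E)%E).
  rewrite -ge0_integral_bigcup //; last 2 first.
    exact: measurable_funTS.
    by move=> *; rewrite lee_fin.
  rewrite -[X in (\int[_]_(_ in X) _)%E](setDUK FJ) ge0_integral_setU //.
  - by rewrite leeD2l // ltW //; apply: hd => //; exact: measurableD.
  - exact: measurableD.
  - exact: measurable_funTS.
  - by move=> *; rewrite lee_fin.
  - by apply/disj_setPS => x [? []].
have -> : phi @` F = \bigcup_i (phi @` (F `&` J i)).
  rewrite -image_bigcup -setI_bigcupr; congr (_ @` _).
  by apply/seteqP; split=> [x Fx|x []//]; split => //; exact: FJ.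
apply: covered_bigcup => i; apply: covered_diam.
  by apply: integral_ge0 => *; rewrite lee_fin.
have main s t : (F `&` J i) s -> (F `&` J i) t -> unit_le s t ->
    (`|phi s - phi t|%:E <= \int[leb01]_(r in J i) (a r)%:E)%E.
  move=> [Fs Js] [Ft Jt] st; apply: le_trans (h _ _ Fs Ft st) _.
  apply: ge0_subset_integral => //.
  - exact: measurable_seg.
  - exact: measurable_funTS.
  - by move=> *; rewrite lee_fin.
  - exact: cJ.
move=> _ _ [s Ss <-] [t St <-].
by have [st|ts] := unit_le_total s t; [exact: main|rewrite distrC; exact: main].
Qed.

End segments.

Section metric_derivative.
Context (R : realType) (Z : pmetricType R).
Implicit Types (s t : unit_itv R).
Let T := borel (unit_itv R).

Definition ac_bound (g : unit_itv R -> Z) (a : T -> R) :=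
  [/\ forall t, 0 <= a t, measurable_fun setT a,
      (\int[leb01]_t (a t)%:E < +oo)%E &
      forall s t, unit_le s t ->
        ((mdist (g s) (g t))%:E <= \int[leb01]_(r in seg s t) (a r)%:E)%E].

Lemma ac_bound_continuous (g : unit_itv R -> Z) (a : T -> R) : ac_bound g a -> continuous g.
Proof.
move=> [a0 ma ia h] t W /nbhs_ballP[e /= e0 eW].
have [d [d0 hd]] := abs_cont_integral a0 ma ia e0.
have main s s' : unit_le s s' -> `|set_val s - set_val s'| < d -> mdist (g s) (g s') < e.
  move=> ss' sd; rewrite -lte_fin; apply: le_lt_trans (h _ _ ss') _.
  apply: hd; first exact: measurable_seg.
  rewrite leb01_seg // lte_fin -[ltLHS]ger0_norm ?subr_ge0 // distrC //.
apply/nbhs_ballP; exists d => // s ts; apply: eW; rewrite ballEmdist /=.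
have {}ts : `|set_val t - set_val s| < d := ts.
have [st|st] := unit_le_total t s; first exact: main.
by rewrite metric_sym; apply: main => //; rewrite distrC.
Qed.

Lemma speed_measurable1 (g : Cpath Z) : measurable_fun setT (fun t : T => speed g t).
Proof.
apply: (measurableT_comp (@speed_measurable R Z) (g := fun t : T => (g : borel (Cpath Z), t))).
exact: measurable_pair1.
Qed.

Lemma slow_near_measurable1 (g : Cpath Z) (q : R) n : measurable (slow_near q n g : set T).
Proof.
have := @measurable_pair1 _ _ (borel (Cpath Z)) T g measurableT _ (@slow_near_measurable R Z q n).
by rewrite setTI.
Qed.

(* With [phi := mdist (g s)], the image under [phi] of [seg s t] covers
   [[0, mdist (g s) (g t)]], and [phi] is locally Lipschitz of constant about [q]
   on the set where the speed is below [q]. *)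
Lemma mdist_le_int_speed (g : Cpath Z) (a : T -> R) : ac_bound g a ->
  forall s t, unit_le s t ->
    ((mdist (g s) (g t))%:E <= \int[leb01]_(r in seg s t) speed g r)%E.
Proof.
move=> [a0 ma ia h] s t st.
set A := seg s t.
have mA : measurable A by exact: measurable_seg.
have mS : measurable_fun setT (fun t : T => speed g t) by exact: speed_measurable1.
have S0 r : (0 <= speed g r)%E by exact: speed_ge0.
have [->|Sfin] := eqVneq (\int[leb01]_(r in A) speed g r)%E +oo%E; first by rewrite leey.
have {}Sfin : (\int[leb01]_(r in A) speed g r < +oo)%E by rewrite ltey.
have Sint : (leb01 : set T -> \bar R).-integrable A (fun r => speed g r).
  apply/integrableP; split; first exact: measurable_funTS.
  by under eq_integral do rewrite gee0_abs //.
pose phi (x : T) : R := mdist (g s) (g x).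
have phid x y : `|phi x - phi y| <= mdist (g x) (g y).
  by apply: le_trans (mdist_lip _ _ _ _) _; rewrite mdistxx add0r.
pose N := A `&` [set r | speed g r = +oo%E].
have mN : measurable N.
  apply: measurableI => //.
  have := mS measurableT _ (@emeasurable_set1 R +oo%E).
  by rewrite setTI.
have N0 : leb01 N = 0%E.
  have [B [mB B0 AB]] := integrable_ae mA Sint.
  apply/eqP; rewrite -measure_le0 -B0; apply: le_measure; rewrite ?inE //.
  by move=> r [Ar /= Sr]; apply: AB => /= /(_ Ar); rewrite Sr.
apply/lee_addgt0Pr => e0 e0_gt0.
(* Three errors of size e occur: one for the null set N, one for raising the speed to speed + e on a
   segment of length at most 1, one for the sum of the errors of the covers. *)
pose e : R := e0 / 3.
have e_gt0 : 0 < e by rewrite divr_gt0.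
(* Cells of length 1/(n+1), the scale of [slow_near _ n]: two points of a cell are close enough for
   the local slope q to apply to them. The set G m collects the points of a cell where the slope q
   is valid at this scale and exceeds the speed by at most e. *)
pose cell (n k : nat) : set T := [set x | k%:R <= n.+1%:R * (set_val x : R) < k.+1%:R].
pose cf (m : nat) : R := if (unpickle m : option (rat * nat * nat)) is Some (q, _, _) then ratr (q : rat) else 0.
pose G (m : nat) : set T := if (unpickle m : option (rat * nat * nat)) is Some (q, n, k) then
  if 0 <= q then A `&` [set r | ((ratr (q : rat) - e)%:E <= speed g r)%E] `&` slow_near (ratr q) n g `&` cell n k
  else set0 else set0.
have mcell n k : measurable (cell n k).
  have mv : measurable_fun setT (fun x : T => n.+1%:R * (set_val x : R)).
    apply: measurable_funM => //; apply: continuous_borel_real; exact: set_val_continuous.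
  have := mv measurableT _ (measurable_itv `[k%:R, k.+1%:R[).
  by rewrite setTI; congr (measurable _); apply/seteqP; split => x; rewrite /cell /= in_itv.
have mG m : measurable (G m).
  rewrite /G; case: unpickle => [[[q n] k]|] //; case: ifPn => _ //.
  apply: measurableI => //; apply: measurableI; last exact: slow_near_measurable1.
  apply: measurableI => //.
  have := mS measurableT _ (@emeasurable_itv R `[(ratr q - e)%:E, +oo[).
  by rewrite setTI; congr (measurable _); apply/seteqP; split => x; rewrite /= in_itv /= andbT.
have GA m : G m `<=` A.
  rewrite /G; case: unpickle => [[[q n] k]|] //; case: ifPn => _ // x; first by move=> [[[]]].
have Gc m x : G m x -> 0 <= cf m /\ ((cf m)%:E <= speed g x + e%:E)%E.
  rewrite /G /cf; case: unpickle => [[[q n] k]|] //; case: ifPn => // q0 [[[_ /= qx] _] _].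
  by rewrite ler0q; split => //; rewrite EFinB leeBlDr // in qx.
have Glip m x y : G m x -> G m y -> `|phi x - phi y| <= cf m * `|set_val x - set_val y|.
  rewrite /G /cf; case: unpickle => [[[q n] k]|] //; case: ifPn => // q0 [[_ sx] /andP[cx cx']] [_ /andP[cy cy']].
  apply: le_trans (phid _ _) _; rewrite distrC; apply: sx.
  have n0 : 0 < n.+1%:R :> R by rewrite ltr0n.
  rewrite -(ltr_pM2l n0) mulfV ?gt_eqF // -[X in X * `|_|]gtr0_norm // -normrM mulrBr.
  have aux (u v k' k'' : R) : k'' = k' + 1 -> k' <= u -> u < k'' -> k' <= v -> v < k'' -> `|v - u| < 1.
    by move=> *; rewrite ltr_norml; apply/andP; split; lra.
  by apply: (aux _ _ k%:R k.+1%:R) => //; rewrite -natr1.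
have AG : A `<=` N `|` \bigcup_m G m.
  move=> x Ax; have [Sx|Sx] := eqVneq (speed g x) +oo%E; first by left.
  have {}Sx : speed g x \is a fin_num by rewrite ge0_fin_numE // ltey.
  right; set r := fine (speed g x).
  have rE : speed g x = r%:E by rewrite fineK.
  have r0 : 0 <= r by exact: fine_ge0.
  (* [speed_lt] gives a slope q below q' that may be far below r + e in an uncontrolled way; q'
     itself is then also a valid slope, and it lies within e of the speed. *)
  have [q'] := @rat_in_itvoo R r (r + e) ltac:(by rewrite ltrDl).
  rewrite in_itv /= => /andP[rq' q'e].
  have /speed_lt[q [qq' [n hn]]] : (speed g x < (ratr q')%:E)%E by rewrite rE lte_fin.
  have q'0 : 0 <= q'.
    by rewrite -(ler0q R) (le_trans r0) // ltW.
  exists (pickle (q', n, Num.truncn (n.+1%:R * (set_val x : R)))); first exact: Logic.I.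
  rewrite /G pickleK q'0; split; last first.
    have nx0 : 0 <= n.+1%:R * (set_val x : R) by rewrite mulr_ge0 // unit_ge0.
    by rewrite /cell /=; apply: truncn_itv.
  split; first by split => //=; rewrite rE lee_fin lerBlDr ltW.
  move=> y xy; apply: le_trans (hn _ xy) _; rewrite ler_wpM2r //.
  by move: qq'; rewrite lte_fin => /ltW.
pose F := seqDU G.
have mF m : measurable (F m) by exact: seqDU_measurable.
have FG m : F m `<=` G m by exact: subset_seqDU.
have tF : trivIset setT F by exact: trivIset_seqDU.
have FA : \bigcup_m F m `<=` A by move=> x [m _ /FG /GA].
have covF m : covered (phi @` F m) (\int[leb01]_(r in F m) (speed g r + e%:E) + (e / (2 ^ m.+1)%:R)%:E)%E.
  have [F0|/set0P[z Fz]] := eqVneq (F m) set0.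
    by rewrite F0 image_set0; exists set0; split => //; rewrite measure0 adde_ge0 // ?lee_fin ?integral_set0 // divr_ge0 // ltW.
  have [c0 _] := Gc m z (FG _ _ Fz).
  have c0' := c0.
  apply: (@covered_le _ _ (\int[leb01]_(r in F m) (cf m)%:E + (e / (2 ^ m.+1)%:R)%:E)%E).
    rewrite leeD2r //; apply: ge0_le_integral => //.
    - by apply: emeasurable_funD => //; exact: measurable_funTS.
    - by move=> x Fx; have [] := Gc m x (FG _ _ Fx).
  apply: (@covered_image R phi (fun=> cf m)) => //.
  - by rewrite integral_cst // [X in (_ * X)%E](@leb01T R) mule1 ltry.
  - move=> x y Fx Fy xy.
    rewrite integral_seg_cst // lee_fin; apply: le_trans (Glip m _ _ _ _) _; try exact: FG.
    by rewrite distrC ger0_norm // subr_ge0.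
  - by rewrite divr_gt0 // ltr0n expn_gt0.
(* On N the speed gives no Lipschitz bound. The majorant a does, and its integral over a null set
   vanishes. *)
have covN : covered (phi @` N) (0 + e%:E)%E.
  rewrite -(null_set_integral (f := fun r => (a r)%:E) mN _ N0); last first.
    by apply: measurable_funTS; exact/measurable_EFinP.
  apply: covered_image => // x y _ _ xy.
  by apply: le_trans (h _ _ xy); rewrite lee_fin.
have covA : covered (phi @` A) (\int[leb01]_(r in A) speed g r + e0%:E)%E.
  have -> : phi @` A = phi @` N `|` \bigcup_m phi @` F m.
    rewrite -image_bigcup -image_setU; congr (_ @` _); apply/seteqP; split.
      by rewrite /F -seqDU_bigcup_eq.
    by rewrite subUset; split; [move=> ? []|exact: FA].
  apply: covered_le (covered_setU covN (covered_bigcup covF)).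
  have Fi0 m : (0 <= \int[leb01]_(r in F m) (speed g r + e%:E))%E.
    by apply: integral_ge0 => x _; rewrite adde_ge0 // lee_fin ltW.
  apply: (@le_trans _ _ (e%:E + (\int[leb01]_(r in A) (speed g r + e%:E) + e%:E))%E).
    rewrite add0e leeD2l //.
    apply: le_trans (epsilon_trick _ Fi0 (ltW e_gt0)) _.
    rewrite leeD2r // -ge0_integral_bigcup //.
    - apply: ge0_subset_integral => //; first exact: bigcupT_measurable.
      + by apply: emeasurable_funD => //; exact: measurable_funTS.
      + by move=> x _; rewrite adde_ge0 // lee_fin ltW.
    - by apply: emeasurable_funD => //; exact: measurable_funTS.
    - by move=> x _; rewrite adde_ge0 // lee_fin ltW.
  have -> : (\int[leb01]_(r in A) (speed g r + e%:E) =
             \int[leb01]_(r in A) speed g r + \int[leb01]_(r in A) e%:E)%E.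
    apply: ge0_integralD => //; first exact: measurable_funTS.
    by move=> x _; rewrite lee_fin ltW.
  rewrite integral_seg_cst //.
  set I := (\int[_]_(_ in _) _)%E.
  have Ifin : I \is a fin_num by rewrite ge0_fin_numE //; apply: integral_ge0.
  rewrite -(fineK Ifin) -!EFinD lee_fin.
  have ts1 : set_val t - set_val s <= 1 :> R.
    by rewrite lerBlDr (le_trans (unit_le1 t)) // lerDl unit_ge0.
  have : e * (set_val t - set_val s) <= e by rewrite ler_piMr // ltW.
  have e3 : e0 = e + e + e by rewrite /e; field.
  rewrite e3; set u := e * _; set v := fine I => uv.
  have aux (x y z : R) : x <= y -> y + (z + x + y) <= z + (y + y + y) by lra.
  exact: aux.
have [C [mC AC Cle]] := covA; apply: le_trans Cle.
have phis : phi s = 0 by rewrite /phi mdistxx.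
have sub : `[0, phi t]%classic `<=` C.
  move=> v; rewrite /= in_itv /= => /andP[v0 vt]; apply: AC.
  pose f (x : R) : R := phi (clip x).
  have cf' : continuous f.
    have cphi : continuous (phi : unit_itv R -> R).
      by apply: mdist_continuousl; [exact: cst_continuous|exact: Cpath_continuous].
    exact: (@continuous_compT _ (unit_itv R) _ (@clip R) phi (@clip_continuous R) cphi).
  have [|c] := @IVT R f (set_val s) (set_val t) v st (continuous_subspaceT cf').
    by rewrite /f !clipK phis min_l ?max_r ?v0 //; exact: (le_trans v0).
  rewrite in_itv /= => /andP[sc ct] fc; exists (clip c) => //.
  have c01 : 0 <= c <= 1 by rewrite (le_trans (unit_ge0 s) sc) (le_trans ct (unit_le1 t)).
  by rewrite /A /seg /= /unit_le clipE // sc ct.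
have : (lebesgue_measure (`[0%R, phi t]%classic : set R) <= lebesgue_measure C)%E.
  by apply: le_measure; rewrite ?inE //; exact: measurable_itv.
rewrite lebesgue_measure_itv /= lte_fin /phi; case: ifPn => [_|].
  by rewrite sube0.
rewrite -leNgt => h0 _; have -> : mdist (g s) (g t) = 0 by apply/eqP; rewrite eq_le h0 mdist_ge0.
exact: measure_ge0.
Qed.

End metric_derivative.

Lemma measurable_fun_integral_section d1 d2 (A : measurableType d1) (T : measurableType d2)
    (R : realType) (mu : {sigma_finite_measure set T -> \bar R}) (D : set T)
    (f : A * T -> \bar R) : measurable D -> measurable_fun setT f -> (forall x, (0 <= f x)%E) ->
  measurable_fun setT (fun a => \int[mu]_(t in D) f (a, t))%E.
Proof.
move=> mD mf f0.
have -> : (fun a => \int[mu]_(t in D) f (a, t))%E =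
    fubini_F mu (f \_ (setT `*` D)).
  apply/funext => a; rewrite integral_mkcond /fubini_F; apply: eq_integral => t _.
  rewrite /patch; have -> // : ((a, t) \in [set: A] `*` D) = (t \in D).
  by apply/idP/idP; rewrite !inE /=; [case|].
apply: measurable_fun_fubini_tonelli_F.
  apply/(measurable_restrictT _ _).1 => //; first exact: measurableX.
  exact: measurable_funTS.
by move=> x; rewrite /patch; case: ifPn.
Qed.

Lemma measurable_leeT d (A : measurableType d) (R : realType) (f h : A -> \bar R) :
  measurable_fun setT f -> measurable_fun setT h -> measurable [set a | (f a <= h a)%E].
Proof. by move=> mf mh; rewrite -[X in measurable X]setTI; exact: measurable_lee. Qed.

Lemma measurable_lteT d (A : measurableType d) (R : realType) (f h : A -> \bar R) :
  measurable_fun setT f -> measurable_fun setT h -> measurable [set a | (f a < h a)%E].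
Proof.
move=> mf mh; rewrite (_ : [set a | _] = ~` [set a | (h a <= f a)%E]).
  by apply: measurableC; exact: measurable_leeT.
by apply/seteqP; split => a /=; rewrite ltNge => /negP.
Qed.

Lemma sqre_y (R : realType) : (+oo ^+ 2 = +oo :> \bar R)%E.
Proof. by rewrite -[LHS]/(+oo * +oo)%E mulyy. Qed.

Lemma le_1Dsqre (R : realType) (x : \bar R) : (0 <= x -> x <= 1 + x ^+ 2)%E.
Proof.
case: x => [x| |] x0; [|by rewrite sqre_y addey|by []].
by rewrite -EFin_expe -EFinD lee_fin; nra.
Qed.

Lemma fine_sqr_le (R : realType) (x : \bar R) : (0 <= x -> (fine x ^+ 2)%:E <= x ^+ 2)%E.
Proof.
by case: x => [x| |] x0; [rewrite EFin_expe|rewrite sqre_y leey|].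
Qed.

Lemma bigcapT_measurable_rat d (A : measurableType d) (F : rat -> set A) :
  (forall i, measurable (F i)) -> measurable (\bigcap_i F i).
Proof.
move=> mF; rewrite -[X in measurable X]setCK setC_bigcap; apply: measurableC.
by apply: bigcupT_measurable_rat => i; exact: measurableC.
Qed.

(** * Curves of finite energy controlled by their speed *)

Section good_curves.
Context (R : realType) (Z : pmetricType R).
Implicit Types (g : Cpath Z) (s t : unit_itv R).
Let T := borel (unit_itv R).

Lemma speed_sqr_measurable : measurable_fun setT
  (fun p : borel (Cpath Z) * T => (speed (p.1 : Cpath Z) p.2 ^+ 2)%E).
Proof.
have -> : (fun p : borel (Cpath Z) * T => (speed (p.1 : Cpath Z) p.2 ^+ 2)%E) =
    (fun p => speed (p.1 : Cpath Z) p.2 * speed (p.1 : Cpath Z) p.2)%E by [].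
by apply: emeasurable_funM; exact: speed_measurable.
Qed.

(** A Borel substitute for AC^2. It mentions no majorant other than the speed; by
    [mdist_le_int_speed] every absolutely continuous curve of finite energy satisfies it. *)
Definition good_curve : set (Cpath Z) := [set g |
  (\int[leb01]_t (speed g t ^+ 2) < +oo)%E /\
  forall s t, unit_le s t -> ((mdist (g s) (g t))%:E <= \int[leb01]_(r in seg s t) speed g r)%E].

(** By continuity of g the ends s < t may be replaced by rationals p and q strictly between them;
    the integral over the smaller segment is no larger. The midpoint of s and t separates p from q,
    which keeps them in order. *)
Lemma good_curve_rat : good_curve = [set g |
  (\int[leb01]_t (speed g t ^+ 2) < +oo)%E /\
  forall p q : rat, unit_le (clip (ratr p : R)) (clip (ratr q)) ->
   ((mdist (g (clip (ratr p))) (g (clip (ratr q))))%:E <=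
      \int[leb01]_(r in seg (clip (ratr p)) (clip (ratr q))) speed g r)%E].
Proof.
apply/seteqP; split=> [g [g2 h]|g [g2 h]]; split => // s t; first by move=> ?; exact: h.
rewrite /unit_le le_eqVlt => /predU1P[/itv_val_inj ->|st].
  by rewrite mdistxx; apply: integral_ge0 => *; exact: speed_ge0.
apply/lee_addgt0Pr => e e0.
have near_pt (u : unit_itv R) : exists2 d : R, 0 < d & forall v : unit_itv R,
    `|set_val u - set_val v| < d -> mdist (g u) (g v) < e / 2.
  have /nbhs_ballP[d /= d0 hd] : nbhs u ((g : unit_itv R -> Z) @^-1` ball (g u) (e / 2)).
    by apply: Cpath_continuous; apply: nbhsx_ballx; rewrite divr_gt0.
  exists d => // v uv; have := hd v uv; by rewrite /= ballEmdist.
have [d1 d10 h1] := near_pt s; have [d2 d20 h2] := near_pt t.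
set m : R := (set_val s + set_val t) / 2.
have sm : set_val s < m by rewrite /m midf_lt.
have mt : m < set_val t by rewrite /m midf_lt.
have sp0 : set_val s < Num.min (set_val s + d1) m by rewrite lt_min ltrDl d10.
have tq0 : Num.max (set_val t - d2) m < set_val t by rewrite gt_max ltrBlDr ltrDl d20.
have [p] := rat_in_itvoo sp0; rewrite in_itv /= lt_min => /andP[sp /andP[pd pm]].
have [q] := rat_in_itvoo tq0; rewrite in_itv /= gt_max => /andP[/andP[dq mq] qt].
have p01 : 0 <= (ratr p : R) <= 1.
  rewrite (le_trans (unit_ge0 s) (ltW sp)) /=.
  by rewrite (le_trans _ (unit_le1 t)) // ltW // (lt_trans pm).
have q01 : 0 <= (ratr q : R) <= 1.
  apply/andP; split; last by rewrite (le_trans (ltW qt)) // unit_le1.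
  by rewrite (le_trans (unit_ge0 s)) // ltW // (lt_trans sm).
have pq : unit_le (clip (ratr p : R)) (clip (ratr q)).
  by rewrite /unit_le !clipE // ltW // (lt_trans pm).
have d1' : mdist (g s) (g (clip (ratr p))) < e / 2.
  by apply: h1; rewrite clipE // distrC ger0_norm ?subr_ge0 ?(ltW sp) // ltrBlDl.
have d2' : mdist (g t) (g (clip (ratr q))) < e / 2.
  apply: h2; rewrite clipE // ger0_norm ?subr_ge0 ?(ltW qt) // ltrBlDr -ltrBlDl //.
apply: (@le_trans _ _ ((mdist (g (clip (ratr p))) (g (clip (ratr q))))%:E + e%:E)%E).
  rewrite -EFinD lee_fin.
  have t1 := metric_triangle (g s) (g (clip (ratr p))) (g t).
  have t2 := metric_triangle (g (clip (ratr p))) (g (clip (ratr q))) (g t).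
  have aux (a b c d a' e' : R) : a <= b + c -> c <= d + a' -> b < e' / 2 -> a' < e' / 2 -> a <= d + e'.
    lra.
  by apply: (aux _ _ _ _ _ _ t1 t2) => //; rewrite metric_sym.
rewrite leeD2r //; apply: le_trans (h _ _ pq) _.
apply: ge0_subset_integral.
- exact: measurable_seg.
- exact: measurable_seg.
- by apply: measurable_funTS; exact: speed_measurable1.
- by move=> *; exact: speed_ge0.
move=> r /andP[]; rewrite /unit_le !clipE // => pr rq.
by apply/andP; split; rewrite /unit_le; [apply: le_trans pr|apply: (le_trans rq)]; exact: ltW.
Qed.

Lemma good_curve_measurable : measurable (good_curve : set (borel (Cpath Z))).
Proof.
have m2 : measurable_fun setT (fun g : borel (Cpath Z) => \int[leb01]_t (speed (g : Cpath Z) t ^+ 2))%E.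
  apply: (@measurable_fun_integral_section _ _ (borel (Cpath Z)) T R (@leb01 R) setT
    (fun p => speed (p.1 : Cpath Z) p.2 ^+ 2)%E) => //.
    exact: speed_sqr_measurable.
  by move=> p; rewrite sqre_ge0.
have mI (s t : unit_itv R) : measurable_fun setT (fun g : borel (Cpath Z) => \int[leb01]_(r in seg s t) speed (g : Cpath Z) r)%E.
  apply: (@measurable_fun_integral_section _ _ (borel (Cpath Z)) T R (@leb01 R) (seg s t)
    (fun p => speed (p.1 : Cpath Z) p.2)) => //.
  - exact: measurable_seg.
  - exact: speed_measurable.
  - by move=> p; exact: speed_ge0.
have -> : (good_curve : set (borel (Cpath Z))) = [set g : borel (Cpath Z) | (\int[leb01]_t (speed (g : Cpath Z) t ^+ 2) < cst +oo g)%E]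
  `&` \bigcap_(p : rat) \bigcap_(q : rat) [set g : borel (Cpath Z) | unit_le (clip (ratr p : R)) (clip (ratr q)) ->
   ((mdist ((g : Cpath Z) (clip (ratr p))) ((g : Cpath Z) (clip (ratr q))))%:E <=
      \int[leb01]_(r in seg (clip (ratr p)) (clip (ratr q))) speed (g : Cpath Z) r)%E].
  rewrite good_curve_rat; apply/seteqP; split=> g [g2 h]; split => //; first by move=> p _ q _; exact: h.
  by move=> p q; exact: h.
apply: measurableI; first exact: measurable_lteT.
apply: bigcapT_measurable_rat => p; apply: bigcapT_measurable_rat => q.
have [pq|pq] := boolP (unit_le (clip (ratr p : R)) (clip (ratr q))); last first.
  by rewrite (_ : [set g | _] = setT) //; apply/seteqP; split => // g _ /=; rewrite (negbTE pq).
rewrite (_ : [set g | _] = [set g : borel (Cpath Z) | ((mdist ((g : Cpath Z) (clip (ratr p))) ((g : Cpath Z) (clip (ratr q))))%:E <=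
      \int[leb01]_(r in seg (clip (ratr p)) (clip (ratr q))) speed (g : Cpath Z) r)%E]); last first.
  by apply/seteqP; split => g /=; [apply|move=> + _].
apply: measurable_leeT => //; apply/measurable_EFinP.
by apply: continuous_borel_real; apply: mdist_continuousl; exact: eval_continuous.
Qed.

Lemma good_curve_ac (g : Cpath Z) : good_curve g -> abs_cont 2 g.
Proof.
move=> [g2 h].
have mS := speed_measurable1 g.
have S0 t : (0 <= speed g t)%E by exact: speed_ge0.
(* [fine] turns an infinite speed into 0. This concerns a null set only, because the square of the
   speed is integrable. *)
have fS : measurable_fun setT (fun t : T => fine (speed g t)) by exact: measurableT_comp.
exists (fun t => fine (speed g t)); split => //.
- by move=> t; exact: fine_ge0.
- apply: le_lt_trans g2; apply: ge0_le_integral => //.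
  + by move=> t _; rewrite lee_fin exprn_ge0 // fine_ge0.
  + by apply/measurable_EFinP; exact: measurable_funX.
  + exact: (measurable_fun_pair2 (f := fun p : borel (Cpath Z) * T => (speed (p.1 : Cpath Z) p.2 ^+ 2)%E) g speed_sqr_measurable).
  + by move=> t _; exact: fine_sqr_le.
- move=> s t st; apply: le_trans (h _ _ st) _.
  have Sint : (leb01 : set T -> \bar R).-integrable setT (fun r => speed g r).
    apply/integrableP; split => //.
    under eq_integral do rewrite gee0_abs //.
    apply: (@le_lt_trans _ _ (\int[leb01]_t (1 + speed g t ^+ 2))%E).
      apply: ge0_le_integral => //.
      - apply: emeasurable_funD => //.
        exact: (measurable_fun_pair2 (f := fun p : borel (Cpath Z) * T => (speed (p.1 : Cpath Z) p.2 ^+ 2)%E) g speed_sqr_measurable).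
      - by move=> x _; exact: le_1Dsqre.
    have -> : (\int[leb01]_t (1 + speed g t ^+ 2) = \int[leb01]_t 1 + \int[leb01]_t (speed g t ^+ 2))%E.
      apply: ge0_integralD => //.
      - by move=> x _; rewrite sqre_ge0.
      - exact: (measurable_fun_pair2 (f := fun p : borel (Cpath Z) * T => (speed (p.1 : Cpath Z) p.2 ^+ 2)%E) g speed_sqr_measurable).
    rewrite lte_add_pinfty //.
    have -> : (\int[leb01]_t 1 = 1 * leb01 [set: T])%E by exact: (integral_cst (@leb01 R)).
    by rewrite [X in (_ * X)%E](@leb01T R) mule1 ltry.
  have Sfin := integrable_ae measurableT Sint.
  apply: ae_ge0_le_integral => //.
  + exact: measurable_seg.
  + exact: measurable_funTS.
  + by move=> x _; rewrite lee_fin fine_ge0.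
  + by apply: measurable_funTS; apply/measurable_EFinP.
  + by apply: filterS Sfin => x /(_ Logic.I) /= fx _; rewrite fineK.
Qed.

Lemma ac_good_curve (g : Cpath Z) (a : T -> R) : ac_bound g a ->
  (\int[leb01]_t (speed g t ^+ 2) < +oo)%E -> good_curve g.
Proof. by move=> ga g2; split => // s t; exact: mdist_le_int_speed ga s t. Qed.

Lemma abs_cont_bound (p : nat) (g : unit_itv R -> Z) : (p = 1 \/ p = 2)%N -> abs_cont p g ->
  exists a, ac_bound g a.
Proof.
move=> p12 [a [a0 ma ia h]]; exists a; split => //.
case: p12 ia => -> // ia.
apply: (@le_lt_trans _ _ (\int[leb01]_t (1 + (a t ^+ 2)%:E))%E).
  apply: ge0_le_integral => //.
  - by move=> t _; rewrite lee_fin.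
  - exact/measurable_EFinP.
  - by apply: emeasurable_funD => //; apply/measurable_EFinP; exact: measurable_funX.
  - by move=> t _; rewrite EFin_expe le_1Dsqre // lee_fin.
have -> : (\int[leb01]_t (1 + (a t ^+ 2)%:E) = \int[leb01]_t 1 + \int[leb01]_t (a t ^+ 2)%:E)%E.
  apply: ge0_integralD => //.
  - by move=> x _; rewrite lee_fin sqr_ge0.
  - by apply/measurable_EFinP; exact: measurable_funX.
rewrite lte_add_pinfty //.
have -> : (\int[leb01]_t 1 = 1 * leb01 [set: T])%E by exact: (integral_cst (@leb01 R)).
by rewrite [X in (_ * X)%E](@leb01T R) mule1 ltry.
Qed.

End good_curves.

Import HBNNSimple.

(** * A countable dense family of nonnegative square integrable functions *)

Section generated_algebra.
Context (T : Type) (B : nat -> set T).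

(** Trees labelled by natural numbers form a countable type, so this enumerates the Boolean algebra
    generated by [B]. *)
Fixpoint tset (t : GenTree.tree nat) : set T :=
  match t with
  | GenTree.Leaf n => B n
  | GenTree.Node _ [:: x] => ~` tset x
  | GenTree.Node _ [:: x; y] => tset x `|` tset y
  | _ => set0
  end.

End generated_algebra.

Definition symdiff (T : Type) (A B : set T) := (A `\` B) `|` (B `\` A).

Lemma symdiff_triangle (T : Type) (A B C : set T) :
  symdiff A C `<=` symdiff A B `|` symdiff B C.
Proof.
move=> x [[Ax nCx]|[Cx nAx]]; have [Bx|nBx] := pselect (B x).
- by right; left.
- by left; left.
- by left; right.
- by right; right.
Qed.

Lemma symdiffC (T : Type) (A B : set T) : symdiff (~` A) (~` B) = symdiff A B.
Proof.
apply/seteqP; split=> x [[h1 h2]|[h1 h2]].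
- by right; split => //; apply: contrapT.
- by left; split => //; apply: contrapT.
- by right; split => // /(_ h1).
- by left; split => // /(_ h1).
Qed.

Lemma symdiffU (T : Type) (A B C D : set T) :
  symdiff (A `|` B) (C `|` D) `<=` symdiff A C `|` symdiff B D.
Proof.
move=> x [[[Ax|Bx] h]|[[Cx|Dx] h]].
- by left; left; split => // ?; apply: h; left.
- by right; left; split => // ?; apply: h; right.
- by left; right; split => // ?; apply: h; left.
- by right; right; split => // ?; apply: h; right.
Qed.

Section algebra_approximation.
Context d (T : measurableType d) (R : realType) (B : nat -> set T).
Hypothesis BE : @measurable _ T = <<s range B >>.

Lemma measurable_tset t : measurable (tset B t).
Proof.
move: t; fix IH 1 => -[m|m [|x [|y [|z l]]]] //=.
- by rewrite BE; apply: sub_sigma_algebra; exists m.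
- by apply: measurableC; exact: IH.
- by apply: measurableU; exact: IH.
Qed.

Lemma measurable_symdiff (A C : set T) : measurable A -> measurable C -> measurable (symdiff A C).
Proof. by move=> mA mC; apply: measurableU; exact: measurableD. Qed.

(** The sets approximable within E form a sigma-algebra. Complements and finite unions are
    immediate; a countable union differs from a finite one by a set of small measure in E, and this
    is where E has to have finite measure. *)
Lemma tset_approx (mu : {measure set T -> \bar R}) (E : set T) : measurable E -> (mu E < +oo)%E ->
  forall A, measurable A -> forall e : R, 0 < e ->
  exists t, (mu (symdiff A (tset B t) `&` E) < e%:E)%E.
Proof.
move=> mE muE.
pose G : set (set T) := [set A | measurable A /\ forall e : R, 0 < e ->
  exists t, (mu (symdiff A (tset B t) `&` E) < e%:E)%E].
suff h : @measurable _ T `<=` G by move=> A /h[].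
have GU A C : G A -> G C -> G (A `|` C).
  move=> [mA hA] [mC hC]; split; first exact: measurableU.
  move=> e e0; have e2 : 0 < e / 2 by rewrite divr_gt0.
  have [t tA] := hA _ e2; have [u uC] := hC _ e2.
  exists (GenTree.Node 0 [:: t; u]) => /=.
  have mt := measurable_tset t; have mu' := measurable_tset u.
  apply: (@le_lt_trans _ _ (mu ((symdiff A (tset B t) `&` E) `|` (symdiff C (tset B u) `&` E)))).
    apply: le_measure; rewrite ?inE.
    - by apply: measurableI => //; apply: measurable_symdiff; exact: measurableU.
    - by apply: measurableU; apply: measurableI => //; exact: measurable_symdiff.
    - by rewrite -setIUl; apply: setSI; exact: symdiffU.
  apply: le_lt_trans; first by apply: measureU2; apply: measurableI => //; exact: measurable_symdiff.
  by rewrite [e]splitr EFinD lteD.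
rewrite BE; apply: smallest_sub; last first.
  move=> _ [n _ <-]; split; first by rewrite BE; apply: sub_sigma_algebra; exists n.
  move=> e e0; exists (GenTree.Leaf n) => /=.
  by rewrite /symdiff setDv setU0 set0I measure0.
have G0 : G set0.
  split => // e e0; exists (GenTree.Node 0 [::]) => /=.
  by rewrite /symdiff setDv setU0 set0I measure0.
split => //.
- move=> A [mA hA]; rewrite setTD; split; first exact: measurableC.
  move=> e e0; have [t tA] := hA _ e0; exists (GenTree.Node 0 [:: t]) => /=.
  by rewrite symdiffC.
- move=> F GF.
  have mF i : measurable (F i) by have [] := GF i.
  split; first exact: bigcupT_measurable.
  pose U n := \big[setU/set0]_(i < n) F i.
  have GUn n : G (U n).
    rewrite /U; elim: n => [|n IH]; first by rewrite big_ord0.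
    by rewrite big_ord_recr /=; apply: GU => //; exact: GF.
  move=> e e0; have e2 : 0 < e / 2 by rewrite divr_gt0.
  pose D n := (\bigcup_i F i `\` U n) `&` E.
  have mD n : measurable (D n).
    apply: measurableI => //; apply: measurableD; first exact: bigcupT_measurable.
    by have [] := GUn n.
  have D0 : \bigcap_n D n = set0.
    rewrite -subset0 => x h; have [[[i _ Fix] _] _] := h 0%N Logic.I.
    have [[_ nU] _] := h i.+1 Logic.I.
    by apply: nU; rewrite /U big_ord_recr /=; right.
  have cD : mu \o D @ \oo --> mu (\bigcap_n D n).
    apply: nonincreasing_cvg_mu => //.
    - apply: le_lt_trans muE; apply: le_measure; rewrite ?inE //.
      by move=> x [].
    - by rewrite D0.
    - move=> n m nm; apply/subsetPset => x [[h1 h2] h3]; split => //; split => // Um.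
      apply: h2; move: Um; rewrite /U -!bigcup_mkord => -[i /= im Fi]; exists i => //=.
      exact: leq_trans nm.
  rewrite D0 measure0 in cD.
  have [n Dn] : exists n, (mu (D n) < (e / 2)%:E)%E.
    have /cD [n _ hn] : nbhs (0 : \bar R)%E [set x : \bar R | (x < (e / 2)%:E)%E].
      by apply: open_nbhs_nbhs; split; [exact: open_ereal_lt_ereal|rewrite /= lte_fin].
    by exists n; apply: hn => /=.
  have [mUn /(_ _ e2)[t ht]] := GUn n; exists t.
  have mt := measurable_tset t.
  apply: (@le_lt_trans _ _ (mu (D n `|` (symdiff (U n) (tset B t) `&` E)))).
    apply: le_measure; rewrite ?inE.
    - by apply: measurableI => //; apply: measurable_symdiff => //; exact: bigcupT_measurable.
    - by apply: measurableU => //; apply: measurableI => //; exact: measurable_symdiff.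
    - rewrite /D -setIUl; apply: setSI => x /(@symdiff_triangle _ _ (U n))[[//|[Ux nF]]|]; [by left| |by right].
      by exfalso; apply: nF; move: Ux; rewrite /U -bigcup_mkord => -[i _ Fi]; exists i.
  apply: le_lt_trans; first by apply: measureU2 => //; apply: measurableI => //; exact: measurable_symdiff.
  by rewrite [e]splitr EFinD lteD.
Qed.

(** A set of finite measure is first cut down to a member F n of an exhaustion, then approximated
    inside F n by the Boolean algebra. *)
Lemma finite_measure_approx (mu : {sigma_finite_measure set T -> \bar R}) :
  exists W : nat -> set T, [/\ forall j, measurable (W j), forall j, (mu (W j) < +oo)%E &
    forall A, measurable A -> (mu A < +oo)%E -> forall e : R, 0 < e ->
      exists j, (mu (symdiff A (W j)) < e%:E)%E].
Proof.
have /sigma_finiteP[F [TF ndF hF]] := sigma_finiteT mu.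
pose W j := if (unpickle j : option (GenTree.tree nat * nat)) is Some (t, n)
  then tset B t `&` F n else set0.
have mF n : measurable (F n) by have [] := hF n.
have mW j : measurable (W j).
  rewrite /W; case: unpickle => [[t n]|] //; apply: measurableI => //; exact: measurable_tset.
exists W; split => //.
  move=> j; rewrite /W; case: unpickle => [[t n]|]; last by rewrite measure0.
  have [_ Fn] := hF n; apply: le_lt_trans Fn; apply: le_measure; rewrite ?inE //.
  by apply: measurableI => //; exact: measurable_tset.
move=> A mA Afin e e0; have e2 : 0 < e / 2 by rewrite divr_gt0.
pose D n := A `\` F n.
have mD n : measurable (D n) by exact: measurableD.
have D0 : \bigcap_n D n = set0.
  rewrite -subset0 => x h; have : setT x by [].
  by rewrite TF => -[i _ Fi]; have [_] := h i Logic.I.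
have cD : mu \o D @ \oo --> mu (\bigcap_n D n).
  apply: nonincreasing_cvg_mu => //.
  - by apply: le_lt_trans Afin; apply: le_measure; rewrite ?inE // => x [].
  - by rewrite D0.
  - move=> n m nm; apply/subsetPset; apply: setDS; apply/subsetPset; exact: ndF.
rewrite D0 measure0 in cD.
have [n Dn] : exists n, (mu (D n) < (e / 2)%:E)%E.
  have /cD [n _ hn] : nbhs (0 : \bar R)%E [set x : \bar R | (x < (e / 2)%:E)%E].
    by apply: open_nbhs_nbhs; split; [exact: open_ereal_lt_ereal|rewrite /= lte_fin].
  by exists n; apply: hn => /=.
have [t ht] := tset_approx (mF n) (hF n).2 mA e2.
exists (pickle (t, n)); rewrite /W pickleK.
have mt := measurable_tset t.
apply: (@le_lt_trans _ _ (mu (D n `|` (symdiff A (tset B t) `&` F n)))).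
  apply: le_measure; rewrite ?inE.
  - by apply: measurable_symdiff => //; exact: measurableI.
  - by apply: measurableU => //; apply: measurableI => //; exact: measurable_symdiff.
  - move=> x [[Ax h]|[[tx Fx] nA]].
      have [Fx|nF] := pselect (F n x); last by left.
      by right; split => //; left; split => // tx; apply: h.
    by right; split => //; right.
apply: le_lt_trans; first by apply: measureU2 => //; apply: measurableI => //; exact: measurable_symdiff.
by rewrite [e]splitr EFinD lteD.
Qed.

End algebra_approximation.

Lemma sqrD_le2 (R : realDomainType) (x y : R) : (x + y) ^+ 2 <= 2 * x ^+ 2 + 2 * y ^+ 2.
Proof. by have := sqr_ge0 (x - y); nra. Qed.

Section square_integrals.
Context d (T : measurableType d) (R : realType) (mu : {measure set T -> \bar R}).
Implicit Types f g : T -> R.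

Definition sqint f : \bar R := (\int[mu]_z (f z ^+ 2)%:E)%E.

Lemma sqint_ge0 f : (0 <= sqint f)%E.
Proof. by apply: integral_ge0 => z _; rewrite lee_fin sqr_ge0. Qed.

Lemma measurable_sqr f : measurable_fun setT f -> measurable_fun setT (fun z => (f z ^+ 2)%:E).
Proof. by move=> mf; apply/measurable_EFinP; exact: measurable_funX. Qed.

Lemma sqint_le f g : measurable_fun setT f -> measurable_fun setT g ->
  (forall z, `|f z| <= `|g z|) -> (sqint f <= sqint g)%E.
Proof.
move=> mf mg fg; apply: ge0_le_integral => //.
- by move=> z _; rewrite lee_fin sqr_ge0.
- exact: measurable_sqr.
- exact: measurable_sqr.
- by move=> z _; rewrite lee_fin -(real_normK (num_real (f z))) -(real_normK (num_real (g z))) lerXn2r ?nnegrE.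
Qed.

Lemma sqintD f g (h : T -> R) : measurable_fun setT f -> measurable_fun setT g -> measurable_fun setT h ->
  (forall z, h z ^+ 2 <= 2 * f z ^+ 2 + 2 * g z ^+ 2) ->
  (sqint h <= 2%:E * sqint f + 2%:E * sqint g)%E.
Proof.
move=> mf mg mh hfg; rewrite /sqint -!ge0_integralZl_EFin //; first last.
- exact: measurable_sqr.
- by move=> z _; rewrite lee_fin sqr_ge0.
- exact: measurable_sqr.
- by move=> z _; rewrite lee_fin sqr_ge0.
rewrite -ge0_integralD //.
- apply: ge0_le_integral => //.
  + by move=> z _; rewrite lee_fin sqr_ge0.
  + exact: measurable_sqr.
  + by apply: emeasurable_funD; apply: measurable_funeM; exact: measurable_sqr.
  + by move=> z _; rewrite -!EFinM -EFinD lee_fin.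
- by move=> z _; rewrite mule_ge0 // lee_fin sqr_ge0.
- by apply: measurable_funeM; exact: measurable_sqr.
- by move=> z _; rewrite mule_ge0 // lee_fin sqr_ge0.
- by apply: measurable_funeM; exact: measurable_sqr.
Qed.

Lemma sqint_scale_indic (c : R) (A : set T) : measurable A ->
  sqint (fun z => c * \1_A z) = ((c ^+ 2)%:E * mu A)%E.
Proof.
move=> mA; rewrite /sqint.
have -> : (fun z => ((c * \1_A z) ^+ 2)%:E) = (fun z => (c ^+ 2)%:E * (\1_A z)%:E)%E :> (T -> \bar R).
  apply/funext => z; rewrite -EFinM exprMn indicE.
  by case: (z \in A); rewrite ?expr1n // expr0n.
rewrite ge0_integralZl_EFin //; last exact: sqr_ge0.
- by rewrite integral_indic // setIT.
- by apply/measurable_EFinP; exact: measurable_indic.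
Qed.

End square_integrals.

Section simple_approximation.
Context d (T : measurableType d) (R : realType) (mu : {measure set T -> \bar R}).
Variable W : nat -> set T.
Hypothesis mW : forall j, measurable (W j).
Hypothesis Wfin : forall j, (mu (W j) < +oo)%E.
Hypothesis Wapprox : forall A, measurable A -> (mu A < +oo)%E -> forall e : R, 0 < e ->
      exists j, (mu (symdiff A (W j)) < e%:E)%E.

(** The absolute value makes every list of pairs code a nonnegative function, so no side condition
    on codes is needed. *)
Definition simple_of (s : seq (rat * nat)) (z : T) : R :=
  \sum_(p <- s) `|ratr p.1| * \1_(W p.2) z.

Lemma simple_of_ge0 s z : 0 <= simple_of s z.
Proof. by apply: sumr_ge0 => p _; rewrite mulr_ge0. Qed.

Lemma measurable_simple_of s : measurable_fun setT (simple_of s).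
Proof.
apply: measurable_sum => p; apply: measurable_funM => //; exact: measurable_indic.
Qed.

Lemma simple_of_cat s s' z : simple_of (s ++ s') z = simple_of s z + simple_of s' z.
Proof. by rewrite /simple_of big_cat. Qed.

(** Together with concatenation this closes the family under averages, as the parallelogram identity
    in [minimal_selection] requires. *)
Definition halve (s : seq (rat * nat)) := [seq (p.1 / 2, p.2) | p <- s].

Lemma simple_of_halve s z : simple_of (halve s) z = simple_of s z / 2.
Proof.
rewrite /simple_of big_map mulr_suml; apply: eq_bigr => p _ /=.
by rewrite rmorphM /= normrM fmorphV /= ratr_nat normfV normr_nat mulrAC.
Qed.

Lemma sqint_simple_of_lty s : (sqint mu (simple_of s) < +oo)%E.
Proof.
elim: s => [|[q j] s IH].
  rewrite /sqint /simple_of; under eq_integral do rewrite big_nil expr0n /=.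
  by rewrite integral0.
apply: le_lt_trans.
  apply: (@sqintD _ _ _ mu (simple_of [:: (q, j)]) (simple_of s)); try exact: measurable_simple_of.
  by move=> z; rewrite -[_ :: s]cat1s simple_of_cat; exact: sqrD_le2.
rewrite lte_add_pinfty // lte_mul_pinfty //.
have -> : simple_of [:: (q, j)] = (fun z => `|ratr q| * \1_(W j) z).
  by apply/funext => z; rewrite /simple_of big_seq1.
by rewrite sqint_scale_indic // lte_mul_pinfty // lee_fin sqr_ge0.
Qed.

Let approximable (f : T -> R) := measurable_fun setT f /\
  forall e : R, 0 < e -> exists s, (sqint mu (fun z => f z - simple_of s z)%R < e%:E)%E.

Let approximableD f g : approximable f -> approximable g -> approximable (fun z => f z + g z).
Proof.
move=> [mf hf] [mg hg]; split; first exact: measurable_funD.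
move=> e e0; have e4 : 0 < e / 4 by rewrite divr_gt0.
have [s hs] := hf _ e4; have [s' hs'] := hg _ e4; exists (s ++ s').
have ms := measurable_simple_of s; have ms' := measurable_simple_of s'.
apply: le_lt_trans.
  apply: (@sqintD _ _ _ mu (fun z => f z - simple_of s z) (fun z => g z - simple_of s' z)).
  - exact: measurable_funB.
  - exact: measurable_funB.
  - by apply: measurable_funB; [exact: measurable_funD|exact: measurable_simple_of].
  - by move=> z; rewrite simple_of_cat opprD addrACA; exact: sqrD_le2.
have -> : e%:E = (2%:E * (e / 4)%:E + 2%:E * (e / 4)%:E)%E.
  by rewrite -!EFinM -EFinD; congr EFin; field.
by apply: lteD; rewrite lte_pmul2l.
Qed.

Let approximable_indic (c : R) (A : set T) : 0 < c -> measurable A -> (mu A < +oo)%E ->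
  approximable (fun z => c * \1_A z).
Proof.
move=> c0 mA Afin; split; first by apply: measurable_funM => //; exact: measurable_indic.
move=> e e0; have e4 : 0 < e / 4 by rewrite divr_gt0.
have mA0 : mu A \is a fin_num by rewrite ge0_fin_numE.
set a := fine (mu A); have a0 : 0 <= a by exact: fine_ge0.
(* The squared error is at most 2 (c - q)^2 mu A + 2 q^2 mu (symdiff A (W j)), and each term has to
   stay below e/2. As dl <= 1, (c - q)^2 <= dl <= e / (4 (a + 1)); the set W j is then taken within
   e / (4 q^2) of A. *)
pose dl : R := Num.min 1 (e / (4 * (a + 1))).
have dl0 : 0 < dl by rewrite lt_min ltr01 /= divr_gt0 // mulr_gt0 // ltr_wpDl.
have [q] : exists q : rat, ratr q \in `]c, c + dl[ by apply: rat_in_itvoo; rewrite ltrDl.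
rewrite in_itv /= => /andP[cq qd].
have q0 : 0 < ratr q :> R by exact: lt_trans cq.
have k0 : 0 < e / (4 * (ratr q ^+ 2)) :> R by rewrite divr_gt0 // mulr_gt0 // exprn_gt0.
have [j hj] := Wapprox mA Afin k0.
exists [:: (q, j)].
apply: le_lt_trans.
  apply: (@sqintD _ _ _ mu (fun z => (c - ratr q) * \1_A z) (fun z => ratr q * \1_(symdiff A (W j)) z)).
  - by apply: measurable_funM => //; exact: measurable_indic.
  - by apply: measurable_funM => //; apply: measurable_indic; exact: measurable_symdiff.
  - apply: measurable_funB; last exact: measurable_simple_of.
    by apply: measurable_funM => //; exact: measurable_indic.
  - move=> z; rewrite /simple_of big_seq1 /= gtr0_norm // !indicE.
    have [Az|nAz] := pselect (A z); have [Wz|nWz] := pselect (W j z).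
    + rewrite (mem_set Az) (mem_set Wz) memNset; last by move=> [[]|[]].
      by rewrite !mulr1 mulr0 expr0n /= mulr0 addr0; nra.
    + rewrite (mem_set Az) (memNset nWz) mem_set; last by left.
      by rewrite !mulr1 mulr0; nra.
    + rewrite (memNset nAz) (mem_set Wz) mem_set; last by right.
      by rewrite !mulr1 !mulr0; nra.
    + rewrite (memNset nAz) (memNset nWz) memNset; last by move=> [[]|[]].
      by rewrite !mulr0 subrr expr0n /= mulr0 addr0.
rewrite !sqint_scale_indic //; last exact: measurable_symdiff.
have -> : e%:E = (2%:E * (e / 4)%:E + 2%:E * (e / 4)%:E)%E.
  by rewrite -!EFinM -EFinD; congr EFin; field.
apply: lee_ltD.
- by rewrite -(fineK mA0).
- rewrite lee_pmul2l // -(fineK mA0) -EFinM lee_fin -/a.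
  have h1 : (c - ratr q) ^+ 2 <= dl.
    have : 0 < ratr q - c < dl by rewrite subr_gt0 cq ltrBlDl.
    have : dl <= 1 by rewrite ge_min lexx.
    by move=> ? /andP[? ?]; nra.
  have h2 : dl * (4 * (a + 1)) <= e.
    by rewrite -ler_pdivlMr ?ge_min ?lexx ?orbT // mulr_gt0 // ltr_wpDl.
  have h3 : (c - ratr q) ^+ 2 * a <= dl * a by rewrite ler_wpM2r.
  lra.
- rewrite lte_pmul2l //.
  have q2 : 0 < ratr q ^+ 2 :> R by rewrite exprn_gt0.
  apply: (@lt_le_trans _ _ ((ratr q ^+ 2)%:E * (e / (4 * ratr q ^+ 2))%:E)%E).
    by rewrite lte_pmul2l.
  rewrite -EFinM lee_fin le_eqVlt; apply/orP; left; apply/eqP; field.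
  by rewrite gt_eqF.
Qed.

Lemma simple_dense (f : T -> R) : measurable_fun setT f -> (forall z, 0 <= f z) ->
  (sqint mu f < +oo)%E -> forall e : R, 0 < e ->
  exists s, (sqint mu (fun z => f z - simple_of s z)%R < e%:E)%E.
Proof.
move=> mf f0 f2 e e0.
have mfE : measurable_fun setT (EFin \o f) by exact/measurable_EFinP.
pose phi n := nnsfun_approx measurableT mfE n.
have phif n z : phi n z <= f z.
  have := @le_approx _ _ _ setT (EFin \o f) n z (fun x _ => f0 x) Logic.I.
  by rewrite /phi nnsfun_approxE lee_fin.
have phic z : (phi n z) @[n --> \oo] --> f z.
  have := @cvg_nnsfun_approx _ _ _ setT measurableT (EFin \o f) mfE (fun x _ => f0 x) z Logic.I.
  by move/fine_cvgP => -[_].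
have phi_approx n : approximable (phi n).
  (* A level set of phi n for a value y > 0 has finite measure, because y^2 times this measure is at
     most the integral of f^2. The conditional therefore drops only the value 0. *)
  suff h (s : seq R) : approximable (fun z => \sum_(y <- s) (if (0 < y) && (mu (phi n @^-1` [set y]) < +oo)%E then
       y * \1_(phi n @^-1` [set y]) z else 0)).
    have := h (finmap.enum_fset (fset_set (range (phi n)))).
    congr approximable; apply/funext => z; rewrite fimfunE fsbig_finite //=.
    rewrite !big_seq; apply: eq_bigr => y; rewrite in_fset_set // inE => -[z' _ yz'].
    case: ifPn => // /nandP[|].
      rewrite -leNgt => y0; have -> : y = 0 by apply/eqP; rewrite eq_le y0 -yz' fun_ge0.
      by rewrite mul0r.
    have [->|y0] := eqVneq y 0; first by rewrite mul0r.
    move=> /negP[]; have mA : measurable (phi n @^-1` [set y]) by exact: measurable_sfunP.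
    have y2 : 0 < y ^+ 2 by rewrite lt_neqAle sqr_ge0 eq_sym sqrf_eq0 y0.
    have : ((y ^+ 2)%:E * mu (phi n @^-1` [set y]) < +oo)%E.
      rewrite -sqint_scale_indic //; apply: le_lt_trans f2.
      apply: sqint_le => //; first by apply: measurable_funM => //; exact: measurable_indic.
      move=> x; rewrite indicE; have [xA|_] := boolP (x \in _); last by rewrite mulr0 normr0.
      move: xA; rewrite inE /= => <-; rewrite mulr1 !ger0_norm //.
    have [//|] := ltP (mu (phi n @^-1` [set y])) +oo%E.
    by rewrite leye_eq => /eqP ->; rewrite gt0_muley ?lte_fin // ltxx.
  elim: s => [|y s IH].
    split; first by under eq_fun do rewrite big_nil; exact: measurable_cst.
    move=> e' e'0; exists [::]; rewrite /sqint /simple_of.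
    under eq_integral do rewrite !big_nil subrr expr0n /=.
    by rewrite integral0.
  under eq_fun do rewrite big_cons.
  apply: approximableD => //.
  case: (boolP ((0 < y) && (mu (phi n @^-1` [set y]) < +oo)%E)) => [/andP[y0 Ay]|_].
    by apply: approximable_indic => //; exact: measurable_sfunP.
  split => // e' e'0; exists [::]; rewrite /sqint /simple_of.
  under eq_integral do rewrite !big_nil subrr expr0n /=.
  by rewrite integral0.
have e4 : 0 < e / 4 by rewrite divr_gt0.
have [n hn] : exists n, (sqint mu (fun z => f z - phi n z)%R < (e / 4)%:E)%E.
  (* As 0 <= phi n <= f, the square of f dominates the squared errors, and dominated convergence
     applies. *)
  have fint : mu.-integrable setT (fun z => (f z ^+ 2)%:E).
    apply/integrableP; split; first exact: measurable_sqr.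
    by under eq_integral do rewrite gee0_abs ?lee_fin ?sqr_ge0 //.
  have [] := @dominated_convergence _ _ _ mu setT measurableT
    (fun n z => ((f z - phi n z) ^+ 2)%:E) (cst 0%E) (fun z => (f z ^+ 2)%:E).
  - by move=> n; apply: measurable_sqr; exact: measurable_funB.
  - exact: measurable_cst.
  - apply: aeW => z _.
    have c1 : f z - phi n z @[n --> \oo] --> (0 : R).
      by rewrite -(subrr (f z)); apply: cvgB; [exact: cvg_cst|exact: phic].
    have c2 : (f z - phi n z) * (f z - phi n z) @[n --> \oo] --> (0 : R).
      by rewrite -(mulr0 (0 : R)); exact: cvgM.
    by apply/fine_cvgP; split; [exact: nearW|exact: c2].
  - exact: fint.
  - apply: aeW => z n _; rewrite gee0_abs ?lee_fin ?sqr_ge0 //.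
    have := phif n z; have p0 : 0 <= phi n z by exact: fun_ge0.
    by move=> ?; rewrite lerXn2r ?nnegrE ?subr_ge0 // lerBlDr lerDl.
  move=> _ _; rewrite integral0 => cI.
  have /cI [n _ hn] : nbhs (0 : \bar R)%E [set x : \bar R | (x < (e / 4)%:E)%E].
    by apply: open_nbhs_nbhs; split; [exact: open_ereal_lt_ereal|rewrite /= lte_fin].
  by exists n; apply: (hn n) => /=.
have [_ /(_ _ e4)[s hs]] := phi_approx n; exists s.
apply: le_lt_trans.
  apply: (@sqintD _ _ _ mu (fun z => f z - phi n z) (fun z => phi n z - simple_of s z)).
  - exact: measurable_funB.
  - by apply: measurable_funB => //; exact: measurable_simple_of.
  - by apply: measurable_funB => //; exact: measurable_simple_of.
  - move=> z; rewrite [X in X ^+ 2 <= _](_ : _ = (f z - phi n z) + (phi n z - simple_of s z)).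
      exact: sqrD_le2.
    by rewrite addrA subrK.
have -> : e%:E = (2%:E * (e / 4)%:E + 2%:E * (e / 4)%:E)%E.
  by rewrite -!EFinM -EFinD; congr EFin; field.
by apply: lteD; rewrite lte_pmul2l.
Qed.

End simple_approximation.

(** * Measurable selection of least-norm solutions *)

Lemma limn_einf_le (R : realType) (u : (\bar R)^nat) (N : nat) (c : \bar R) :
  (forall n, (N <= n)%N -> (u n <= c)%E) -> (limn_einf u <= c)%E.
Proof.
move=> h; apply: le_trans (limn_einf_sup u) _.
rewrite /limn_esup /limf_esup.
apply: (@le_trans _ _ (ereal_sup (u @` [set n | (N <= n)%N]))).
  apply: ereal_inf_lbound; exists [set n | (N <= n)%N] => //.
  exact: nbhs_infty_ge.
by apply: ge_ereal_sup => _ [n /= Nn <-]; exact: h.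
Qed.

Lemma limn_einf_ge0 (R : realType) (u : (\bar R)^nat) :
  (forall n, (0 <= u n)%E) -> (0 <= limn_einf u)%E.
Proof.
move=> h; rewrite limn_einf_lim; apply: lime_ge; first exact: is_cvg_einfs.
by apply: nearW => n; apply: le_ereal_inf_tmp => _ [m _ <-].
Qed.

Section fast_cauchy.
Context d (T : measurableType d) (R : realType) (mu : {measure set T -> \bar R}).
Variable h : nat -> T -> R.
Hypothesis mh : forall j, measurable_fun setT (h j).
Hypothesis hC : forall j l, (j <= l)%N ->
  (sqint mu (fun z => h l z - h j z)%R <= (6 * (8^-1) ^+ j)%:E)%E.

(** An upper limit is measurable, even jointly with a parameter, and needs no knowledge of the null
    set on which h diverges; [fine] assigns a real value there. *)
Definition esup_limit (z : T) : R := fine (limn_esup (fun j => (h j z)%:E)).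

Lemma measurable_esup_limit : measurable_fun setT esup_limit.
Proof.
apply: measurableT_comp => //; apply: measurable_fun_limn_esup => j.
exact/measurable_EFinP.
Qed.

Let dl j z := h j.+1 z - h j z.

(** The weights 2^j make the increments summable pointwise wherever u is finite, while leaving the
    integral of u finite. *)
Let u z := (\sum_(0 <= j <oo) (2 ^+ j * dl j z ^+ 2)%:E)%E.

Let mdl j : measurable_fun setT (dl j).
Proof. exact: measurable_funB. Qed.

Let mu_ : measurable_fun setT u.
Proof.
apply: ge0_emeasurable_sum => [k x _ _|k _].
  by rewrite lee_fin mulr_ge0 // ?sqr_ge0 // exprn_ge0.
by apply/measurable_EFinP; apply: measurable_funM => //; exact: measurable_funX.
Qed.

Let u_lty : (\int[mu]_z u z < +oo)%E.
Proof.
rewrite /u integral_nneseries //; last 2 first.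
- by move=> n; apply/measurable_EFinP; apply: measurable_funM => //; exact: measurable_funX.
- by move=> n x _; rewrite lee_fin mulr_ge0 // ?sqr_ge0 // exprn_ge0.
(* The n-th integral is at most 2^n * 6 * 8^-n = 6 * 4^-n, hence at most 6 * 2^-n, which is written
   12 / 2^(n+1) to match the geometric sum of [epsilon_trick0]. *)
apply: (@le_lt_trans _ _ (\sum_(0 <= j <oo) (12 / (2 ^ j.+1)%:R)%:E)%E); last first.
  by apply: le_lt_trans (epsilon_trick0 _ _) _; rewrite ?ltry.
apply: lee_nneseries => [n _ _|n _].
  by apply: integral_ge0 => x _; rewrite lee_fin mulr_ge0 // ?sqr_ge0 // exprn_ge0.
under eq_integral do rewrite EFinM.
rewrite ge0_integralZl_EFin ?exprn_ge0 //; last 2 first.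
- by move=> z _; rewrite lee_fin sqr_ge0.
- exact: measurable_sqr.
apply: (@le_trans _ _ ((2 ^+ n)%:E * (6 * (8^-1) ^+ n)%:E)%E).
  by apply: lee_wpmul2l; [rewrite lee_fin exprn_ge0|exact: (hC (leqnSn n))].
rewrite -EFinM lee_fin natrX exprS.
have -> : 12 / (2 * 2 ^+ n) = 6 * 2^-1 ^+ n :> R.
  by rewrite exprVn invfM mulrA; congr (_ * _); field.
rewrite mulrCA ler_pM2l // -exprMn.
have -> : 2 * 8^-1 = 4^-1 :> R by field.
by rewrite lerXn2r ?nnegrE // lef_pV2 ?posrE // ler_nat.
Qed.

Let u_ge0 z : (0 <= u z)%E.
Proof.
by apply: nneseries_ge0 => n _ _; rewrite lee_fin mulr_ge0 // ?sqr_ge0 // exprn_ge0.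
Qed.

Lemma fast_cauchy_cvg : {ae mu, forall z, h j z @[j --> \oo] --> esup_limit z}.
Proof.
have iu : mu.-integrable setT u.
  apply/integrableP; split; first exact: mu_.
  by under eq_integral do rewrite gee0_abs //.
have := integrable_ae measurableT iu; apply: filterS => z /(_ Logic.I) uz.
(* By 2 a <= 2^-j + 2^j a^2, [v j] dominates the absolute value of [dl j z], and its series is
   bounded by a geometric one plus u z / 2. *)
pose v j : R := 2^-1 * ((2^-1) ^+ j + 2 ^+ j * dl j z ^+ 2).
have v0 j : 0 <= v j.
  by rewrite mulr_ge0 // addr_ge0 ?exprn_ge0 // mulr_ge0 ?sqr_ge0 ?exprn_ge0.
have cv : cvgn (series v).
  apply: nondecreasing_is_cvgn.
    by apply: nondecreasing_series => n _ _; exact: v0.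
  exists (1 + 2^-1 * fine (u z)) => _ [n _ <-]; rewrite /series /=.
  rewrite -mulr_sumr big_split /= mulrDr lerD //.
    suff -> : \sum_(0 <= i < n) (2^-1 : R) ^+ i = 2 - 2 * 2^-1 ^+ n.
      by rewrite mulrBr mulVf ?pnatr_eq0 // mulrA mulVf ?pnatr_eq0 // mul1r gerBl exprn_ge0.
    elim: n => [|n IH]; first by rewrite big_geq // expr0 mulr1 subrr.
    by rewrite big_nat_recr //= IH exprS; field.
  rewrite ler_pM2l // -lee_fin fineK // -sumEFin.
  apply: nneseries_lim_ge => k _ _.
  by rewrite lee_fin mulr_ge0 // ?sqr_ge0 // exprn_ge0.
have cd : cvgn (series (fun j => dl j z)).
  apply: normed_cvg; apply: series_le_cvg cv => // n; first exact: normr_ge0.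
  rewrite /= /v.
  set a := `|dl n z|; rewrite -(real_normK (num_real (dl n z))) -/a.
  set b : R := 2 ^+ n; have b0 : 0 < b by rewrite exprn_gt0.
  have -> : 2^-1 ^+ n = b^-1 by rewrite exprVn.
  have h1 : 0 <= (b * a - 1) ^+ 2 / b by rewrite divr_ge0 ?sqr_ge0 // ltW.
  have h2 : (b * a - 1) ^+ 2 / b = b * a ^+ 2 - 2 * a + b^-1 by field; rewrite gt_eqF.
  by rewrite h2 in h1; lra.
have ch : cvgn (fun j => h j z).
  have -> : (fun j => h j z) = (fun j => h 0%N z + series (telescope (fun j => h j z)) j).
    by apply/funext => j; rewrite -eq_sum_telescope.
  by apply: is_cvgD; [exact: is_cvg_cst|exact: cd].
have : (fun j => (h j z)%:E) @ \oo --> (limn (fun j => h j z))%:E.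
  by apply/fine_cvgP; split; [exact: nearW|exact: ch].
by move=> /cvg_limn_einf_sup[_ e]; rewrite /esup_limit e.
Qed.

(** Fatou's lemma in l, with j fixed. *)
Lemma sqint_fast_cauchy j :
  (sqint mu (fun z => esup_limit z - h j z)%R <= (6 * (8^-1) ^+ j)%:E)%E.
Proof.
have mG := measurable_esup_limit.
have hl l z : (0 <= ((h l z - h j z) ^+ 2)%:E)%E by rewrite lee_fin sqr_ge0.
have ml l : measurable_fun setT (fun z => ((h l z - h j z) ^+ 2)%:E).
  by apply: measurable_sqr; exact: measurable_funB.
apply: (@le_trans _ _ (\int[mu]_z limn_einf (fun l => ((h l z - h j z) ^+ 2)%:E))%E).
  rewrite /sqint (@ge0_ae_eq_integral _ _ _ mu setT _
    (fun z => limn_einf (fun l => ((h l z - h j z) ^+ 2)%:E))) //.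
  - by apply: measurable_sqr; exact: measurable_funB.
  - apply: (measurableT_comp (f := -%E) (@oppe_measurable R setT)).
    by apply: measurable_fun_limn_esup => l; apply: (measurableT_comp (f := -%E) (@oppe_measurable R setT)); exact: ml.
  - by move=> z _; rewrite lee_fin sqr_ge0.
  - by move=> z _; apply: limn_einf_ge0 => l; exact: hl.
  apply: filterS fast_cauchy_cvg => z cz _.
  have c1 : h l z - h j z @[l --> \oo] --> esup_limit z - h j z.
    by apply: cvgB => //; exact: cvg_cst.
  have c2 : ((h l z - h j z) ^+ 2)%:E @[l --> \oo] --> ((esup_limit z - h j z) ^+ 2)%:E.
    apply/fine_cvgP; split; first exact: nearW.
    rewrite expr2; apply: cvgM; exact: c1.
  by have [-> _] := cvg_limn_einf_sup c2.
apply: le_trans; first exact: fatou.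
by apply: (@limn_einf_le _ _ j) => l jl; exact: hC.
Qed.

End fast_cauchy.

(** Disjointifying the sets A c describes the choice of the first index by measurable sets. *)
Lemma measurable_first_index d (Y : measurableType d) (A : nat -> set Y) :
  (forall c, measurable (A c)) -> exists sel : Y -> nat,
    (forall c, measurable (sel @^-1` [set c])) /\ forall y, (exists c, A c y) -> A (sel y) y.
Proof.
move=> mA; pose D := seqDU A.
have mD c : measurable (D c) by exact: seqDU_measurable.
exists (fun y => xget 0%N [set c | D c y]); split; last first.
  move=> y [c Ac]; have [c' _ Dc] : (\bigcup_c D c) y by rewrite /D -seqDU_bigcup_eq; exists c.
  by case: xgetP => [c'' _ Dc''|/(_ c')] //; exact: (subset_seqDU Dc'').
move=> c.
(* The value 0 is also the default of [xget], so its fibre contains the points lying in no A c. *)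
rewrite (_ : _ @^-1` _ = D c `|` (if c == 0%N then ~` \bigcup_c D c else set0)).
  apply: measurableU => //; case: ifPn => _ //.
  by apply: measurableC; exact: bigcupT_measurable.
apply/seteqP; split=> y /=.
  case: xgetP => [c' -> Dc' <-|nD <-]; first by left.
  by right; rewrite eqxx => -[c' _ Dc']; exact: (nD c').
move=> [Dc|]; last first.
  case: ifPn => // /eqP -> nD; case: xgetP => // c' -> Dc'.
  by exfalso; apply: nD; eexists; [|exact: Dc'].
case: xgetP => [c' _ Dc'|/(_ c)] //.
have [-> //|cc'] := eqVneq c' c.
have := @trivIset_seqDU _ A; move=> /trivIsetP/(_ c' c Logic.I Logic.I cc'); rewrite -subset0 => /(_ y) f.
by exfalso; apply: f.
Qed.

Section square_integral_continuity.
Context d (T : measurableType d) (R : realType) (mu : {measure set T -> \bar R}).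

(** From g^2 <= (1 + k) f^2 + (1 + 1/k) (g - f)^2, with k chosen such that k (M + 1) = e/2. The
    bound M makes the radius independent of f. *)
Lemma sqint_near (M e : R) : 0 <= M -> 0 < e -> exists dl : R, 0 < dl /\
  forall f g : T -> R, measurable_fun setT f -> measurable_fun setT g -> (sqint mu f <= M%:E)%E ->
    (sqint mu (fun z => g z - f z)%R < dl%:E)%E -> (sqint mu g <= sqint mu f + e%:E)%E.
Proof.
move=> M0 e0; pose k : R := e / (2 * (M + 1)).
have M1 : 0 < M + 1 by rewrite ltr_wpDl.
have k0 : 0 < k by rewrite divr_gt0 // mulr_gt0.
have k1 : 0 < 1 + k^-1 by rewrite addr_gt0 // invr_gt0.
exists (e / 2 / (1 + k^-1)); split; first by rewrite !divr_gt0.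
move=> f g mf mg fM fg.
have mfg : measurable_fun setT (fun z => g z - f z) by exact: measurable_funB.
have h : (sqint mu g <= (1 + k)%:E * sqint mu f + (1 + k^-1)%:E * sqint mu (fun z => g z - f z)%R)%E.
  rewrite /sqint -!ge0_integralZl_EFin //; last 6 first.
  - by move=> z _; rewrite lee_fin sqr_ge0.
  - exact: measurable_sqr.
  - exact: ltW.
  - by move=> z _; rewrite lee_fin sqr_ge0.
  - exact: measurable_sqr.
  - by rewrite addr_ge0 // ltW.
  rewrite -ge0_integralD //; last 4 first.
  - by move=> z _; rewrite -EFinM lee_fin mulr_ge0 ?sqr_ge0 // addr_ge0 // ltW.
  - by apply: measurable_funeM; exact: measurable_sqr.
  - by move=> z _; rewrite -EFinM lee_fin mulr_ge0 ?sqr_ge0 // ltW.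
  - by apply: measurable_funeM; exact: measurable_sqr.
  apply: ge0_le_integral => //.
  - by move=> z _; rewrite lee_fin sqr_ge0.
  - exact: measurable_sqr.
  - by apply: emeasurable_funD; apply: measurable_funeM; exact: measurable_sqr.
  - move=> z _; rewrite -!EFinM -EFinD lee_fin.
    set x := f z; set y := g z.
    have h1 : 0 <= (k * x - (y - x)) ^+ 2 / k by rewrite divr_ge0 ?sqr_ge0 // ltW.
    have h2 : (1 + k) * x ^+ 2 + (1 + k^-1) * (y - x) ^+ 2 - y ^+ 2 = (k * x - (y - x)) ^+ 2 / k.
      by field; rewrite gt_eqF.
    by rewrite -subr_ge0 h2.
apply: le_trans h _.
have ffin : sqint mu f \is a fin_num by rewrite ge0_fin_numE ?sqint_ge0 // (le_lt_trans fM) ?ltry.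
have gfin : sqint mu (fun z => g z - f z) \is a fin_num by rewrite ge0_fin_numE ?sqint_ge0 // (lt_trans fg) ?ltry.
move: fM fg; rewrite -(fineK ffin) -(fineK gfin) -!EFinM -!EFinD !lee_fin lte_fin.
set x := fine _; set y := fine _ => xM.
rewrite ltr_pdivlMr // => yd.
have : k * x <= k * (M + 1) by rewrite ler_pM2l // (le_trans xM) // lerDl.
have -> : k * (M + 1) = e / 2 by rewrite /k; field; rewrite gt_eqF.
rewrite mulrDl mul1r -addrA lerD2l => kx.
by rewrite [leRHS]splitr lerD // mulrC ltW.
Qed.

Lemma parallelogram (f g : T -> R) : measurable_fun setT f -> measurable_fun setT g ->
  (sqint mu (fun z => f z - g z)%R + 4%:E * sqint mu (fun z => (f z + g z) / 2)%R =
   2%:E * sqint mu f + 2%:E * sqint mu g)%E.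
Proof.
move=> mf mg.
have ms : measurable_fun setT (fun z => (f z + g z) / 2).
  by apply: measurable_funM => //; exact: measurable_funD.
have md : measurable_fun setT (fun z => f z - g z) by exact: measurable_funB.
rewrite /sqint -!ge0_integralZl_EFin //; try exact: measurable_sqr;
  try by move=> z _; rewrite lee_fin sqr_ge0.
rewrite -!ge0_integralD //; try (by apply: measurable_funeM; exact: measurable_sqr);
  try exact: measurable_sqr; try (by move=> z _; rewrite ?mule_ge0 // lee_fin sqr_ge0).
apply: eq_integral => z _; rewrite -!EFinM -!EFinD; congr EFin.
by field.
Qed.

End square_integral_continuity.

Section minimal_selection.
Context d (T : measurableType d) (R : realType) (mu : {measure set T -> \bar R}).
Context dY (Y : measurableType dY).
Variables (h : nat -> T -> R) (B : nat -> (T -> R) -> \bar R) (a : nat -> Y -> \bar R).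

Definition nnL2 (f : T -> R) :=
  [/\ measurable_fun setT f, forall z, 0 <= f z & (sqint mu f < +oo)%E].

Hypothesis h_nn : forall i, nnL2 (h i).
Hypothesis h_dense : forall f, nnL2 f -> forall e : R, 0 < e ->
  exists i, (sqint mu (fun z => f z - h i z)%R < e%:E)%E.
Hypothesis h_avg : forall i j, exists k, h k = (fun z => (h i z + h j z) / 2).
(** The next two conditions say that the constraints [a k y <= B k G] are stable under averages and
    closed in L^2, which is what a projection argument in a Hilbert space asks for. *)
Hypothesis B_avg : forall k f g c, nnL2 f -> nnL2 g -> (c <= B k f)%E -> (c <= B k g)%E ->
  (c <= B k (fun z => (f z + g z) / 2)%R)%E.
Hypothesis B_cont : forall k (e : R), 0 < e -> exists dl : R, 0 < dl /\
  forall f g, nnL2 f -> nnL2 g -> (sqint mu (fun z => f z - g z)%R < dl%:E)%E ->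
    (B k f <= B k g + e%:E)%E.
Hypothesis ma : forall k, measurable_fun setT (a k).

Definition admissible (y : Y) (G : T -> R) := nnL2 G /\ forall k, (a k y <= B k G)%E.

(* Near-solutions of the first [n] constraints in the dense family, and [dn n y]
   the infimum of their squared norms; [dn n y] increases to the least squared
   norm of a solution. *)
Let feas (n : nat) (y : Y) : set nat :=
  [set i | forall k, (k <= n)%N -> (a k y <= B k (h i) + (n.+1%:R^-1)%:E)%E].

Let dn n y := ereal_inf [set sqint mu (h i) | i in feas n y].

Let dn_ge0 n y : (0 <= dn n y)%E.
Proof. by apply: le_ereal_inf_tmp => _ [i _ <-]; exact: sqint_ge0. Qed.

Let dn_homo n m y : (n <= m)%N -> (dn n y <= dn m y)%E.
Proof.
move=> nm; apply: ereal_inf_le_tmp => _ [i fi <-]; exists i => // k kn.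
apply: le_trans (fi k (leq_trans kn nm)) _.
by rewrite leeD2l // lee_fin lef_pV2 ?posrE // ler_nat.
Qed.

Let nn_sub f g : nnL2 f -> nnL2 g -> sqint mu (fun z => f z - g z) = sqint mu (fun z => g z - f z).
Proof.
by move=> _ _; rewrite /sqint; apply: eq_integral => z _; rewrite -sqrrN opprB.
Qed.

(** A solution need not belong to the dense family, but a close member of the family satisfies
    finitely many constraints up to the slack 1/(n+1) and has almost the same norm. *)
Let dn_le n y G : admissible y G -> (dn n y <= sqint mu G)%E.
Proof.
move=> [nG aG]; have [mG G0 Gfin] := nG.
have Gf : sqint mu G \is a fin_num by rewrite ge0_fin_numE ?sqint_ge0.
apply/lee_addgt0Pr => e e0.
have [dl [dl0 hdl]] := sqint_near mu (fine_ge0 (sqint_ge0 mu G)) e0.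
have [dl' [dl'0 hdl']] : exists dl' : R, 0 < dl' /\ forall k g, (k <= n)%N -> nnL2 g ->
    (sqint mu (fun z => G z - g z)%R < dl'%:E)%E -> (B k G <= B k g + (n.+1%:R^-1)%:E)%E.
  have n0 : 0 < n.+1%:R^-1 :> R by rewrite invr_gt0.
  suff H m : exists dl' : R, 0 < dl' /\ forall k g, (k < m)%N -> nnL2 g ->
    (sqint mu (fun z => G z - g z)%R < dl'%:E)%E -> (B k G <= B k g + (n.+1%:R^-1)%:E)%E.
    by have [dl' [? H']] := H n.+1; exists dl'.
  elim: m => [|m [d1 [d10 H1]]]; first by exists 1.
  have [d2 [d20 H2]] := B_cont m n0.
  exists (Num.min d1 d2); split; first by rewrite lt_min d10.
  move=> k g; rewrite ltnS leq_eqVlt => /predU1P[->|km] ng hg.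
    by apply: H2 => //; apply: lt_le_trans hg _; rewrite lee_fin ge_min lexx orbT.
  by apply: H1 => //; apply: lt_le_trans hg _; rewrite lee_fin ge_min lexx.
have m0 : 0 < Num.min dl dl' by rewrite lt_min dl0.
have [i hi] := h_dense nG m0.
apply: (@le_trans _ _ (sqint mu (h i))).
  apply: ereal_inf_lbound; exists i => // k kn.
  apply: le_trans (aG k) _; apply: hdl' => //.
  by apply: lt_le_trans hi _; rewrite lee_fin ge_min lexx orbT.
have [mh _ _] := h_nn i.
apply: hdl => //; first by rewrite fineK.
by rewrite nn_sub //; apply: lt_le_trans hi _; rewrite lee_fin ge_min lexx.
Qed.

Let measurable_feas n i : measurable [set y | feas n y i].
Proof.
rewrite (_ : [set y | _] = \bigcap_(k in [set k | (k <= n)%N])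
   [set y | (a k y <= B k (h i) + (n.+1%:R^-1)%:E)%E]) //.
rewrite bigcap_mkcond; apply: bigcapT_measurable => k; case: ifPn => _ //.
rewrite -[X in measurable X]setTI; apply: measurable_lee => //; exact: measurable_cst.
Qed.

Let measurable_dn n : measurable_fun setT (dn n).
Proof.
apply: (measurability _ (ErealGenInftyO.measurableE R)) => //.
move=> _ [_ [r ->] <-]; rewrite setTI.
rewrite (_ : _ @^-1` _ = \bigcup_(i in [set i | (sqint mu (h i) < r%:E)%E]) [set y | feas n y i]).
  by apply: bigcup_measurable => i _; exact: measurable_feas.
apply/seteqP; split=> y /=.
  by rewrite in_itv /= => /ereal_inf_lt[_ [i fi <-] ir]; exists i.
move=> [i /= ir fi]; rewrite in_itv /=; apply: le_lt_trans ir.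
by apply: ereal_inf_lbound; exists i.
Qed.

(* [c] codes a pair [(n, i)] such that [h i] is within [8^-j] of optimality at
   stage [n] and [dn _ y] is stationary up to [8^-j] from stage [n] on. *)
Let Q (j : nat) (c : nat) : set Y :=
  if (unpickle c : option (nat * nat)) is Some (n, i) then
    if (j <= n)%N then [set y | feas n y i] `&`
      [set y | (sqint mu (h i) <= dn n y + ((8^-1) ^+ j)%:E)%E] `&`
      \bigcap_m [set y | (dn (n + m) y <= dn n y + ((8^-1) ^+ j)%:E)%E]
    else set0
  else set0.

Let measurable_Q j c : measurable (Q j c).
Proof.
rewrite /Q; case: unpickle => [[n i]|] //; case: ifPn => // _.
have md : measurable_fun setT (fun y => dn n y + ((8^-1) ^+ j)%:E)%E by exact: emeasurable_funD.
apply: measurableI; last first.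
  by apply: bigcapT_measurable => m; rewrite -[X in measurable X]setTI; exact: measurable_lee.
apply: measurableI; first exact: measurable_feas.
by rewrite -[X in measurable X]setTI; apply: measurable_lee.
Qed.

(** The values dn n y increase with n and stay below the squared norm of a solution, so from some
    stage on they are within 8^-j of their supremum; a near-minimiser is taken at such a stage. The
    stage is at least j, so that the slack 1/(n+1) tends to 0 along the sequence. *)
Let Q_ex j y G : admissible y G -> exists c, Q j c y.
Proof.
move=> aG; have [[_ _ Gfin] _] := aG.
have e0 : 0 < (8^-1) ^+ j :> R by rewrite exprn_gt0.
pose D := ereal_sup (range (fun n => dn n y)).
have DG : (D <= sqint mu G)%E by apply: ge_ereal_sup => _ [n _ <-]; exact: dn_le.
have D0 : (0 <= D)%E by apply: ereal_sup_ge; exists (dn 0%N y) => //; exact: dn_ge0.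
have Df : D \is a fin_num by rewrite ge0_fin_numE // (le_lt_trans DG).
have [n0 hn0] : exists n0, (D - ((8^-1) ^+ j)%:E < dn n0 y)%E.
  have [_ [n _ <-] h1] := @ub_ereal_sup_adherent _ (range (fun n => dn n y)) _ e0 Df.
  by exists n.
pose n := maxn n0 j.
have hn m : (dn (n + m) y <= dn n y + ((8^-1) ^+ j)%:E)%E.
  apply: (@le_trans _ _ D); first by apply: ereal_sup_ubound; exists (n + m)%N.
  rewrite -leeBlDr //; apply: le_trans (ltW hn0) _; apply: dn_homo; exact: leq_maxl.
have dnf : dn n y \is a fin_num.
  by rewrite ge0_fin_numE // (le_lt_trans (dn_le n aG)).
have [_ [i fi <-] hi] := @lb_ereal_inf_adherent _ [set sqint mu (h i) | i in feas n y] _ e0 dnf.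
exists (pickle (n, i)); rewrite /Q pickleK leq_maxr; split => //.
  by split; [exact: fi|exact: (ltW hi)].
by move=> m _; exact: hn.
Qed.

Lemma minimal_selection : exists G : Y * T -> R,
  [/\ measurable_fun setT G, forall p, 0 <= G p &
    forall y, (exists G', admissible y G') -> admissible y (fun z => G (y, z)) /\
      forall G', admissible y G' -> (sqint mu (fun z => G (y, z)) <= sqint mu G')%E].
Proof.
have /choice[sel hsel] : forall j, exists sel : Y -> nat,
    (forall c, measurable (sel @^-1` [set c])) /\ forall y, (exists c, Q j c y) -> Q j (sel y) y.
  by move=> j; apply: measurable_first_index; exact: measurable_Q.
(* G is defined for every y. Where there is no solution the selected numbers carry no meaning, and
   index 0 replaces those that code no pair. *)
pose ind (c : nat) := if (unpickle c : option (nat * nat)) is Some (n, i) then i else 0%N.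
pose H j (p : Y * T) := h (ind (sel j p.1)) p.2.
have mH j : measurable_fun setT (H j).
  move=> _ E mE; rewrite setTI.
  rewrite (_ : _ @^-1` _ = \bigcup_c ((sel j @^-1` [set c]) `*` (h (ind c) @^-1` E))).
    apply: bigcupT_measurable => c; apply: measurableX; first by have [] := hsel j.
    have [mh _ _] := h_nn (ind c).
    by have := mh measurableT _ mE; rewrite setTI.
  apply/seteqP; split=> [[y z] Hyz|[y z] [c _ [/= <-]]] //.
  by exists (sel j y).
have H0 j p : 0 <= H j p by have [_ + _] := h_nn (ind (sel j p.1)); apply.
pose G (p : Y * T) := fine (limn_esup (fun j => (H j p)%:E)).
have mG : measurable_fun setT G.
  apply: measurableT_comp => //; apply: measurable_fun_limn_esup => j.
  exact/measurable_EFinP.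
have G0 p : 0 <= G p.
  by apply: fine_ge0; apply: limf_esup_ge0 => // j; rewrite lee_fin.
exists G; split => // y [G' aG'].
have selQ j : Q j (sel j y) y by have [_] := hsel j; apply; exact: (Q_ex j aG').
have /choice[n_ /choice[i_ hni]] : forall j, exists n i, [/\ (j <= n)%N, feas n y i,
     (sqint mu (h i) <= dn n y + ((8^-1) ^+ j)%:E)%E,
     forall m, (n <= m)%N -> (dn m y <= dn n y + ((8^-1) ^+ j)%:E)%E & ind (sel j y) = i].
  move=> j; move: (selQ j); rewrite /Q /ind; case: unpickle => [[n i]|] //; case: ifPn => // jn.
  move=> [[f1 f2] f3]; exists n, i; split => // m nm.
  by have := f3 (m - n)%N Logic.I; rewrite /= subnKC.
have hE j : (fun z => H j (y, z)) = h (i_ j).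
  by apply/funext => z; rewrite /H /=; have [_ _ _ _ ->] := hni j.
have dnfin n : dn n y \is a fin_num.
  by rewrite ge0_fin_numE // (le_lt_trans (dn_le n aG')) //; case: aG' => -[].
have hfin i : sqint mu (h i) \is a fin_num.
  by rewrite ge0_fin_numE ?sqint_ge0 //; have [] := h_nn i.
have cauchy j l : (j <= l)%N ->
    (sqint mu (fun z => h (i_ l) z - h (i_ j) z)%R <= (6 * (8^-1) ^+ j)%:E)%E.
  move=> jl; have [jn fn qn mn _] := hni j; have [ln fl ql ml _] := hni l.
  have [k hk] := h_avg (i_ l) (i_ j).
  have [mhj _ _] := h_nn (i_ j); have [mhl _ _] := h_nn (i_ l).
  (* j <= l does not imply that the stages n_ j and n_ l are in the same order. The average is
     feasible at the smaller stage, so its squared norm is at least [dn p y]. *)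
  pose p := minn (n_ j) (n_ l).
  have fk : feas p y k.
    move=> q qp; rewrite hk.
    have pos : ((p.+1%:R^-1)%:E : \bar R) \is a fin_num by [].
    rewrite -leeBlDr //; apply: B_avg => //; rewrite leeBlDr //.
      apply: le_trans (fl q (leq_trans qp (geq_minr _ _))) _.
      by rewrite leeD2l // lee_fin lef_pV2 ?posrE // ler_nat ltnS geq_minr.
    apply: le_trans (fn q (leq_trans qp (geq_minl _ _))) _.
    by rewrite leeD2l // lee_fin lef_pV2 ?posrE // ler_nat ltnS geq_minl.
  have dk : (dn p y <= sqint mu (h k))%E by apply: ereal_inf_lbound; exists k.
  have := parallelogram mu mhl mhj; rewrite -hk => par.
  have e8 : (8^-1) ^+ l <= (8^-1) ^+ j :> R.
    by rewrite ler_wiXn2l // invf_le1 // ler1n.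
  have Dfin : sqint mu (fun z => h (i_ l) z - h (i_ j) z) \is a fin_num.
    rewrite ge0_fin_numE ?sqint_ge0 //.
    apply: (@le_lt_trans _ _ (2%:E * sqint mu (h (i_ l)) + 2%:E * sqint mu (h (i_ j)))%E).
      by rewrite -par leeDl // mule_ge0 // sqint_ge0.
    by rewrite -(fineK (hfin (i_ l))) -(fineK (hfin (i_ j))) -!EFinM -EFinD ltry.
  have qj : (sqint mu (h (i_ j)) <= dn p y + ((8^-1) ^+ j + (8^-1) ^+ l)%:E)%E.
    rewrite /p /minn; case: ltnP => [_|ln'].
      by apply: le_trans qn _; rewrite leeD2l // lee_fin lerDl exprn_ge0.
    apply: le_trans qn _; rewrite (addrC (8^-1 ^+ j)) EFinD addeA leeD2r //; exact: ml.
  have ql' : (sqint mu (h (i_ l)) <= dn p y + ((8^-1) ^+ j + (8^-1) ^+ l)%:E)%E.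
    rewrite /p /minn; case: ltnP => [ln'|_].
      apply: le_trans ql _; rewrite EFinD addeA leeD2r //; apply: mn; exact: ltnW.
    by apply: le_trans ql _; rewrite leeD2l // lee_fin lerDr exprn_ge0.
  have qn' : (n_ j < n_ l)%N \/ (n_ l <= n_ j)%N by case: ltnP; [left|right].
  (* The element chosen at stage p exceeds dn p by one error, the other one by two, the second being
     the growth of dn between the stages. With the parallelogram identity, 2 (2 dn p + 3 * 8^-j) - 4
     dn p gives the constant 6. *)
  have sharp : (sqint mu (h (i_ j)) + sqint mu (h (i_ l)) <= 2%:E * dn p y + (3 * (8^-1) ^+ j)%:E)%E.
    move: qn ql qj ql' mn ml; rewrite /p /minn; case: ltnP => [nl|nl] qn ql qj ql' mn ml.
      have := leeD qn ql'; move/le_trans; apply.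
      rewrite -(fineK (dnfin (n_ j))) -!EFinM -!EFinD lee_fin; lra.
    have := leeD qj ql; move/le_trans; apply.
    rewrite -(fineK (dnfin (n_ l))) -!EFinM -!EFinD lee_fin; lra.
  move: par dk sharp; rewrite -(fineK Dfin) -(fineK (hfin k)) -(fineK (hfin (i_ l))) -(fineK (hfin (i_ j))) -(fineK (dnfin p)).
  rewrite -!EFinM -!EFinD !lee_fin => -[]; lra.
have hC j l : (j <= l)%N -> (sqint mu (fun z => H l (y, z) - H j (y, z))%R <= (6 * (8^-1) ^+ j)%:E)%E.
  move=> jl; have := cauchy _ _ jl; congr (_ <= _)%E.
  by rewrite /sqint; apply: eq_integral => z _; rewrite -!hE.
have mHy j : measurable_fun setT (fun z => H j (y, z)).
  by rewrite hE; have [] := h_nn (i_ j).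
have GH j : (sqint mu (fun z => G (y, z) - h (i_ j) z)%R <= (6 * (8^-1) ^+ j)%:E)%E.
  by rewrite -hE; exact: (sqint_fast_cauchy mHy hC j).
have mGy : measurable_fun setT (fun z => G (y, z)) by exact: measurable_fun_pair2.
have small (e : R) : 0 < e -> exists J, forall j, (J <= j)%N -> 6 * (8^-1) ^+ j < e /\ j.+1%:R^-1 < e.
  move=> e0.
  have c1 : (fun j => 6 * (8^-1) ^+ j : R) @ \oo --> (0 : R).
    rewrite -(mulr0 (6 : R)); apply: cvgM; first exact: cvg_cst.
    by apply: cvg_expr; rewrite ger0_norm // invf_lt1 // ltr1n.
  have c2 : (fun j => j.+1%:R^-1 : R) @ \oo --> (0 : R) by exact: cvg_harmonic.
  have := cvgr_lt 0 c1 _ e0; have := cvgr_lt 0 c2 _ e0.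
  move=> [J1 _ h1] [J2 _ h2]; exists (maxn J1 J2) => j; rewrite geq_max => /andP[j1 j2].
  by split; [exact: h2|exact: h1].
have Gy2 : (sqint mu (fun z => G (y, z)) < +oo)%E.
  have [mh0 _ h02] := h_nn (i_ 0%N).
  apply: le_lt_trans.
    apply: (@sqintD _ _ _ mu (h (i_ 0%N)) (fun z => G (y, z) - h (i_ 0%N) z)) => //.
      exact: measurable_funB.
    move=> z; rewrite [X in X ^+ 2 <= _](_ : _ = h (i_ 0%N) z + (G (y, z) - h (i_ 0%N) z)).
      exact: sqrD_le2.
    by rewrite addrC subrK.
  rewrite lte_add_pinfty // lte_mul_pinfty //.
  by apply: le_lt_trans (GH 0%N) _; rewrite ltry.
have nGy : nnL2 (fun z => G (y, z)) by split.
split; first split => //.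
  move=> k; apply/lee_addgt0Pr => e e0.
  have e2 : 0 < e / 2 by rewrite divr_gt0.
  have [dl [dl0 hdl]] := B_cont k e2.
  have m0 : 0 < Num.min dl (e / 2) by rewrite lt_min dl0.
  have [J hJ] := small _ m0.
  (* j >= k ensures that the k-th constraint is among those imposed at stage n_ j. *)
  pose j := maxn J k; have [h1 h2] := hJ j (leq_maxl _ _).
  have [jn fj _ _ _] := hni j.
  apply: le_trans (fj k (leq_trans (leq_maxr _ _) jn)) _.
  rewrite [e]splitr EFinD addeA; apply: leeD.
    apply: hdl => //; rewrite nn_sub //; apply: le_lt_trans (GH j) _.
    by rewrite lte_fin (lt_le_trans h1) // ge_min lexx.
  rewrite lee_fin; apply: le_trans (_ : j.+1%:R^-1 <= _).
    by rewrite lef_pV2 ?posrE // ler_nat.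
  by rewrite ltW // (lt_le_trans h2) // ge_min lexx orbT.
move=> G'' aG''; apply/lee_addgt0Pr => e e0.
have [[_ _ G''2] _] := aG''.
have G''f : sqint mu G'' \is a fin_num by rewrite ge0_fin_numE ?sqint_ge0.
have e2 : 0 < e / 2 by rewrite divr_gt0.
(* [sqint_near] needs a norm bound that is known before J is chosen; this one holds for all h (i_ J)
   with 8^-J <= e/2. *)
have M0 : 0 <= fine (sqint mu G'') + e / 2 by rewrite addr_ge0 ?fine_ge0 ?sqint_ge0 // ltW.
have [dl [dl0 hdl]] := sqint_near mu M0 e2.
have m0 : 0 < Num.min dl (e / 2) by rewrite lt_min dl0.
have [J hJ] := small _ m0; have [h1 h2] := hJ J (leqnn _).
have [mhJ _ _] := h_nn (i_ J).
have [_ _ qJ _ _] := hni J.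
have hJG : (sqint mu (h (i_ J)) <= sqint mu G'' + (e / 2)%:E)%E.
  apply: le_trans qJ _; apply: leeD; first exact: dn_le.
  rewrite lee_fin; apply: (@le_trans _ _ (6 * 8^-1 ^+ J)).
    by rewrite ler_peMl ?exprn_ge0 // ler1n.
  by rewrite ltW // (lt_le_trans h1) // ge_min lexx orbT.
apply: (@le_trans _ _ (sqint mu (h (i_ J)) + (e / 2)%:E)%E).
  apply: hdl => //; first by rewrite EFinD fineK.
  by apply: le_lt_trans (GH J) _; rewrite lte_fin (lt_le_trans h1) // ge_min lexx.
by rewrite [in leRHS](splitr e) EFinD addeA leeD2r.
Qed.

End minimal_selection.

Import HBNNSimple.

(** * Reduction to countably many plans *)

Section weighted_pushforward.
Context d1 d2 (T1 : measurableType d1) (T2 : measurableType d2) (R : realType).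
Variables (m : {measure set T1 -> \bar R}) (f : T1 -> T2) (w : T1 -> \bar R).
Hypothesis mf : measurable_fun setT f.
Hypothesis mw : measurable_fun setT w.
Hypothesis w0 : forall x, (0 <= w x)%E.

(** The image of the measure with density w. It serves as plain image measure for w = 1, as image of
    a restriction when w is an indicator, and as measure with density when f is the identity. *)
Definition wpush (A : set T2) : \bar R := (\int[m]_(x in f @^-1` A) w x)%E.

Lemma wpush_measure : exists M : {measure set T2 -> \bar R}, (M : set T2 -> \bar R) = wpush.
Proof.
have h0 : wpush set0 = 0%E by rewrite /wpush preimage_set0 integral_set0.
have hge A : (0 <= wpush A)%E by apply: integral_ge0 => x _; exact: w0.
have hsa : semi_sigma_additive wpush.
  move=> F mF tF mUF; rewrite /wpush preimage_bigcup.
  apply: (semi_sigma_additive_nng_induced mw w0).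
  - by move=> i; rewrite -[X in measurable X]setTI; exact: mf.
  - move/trivIsetP : tF => tF; apply/trivIsetP => i j _ _ ij; rewrite -preimage_setI.
    by rewrite (tF i j) // preimage_set0.
  - by rewrite -preimage_bigcup -[X in measurable X]setTI; exact: mf.
by pose M : {measure set T2 -> \bar R} := HB.pack wpush (isMeasure.Build _ T2 R wpush h0 hge hsa); exists M.
Qed.

Lemma integral_wpush (M : {measure set T2 -> \bar R}) : (M : set T2 -> \bar R) = wpush ->
  forall h : T2 -> \bar R, measurable_fun setT h -> (forall y, (0 <= h y)%E) ->
  (\int[M]_y h y = \int[m]_x (h (f x) * w x))%E.
Proof.
move=> ME h mh h0.
have indic (A : set T2) : measurable A ->
    (\int[M]_y (\1_A y)%:E = \int[m]_x ((\1_A (f x))%:E * w x))%E.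
  move=> mA; rewrite integral_indic // setIT ME /wpush integral_mkcond.
  apply: eq_integral => x _; rewrite /patch indicE.
  have -> : (x \in f @^-1` A) = (f x \in A) by apply/idP/idP; rewrite !inE.
  by case: (_ \in _); rewrite ?mul1e ?mul0e.
have simple (s : {nnsfun T2 >-> R}) :
    (\int[M]_y (s y)%:E = \int[m]_x ((s (f x))%:E * w x))%E.
  under [LHS]eq_integral do rewrite fimfunE -fsumEFin//.
  rewrite [LHS]ge0_integral_fsum//; last 2 first.
    - by move=> r; exact/measurable_EFinP/measurableT_comp.
    - by move=> n x _; rewrite EFinM nnfun_muleindic_ge0.
  under [RHS]eq_integral.
    move=> x _; rewrite fimfunE -fsumEFin // ge0_mule_fsuml; last first.
      by move=> r; rewrite EFinM nnfun_muleindic_ge0.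
    over.
  have mi r : measurable_fun setT (fun x => \1_(s @^-1` [set r]) (f x) : R).
    by apply: (measurableT_comp (f := fun y => \1_(s @^-1` [set r]) y : R)) => //; exact: measurable_indic.
  have mterm r : measurable_fun setT (fun x => (\1_(s @^-1` [set r]) (f x))%:E * w x)%E.
    by apply: emeasurable_funM => //; exact/measurable_EFinP.
  rewrite [RHS]ge0_integral_fsum //; last 2 first.
  - by move=> r; apply: emeasurable_funM => //; apply/measurable_EFinP; exact: measurable_funM.
  - by move=> r x _; rewrite mule_ge0 // EFinM nnfun_muleindic_ge0.
  apply: eq_fsbigr => r; rewrite inE => -[y _ sy].
  have r0 : 0 <= r by rewrite -sy fun_ge0.
  transitivity (r%:E * \int[M]_y (\1_(s @^-1` [set r]) y)%:E)%E.
    rewrite -ge0_integralZl_EFin //; last by apply/measurable_EFinP; exact: measurable_indic.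
  rewrite indic // -ge0_integralZl_EFin //; last by move=> x _; rewrite mule_ge0.
  by apply: eq_integral => z _; rewrite EFinM muleA.
have mhT := mh; pose s n := nnsfun_approx measurableT mh n.
have sc y : (s n y)%:E @[n --> \oo] --> h y.
  exact: (@cvg_nnsfun_approx _ _ _ setT measurableT h mh (fun x _ => h0 x) y Logic.I).
have sm y : {homo (fun n => (s n y)%:E) : n k / (n <= k)%N >-> (n <= k)%E}.
  by move=> n k nk; rewrite lee_fin; exact/lefP/nd_nnsfun_approx.
transitivity (limn (fun n => \int[M]_y (s n y)%:E)%E).
  rewrite -monotone_convergence //=.
  - by apply: eq_integral => y _; apply/esym/cvg_lim.
  - by move=> n; exact/measurable_EFinP.
  - by move=> n y _; rewrite lee_fin.
transitivity (limn (fun n => \int[m]_x ((s n (f x))%:E * w x))%E).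
  by congr (limn _); apply/funext => n; exact: simple.
rewrite -monotone_convergence //=.
- apply: eq_integral => x _; apply/cvg_lim => //.
  (* Multiplication by +oo is not continuous at 0, so an infinite weight is treated apart: the
     products are constantly 0 if h (f x) = 0 and eventually +oo otherwise. *)
  have [wf|wi] := boolP (w x \is a fin_num).
    by apply: cvgeZr => //; exact: sc.
  have -> : w x = +oo%E by apply/eqP; move: wi; rewrite ge0_fin_numE // -leNgt leye_eq.
  have [hx|hx] := eqVneq (h (f x)) 0%E.
    rewrite hx mul0e; have -> : (fun n => (s n (f x))%:E * +oo)%E = cst 0%E.
      apply/funext => n; have : ((s n (f x))%:E <= h (f x))%E.
        rewrite (cvg_unique _ (sc (f x)) (ereal_nondecreasing_cvgn (sm (f x)))) //.
        by apply: ereal_sup_ubound; exists n.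
      rewrite hx lee_fin => s0; have -> : s n (f x) = 0 by apply/eqP; rewrite eq_le s0 fun_ge0.
      by rewrite mul0e.
    exact: cvg_cst.
  have hx0 : (0 < h (f x))%E by rewrite lt_def hx h0.
  rewrite gt0_muley //.
  apply: (cvg_near_cst).
  have nb : \forall n \near \oo, (0 < (s n (f x))%:E)%E.
    apply: (sc (f x) [set y | (0 < y)%E]); apply: open_nbhs_nbhs; split => //; exact: open_ereal_gt_ereal.
  by apply: filterS nb => n sn; rewrite gt0_muley.
- by move=> n; apply: emeasurable_funM => //; apply/measurable_EFinP; exact: measurableT_comp.
- by move=> n x _; rewrite mule_ge0 // lee_fin.
- by move=> x _ n k nk; rewrite lee_wpmul2r //; exact: sm.
Qed.

End weighted_pushforward.

(** * Oscillation and cost of a plan *)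

Section plan_functionals.
Context (R : realType) (Z : pmetricType R).
Implicit Types (mu : {measure set (borel Z) -> \bar R}) (P : {finite_measure set (borel (Cpath Z)) -> \bar R}).
Implicit Types (f G : borel Z -> R).
Let T := borel (unit_itv R).
Let C := borel (Cpath Z).

Definition plan_osc P f : \bar R :=
  (\int[P]_g `|f ((g : Cpath Z) i1) - f ((g : Cpath Z) i0)|%:E)%E.

Definition plan_cost P G : \bar R :=
  (\int[P]_g \int[leb01]_s ((G ((g : Cpath Z) s))%:E * speed (g : Cpath Z) s))%E.

Lemma measurable_eval_fun f (t : unit_itv R) : measurable_fun setT f ->
  measurable_fun setT (fun g : C => f ((g : Cpath Z) t)).
Proof. by move=> mf; apply: (measurableT_comp (f := f) mf (g := fun g : C => (g : Cpath Z) t : borel Z)); exact: eval_measurable. Qed.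

Lemma measurable_joint_fun f : measurable_fun setT f ->
  measurable_fun setT (fun p : C * T => f ((p.1 : Cpath Z) p.2)).
Proof. by move=> mf; apply: (measurableT_comp (f := f) mf (g := fun p : C * T => (p.1 : Cpath Z) p.2 : borel Z)); exact: joint_eval_measurable. Qed.

Lemma measurable_osc f : measurable_fun setT f ->
  measurable_fun setT (fun g : C => `|f ((g : Cpath Z) i1) - f ((g : Cpath Z) i0)|%:E).
Proof.
move=> mf; apply/measurable_EFinP; apply: measurableT_comp => //.
by apply: measurable_funB; exact: measurable_eval_fun.
Qed.

Lemma measurable_cost G : measurable_fun setT G ->
  measurable_fun setT (fun p : C * T => (G ((p.1 : Cpath Z) p.2))%:E * speed (p.1 : Cpath Z) p.2)%E.
Proof.
move=> mG; apply: emeasurable_funM; last exact: speed_measurable.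
by apply/measurable_EFinP; exact: measurable_joint_fun.
Qed.

Lemma measurable_int_cost G (D : set T) : measurable D -> measurable_fun setT G -> (forall z, 0 <= G z) ->
  measurable_fun setT (fun g : C => \int[leb01]_(s in D) ((G ((g : Cpath Z) s))%:E * speed (g : Cpath Z) s))%E.
Proof.
move=> mD mG G0.
apply: (@measurable_fun_integral_section _ _ C T R (@leb01 R) D
  (fun p => (G ((p.1 : Cpath Z) p.2))%:E * speed (p.1 : Cpath Z) p.2)%E) => //.
  exact: measurable_cost.
by move=> p; rewrite mule_ge0 // ?lee_fin // speed_ge0.
Qed.

(** Mass and compression are bounded by c and the energy by E. The moduli of continuity of
    oscillation and cost depend on c and E alone, hence are common to all plans with the same
    bounds. *)
Definition plan_bound (mu : set (borel Z) -> \bar R) (c E : R) P := [/\ 0 < c, (P setT <= c%:E)%E,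
  (forall (t : unit_itv R) (A : set (borel Z)), measurable A ->
     (pushforward P (fun g : C => (g : Cpath Z) t : borel Z) A <= c%:E * mu A)%E) &
  (\int[leb01]_t \int[P]_g (speed (g : Cpath Z) t ^+ 2) <= E%:E)%E].

Lemma plan_eval_le mu c E P (h : borel Z -> \bar R) t : plan_bound mu c E P ->
  measurable_fun setT h -> (forall z, (0 <= h z)%E) ->
  (\int[P]_g h ((g : Cpath Z) t) <= c%:E * \int[mu]_z h z)%E.
Proof.
move=> [c0 _ Pc _] mh h0.
have me := @eval_measurable R Z t.
have [M ME] := @wpush_measure _ _ C (borel Z) R P _ (cst 1%E) me (measurable_cst _) (fun=> lee01).
have -> : (\int[P]_g h ((g : Cpath Z) t) = \int[M]_z h z)%E.
  rewrite (@integral_wpush _ _ C (borel Z) R P _ (cst 1%E) me (measurable_cst _) (fun=> lee01) M ME h mh h0).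
  by apply: eq_integral => g _; rewrite mule1.
have -> : (c%:E * \int[mu]_z h z = \int[mscale (NngNum (ltW c0)) mu]_z h z)%E.
  by rewrite ge0_integral_mscale.
apply: ge0_le_measure_integral => //= A mA.
apply: (le_trans _ (Pc t A mA)); rewrite ME /wpush integral_cst //; first by rewrite mul1e.
by rewrite -[X in measurable X]setTI; exact: me.
Qed.

(** Young's inequality h * speed <= (l/2) h^2 + speed^2 / (2 l) under the integral. The parameter l
    is free, so that both terms can later be made small together. *)
Lemma plan_cost_le mu c E P (h : borel Z -> R) (l : R) : plan_bound mu c E P -> 0 < l ->
  measurable_fun setT h -> (forall z, 0 <= h z) ->
  (plan_cost P h <= (l / 2 * c)%:E * sqint mu h + ((2 * l)^-1 * E)%:E)%E.
Proof.
move=> Pb l0 mh h0; have [c0 _ _ PE] := Pb.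
have mh2 : measurable_fun setT (fun p : C * T => ((h ((p.1 : Cpath Z) p.2)) ^+ 2)%:E).
  by apply/measurable_EFinP; apply: measurable_funX; exact: measurable_joint_fun.
have l2 : 0 <= l / 2 by rewrite divr_ge0 // ltW.
have il : 0 <= (2 * l)^-1 by rewrite invr_ge0 mulr_ge0 // ltW.
pose F (p : C * T) := ((l / 2)%:E * ((h ((p.1 : Cpath Z) p.2)) ^+ 2)%:E + ((2 * l)^-1)%:E * speed (p.1 : Cpath Z) p.2 ^+ 2)%E.
have mF : measurable_fun setT F.
  by apply: emeasurable_funD; apply: measurable_funeM => //; exact: speed_sqr_measurable.
have F0 p : (0 <= F p)%E by rewrite adde_ge0 // mule_ge0 // ?lee_fin ?sqr_ge0 // sqre_ge0.
have F_ge g s : ((h ((g : Cpath Z) s))%:E * speed (g : Cpath Z) s <= F (g, s))%E.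
  rewrite /F /=; set x := h _; have := speed_ge0 g s; case: (speed g s) => [y| |] // y0.
    rewrite -!EFinM -EFinD lee_fin.
    have h1 : 0 <= (l * x - y) ^+ 2 / (2 * l) by rewrite divr_ge0 ?sqr_ge0 // mulr_ge0 // ltW.
    have h2 : l / 2 * x ^+ 2 + (2 * l)^-1 * (y * y) - x * y = (l * x - y) ^+ 2 / (2 * l).
      by field; rewrite gt_eqF.
    by rewrite -subr_ge0 h2.
  have -> : (((2 * l)^-1)%:E * (+oo * +oo) = +oo :> \bar R)%E.
    by rewrite mulyy gt0_muley // lte_fin invr_gt0 mulr_gt0.
  by rewrite addey ?leey // -EFinM.
apply: (@le_trans _ _ (\int[P]_g \int[leb01]_s F (g, s))%E).
  apply: ge0_le_integral => //.
  - by move=> g _; apply: integral_ge0 => s _; rewrite mule_ge0 // ?lee_fin // speed_ge0.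
  - exact: measurable_int_cost.
  - exact: (@measurable_fun_integral_section _ _ C T R (@leb01 R) setT F).
  - move=> g _; apply: ge0_le_integral => //.
    + by move=> s _; rewrite mule_ge0 // ?lee_fin // speed_ge0.
    + exact: (measurable_fun_pair2 (f := fun p : C * T => (h ((p.1 : Cpath Z) p.2))%:E * speed (p.1 : Cpath Z) p.2)%E g (measurable_cost mh)).
    + exact: (measurable_fun_pair2 g mF).
have := @fubini_tonelli _ _ C T R P (@leb01 R) F mF F0; rewrite /fubini_F /fubini_G => ->.
apply: (@le_trans _ _ (\int[leb01]_s ((l / 2 * c)%:E * sqint mu h + ((2 * l)^-1)%:E * \int[P]_g (speed (g : Cpath Z) s ^+ 2)))%E).
  have mS2 : measurable_fun setT (fun s : T => \int[P]_g (speed (g : Cpath Z) s ^+ 2))%E.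
    apply: (@measurable_fun_fubini_tonelli_G _ _ C T R P (fun p => speed (p.1 : Cpath Z) p.2 ^+ 2)%E) => //.
      exact: speed_sqr_measurable.
    by move=> p; rewrite sqre_ge0.
  apply: ge0_le_integral => //.
  - by move=> s _; apply: integral_ge0.
  - exact: (@measurable_fun_fubini_tonelli_G _ _ C T R P F).
  - by apply: emeasurable_funD => //; apply: measurable_funeM.
  - move=> s _; rewrite /F.
    have mh2s : measurable_fun setT (fun g : C => ((h ((g : Cpath Z) s)) ^+ 2)%:E).
      by apply/measurable_EFinP; apply: measurable_funX; exact: measurable_eval_fun.
    have ms2s : measurable_fun setT (fun g : C => speed (g : Cpath Z) s ^+ 2)%E.
      exact: (measurable_fun_pair1 s (@speed_sqr_measurable R Z)).
    rewrite ge0_integralD //; last 4 first.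
    + by move=> g _; rewrite mule_ge0 // lee_fin sqr_ge0.
    + exact: measurable_funeM.
    + by move=> g _; rewrite mule_ge0 ?lee_fin // sqre_ge0.
    + exact: measurable_funeM.
    rewrite ge0_integralZl_EFin //; last by move=> g _; rewrite lee_fin sqr_ge0.
    rewrite ge0_integralZl_EFin //; last by move=> g _; rewrite sqre_ge0.
    apply: leeD; last exact: lexx.
    rewrite [X in (_ <= X * _)%E]EFinM -muleA; apply: lee_wpmul2l => //.
    apply: (@plan_eval_le mu c E P (fun z => (h z ^+ 2)%:E) s Pb).
      exact: measurable_sqr.
    by move=> z; rewrite lee_fin sqr_ge0.
rewrite ge0_integralD //; last 3 first.
- by move=> s _; rewrite mule_ge0 ?sqint_ge0 // lee_fin mulr_ge0 // ltW.
- by move=> s _; rewrite mule_ge0 ?lee_fin //; apply: integral_ge0 => *; rewrite sqre_ge0.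
- apply: measurable_funeM; apply: (@measurable_fun_fubini_tonelli_G _ _ C T R P (fun p => speed (p.1 : Cpath Z) p.2 ^+ 2)%E) => //.
    exact: speed_sqr_measurable.
  by move=> p; rewrite sqre_ge0.
apply: leeD.
  have -> : (\int[leb01]_(_ in [set: T]) ((l / 2 * c)%:E * sqint mu h) = ((l / 2 * c)%:E * sqint mu h) * leb01 [set: T])%E.
    exact: (integral_cst (@leb01 R)).
  by rewrite [X in (_ * X)%E](@leb01T R) mule1.
rewrite ge0_integralZl_EFin //.
- by rewrite EFinM lee_wpmul2l.
- by move=> s _; apply: integral_ge0 => *; rewrite sqre_ge0.
- apply: (@measurable_fun_fubini_tonelli_G _ _ C T R P (fun p => speed (p.1 : Cpath Z) p.2 ^+ 2)%E) => //.
    exact: speed_sqr_measurable.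
  by move=> p; rewrite sqre_ge0.
Qed.

(** From |x - y| <= l/2 + (x^2 + y^2) / l. The first term is integrated against the total mass, the
    others are bounded by compression at the two end times. *)
Lemma plan_osc_le mu c E P (h : borel Z -> R) (l : R) : plan_bound mu c E P -> 0 < l ->
  measurable_fun setT h ->
  (plan_osc P h <= (l / 2 * c)%:E + (2 / l * c)%:E * sqint mu h)%E.
Proof.
move=> Pb l0 mh; have [c0 Pc _ _] := Pb.
have mt t : measurable_fun setT (fun g : C => (l^-1 * h ((g : Cpath Z) t) ^+ 2)%:E).
  apply/measurable_EFinP; apply: measurable_funM => //; apply: measurable_funX.
  exact: measurable_eval_fun.
have t0 (g : C) t : (0 <= (l^-1 * h ((g : Cpath Z) t) ^+ 2)%:E)%E.
  by rewrite lee_fin mulr_ge0 ?sqr_ge0 // invr_ge0 ltW.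
have l2 : (0 <= (l / 2)%:E)%E by rewrite lee_fin divr_ge0 // ltW.
apply: (@le_trans _ _ (\int[P]_g ((l / 2)%:E + ((l^-1 * h ((g : Cpath Z) i1) ^+ 2)%:E + (l^-1 * h ((g : Cpath Z) i0) ^+ 2)%:E)))%E).
  apply: ge0_le_integral => //.
  - exact: measurable_osc.
  - by apply: emeasurable_funD => //; exact: emeasurable_funD.
  - move=> g _; rewrite -!EFinD lee_fin; set x := h _; set y := h _.
    have h1 : 0 <= (`|x - y| - l) ^+ 2 + (x + y) ^+ 2 by rewrite addr_ge0 ?sqr_ge0.
    have h2 : l / 2 + (l^-1 * x ^+ 2 + l^-1 * y ^+ 2) - `|x - y| = ((`|x - y| - l) ^+ 2 + (x + y) ^+ 2) / (2 * l).
      have h3 : `|x - y| ^+ 2 = (x - y) ^+ 2 by rewrite real_normK // num_real.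
      have -> : (`|x - y| - l) ^+ 2 = (x - y) ^+ 2 - 2 * l * `|x - y| + l ^+ 2.
        by rewrite -h3; ring.
      by field; rewrite gt_eqF.
    by rewrite -subr_ge0 h2 divr_ge0 // mulr_ge0 // ltW.
rewrite ge0_integralD //; last 2 first.
- by move=> g _; rewrite adde_ge0.
- exact: emeasurable_funD.
rewrite ge0_integralD //.
have eb t : (\int[P]_g (l^-1 * h ((g : Cpath Z) t) ^+ 2)%:E <= (l^-1 * c)%:E * sqint mu h)%E.
  have mh2 : measurable_fun setT (fun g : C => (h ((g : Cpath Z) t) ^+ 2)%:E).
    by apply/measurable_EFinP; apply: measurable_funX; exact: measurable_eval_fun.
  under eq_integral do rewrite EFinM.
  rewrite ge0_integralZl_EFin //; last 2 first.
  - by move=> g _; rewrite lee_fin sqr_ge0.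
  - by rewrite invr_ge0 ltW.
  rewrite [X in (_ <= X * _)%E]EFinM -muleA; apply: lee_wpmul2l; first by rewrite lee_fin invr_ge0 ltW.
  apply: (@plan_eval_le mu c E P (fun z => (h z ^+ 2)%:E) t Pb).
    exact: measurable_sqr.
  by move=> z; rewrite lee_fin sqr_ge0.
apply: leeD.
  rewrite integral_cst // [X in (_ <= X)%E]EFinM; exact: lee_wpmul2l.
apply: (le_trans (leeD (eb i1) (eb i0))).
have -> : 2 / l * c = l^-1 * c + l^-1 * c by ring.
have lc : (0 <= (l^-1 * c)%:E)%E by rewrite lee_fin mulr_ge0 ?invr_ge0 // ltW.
by rewrite EFinD ge0_muleDl.
Qed.

Lemma plan_osc_cont mu c E : 0 < c -> forall e : R, 0 < e -> exists dl : R, 0 < dl /\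
  forall P, plan_bound mu c E P -> forall f g : borel Z -> R, measurable_fun setT f -> measurable_fun setT g ->
    (sqint mu (fun z => f z - g z)%R < dl%:E)%E -> (plan_osc P f <= plan_osc P g + e%:E)%E.
Proof.
(* With l = e / c in [plan_osc_le], both terms become e/2. *)
move=> c0 e e0; exists (e ^+ 2 / (4 * c ^+ 2)); split; first by rewrite divr_gt0 ?exprn_gt0 // mulr_gt0 // exprn_gt0.
move=> P Pb f g mf mg fg.
have mfg : measurable_fun setT (fun z => f z - g z) by exact: measurable_funB.
apply: (@le_trans _ _ (plan_osc P g + plan_osc P (fun z => f z - g z)%R)%E).
  rewrite /plan_osc -ge0_integralD //; [|exact: measurable_osc|exact: (measurable_osc mfg)].
  apply: ge0_le_integral => //.
  - exact: measurable_osc.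
  - by apply: emeasurable_funD; [exact: measurable_osc|exact: (measurable_osc mfg)].
  - move=> h _; rewrite -EFinD lee_fin.
    set a := f _; set b := f _; set a' := g _; set b' := g _.
    rewrite (_ : a - b = (a' - b') + (a - a' - (b - b'))); last by ring.
    exact: ler_normD.
apply: leeD; first exact: lexx.
have l0 : 0 < e / c by rewrite divr_gt0.
apply: (le_trans (plan_osc_le Pb l0 mfg)).
have k0 : 0 <= 2 / (e / c) * c by rewrite mulr_ge0 ?divr_ge0 // ltW.
apply: (@le_trans _ _ ((e / c / 2 * c)%:E + (2 / (e / c) * c)%:E * (e ^+ 2 / (4 * c ^+ 2))%:E)%E).
  by apply: leeD; [exact: lexx|apply: lee_wpmul2l; [rewrite lee_fin|exact: ltW]].
rewrite -EFinM -EFinD lee_fin le_eqVlt; apply/orP; left; apply/eqP.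
by field; rewrite !gt_eqF.
Qed.

Lemma measurable_cost_section (u : borel Z -> R) (h : C) : measurable_fun setT u ->
  measurable_fun setT (fun s : T => (u ((h : Cpath Z) s))%:E * speed (h : Cpath Z) s)%E.
Proof. by move=> mu'; exact: (measurable_fun_pair2 h (measurable_cost mu')). Qed.

Lemma cost_ge0 (u : borel Z -> R) (h : C) s : (forall z, 0 <= u z) ->
  (0 <= (u ((h : Cpath Z) s))%:E * speed (h : Cpath Z) s)%E.
Proof. by move=> u0; rewrite mule_ge0 ?lee_fin // speed_ge0. Qed.

Lemma int_cost_ge0 (u : borel Z -> R) (h : C) (D : set T) : (forall z, 0 <= u z) ->
  (0 <= \int[leb01]_(s in D) ((u ((h : Cpath Z) s))%:E * speed (h : Cpath Z) s))%E.
Proof. by move=> u0; apply: integral_ge0 => s _; exact: cost_ge0. Qed.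

Lemma plan_cost_ge0 P u : (forall z, 0 <= u z) -> (0 <= plan_cost P u)%E.
Proof. by move=> u0; apply: integral_ge0 => g _; exact: int_cost_ge0. Qed.

Lemma plan_cost_mono P (u v : borel Z -> R) : measurable_fun setT u -> measurable_fun setT v ->
  (forall z, 0 <= u z) -> (forall z, u z <= v z) -> (plan_cost P u <= plan_cost P v)%E.
Proof.
move=> mu' mv u0 uv; have v0 z : 0 <= v z := le_trans (u0 z) (uv z).
apply: ge0_le_integral => //.
- by move=> h _; exact: int_cost_ge0.
- exact: measurable_int_cost.
- exact: measurable_int_cost.
- move=> h _; apply: ge0_le_integral => //.
  + by move=> s _; exact: cost_ge0.
  + exact: measurable_cost_section.
  + exact: measurable_cost_section.
  + by move=> s _; apply: lee_wpmul2r; [exact: speed_ge0|rewrite lee_fin].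
Qed.

Lemma plan_costD P (u v : borel Z -> R) : measurable_fun setT u -> measurable_fun setT v ->
  (forall z, 0 <= u z) -> (forall z, 0 <= v z) ->
  plan_cost P (fun z => u z + v z) = (plan_cost P u + plan_cost P v)%E.
Proof.
move=> mu' mv u0 v0.
rewrite /plan_cost -ge0_integralD //; last 4 first.
- by move=> h _; exact: int_cost_ge0.
- exact: measurable_int_cost.
- by move=> h _; exact: int_cost_ge0.
- exact: measurable_int_cost.
apply: eq_integral => h _; rewrite -ge0_integralD //; last 4 first.
- by move=> s _; exact: cost_ge0.
- exact: measurable_cost_section.
- by move=> s _; exact: cost_ge0.
- exact: measurable_cost_section.
by apply: eq_integral => s _; rewrite EFinD ge0_muleDl ?lee_fin.
Qed.

Lemma plan_costZ P (k : R) (u : borel Z -> R) : 0 <= k -> measurable_fun setT u -> (forall z, 0 <= u z) ->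
  plan_cost P (fun z => k * u z) = (k%:E * plan_cost P u)%E.
Proof.
move=> k0 mu' u0; rewrite /plan_cost -ge0_integralZl_EFin //; last 2 first.
- by move=> h _; exact: int_cost_ge0.
- exact: measurable_int_cost.
apply: eq_integral => h _; rewrite -ge0_integralZl_EFin //; last 2 first.
- by move=> s _; exact: cost_ge0.
- exact: measurable_cost_section.
by apply: eq_integral => s _; rewrite EFinM muleA.
Qed.

Lemma plan_cost_cont mu c E : 0 < c -> 0 < E -> forall e : R, 0 < e -> exists dl : R, 0 < dl /\
  forall P, plan_bound mu c E P -> forall f g, nnL2 mu f -> nnL2 mu g ->
    (sqint mu (fun z => f z - g z)%R < dl%:E)%E -> (plan_cost P f <= plan_cost P g + e%:E)%E.
Proof.
(* With l = E / e in [plan_cost_le], both terms become e/2. *)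
move=> c0 E0 e e0; exists (e ^+ 2 / (c * E)); split.
  by rewrite divr_gt0 ?exprn_gt0 // mulr_gt0.
move=> P Pb f g [mf f0 _] [mg g0 _] fg.
have mfg : measurable_fun setT (fun z => `|f z - g z|).
  by apply: measurableT_comp => //; exact: measurable_funB.
have fg0 z : 0 <= `|f z - g z| by [].
apply: (@le_trans _ _ (plan_cost P g + plan_cost P (fun z => `|f z - g z|)%R)%E).
  rewrite -(plan_costD P mg mfg g0 fg0).
  apply: (plan_cost_mono P mf (measurable_funD mg mfg) f0).
  by move=> z; rewrite -lerBlDl; exact: ler_norm.
apply: leeD; first exact: lexx.
have l0 : 0 < E / e by rewrite divr_gt0.
apply: (le_trans (plan_cost_le Pb l0 mfg fg0)).
have k0 : 0 <= E / e / 2 * c by rewrite mulr_ge0 ?divr_ge0 // ltW.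
have -> : sqint mu (fun z => `|f z - g z|) = sqint mu (fun z => f z - g z).
  by apply: eq_integral => z _; rewrite real_normK // num_real.
apply: (@le_trans _ _ ((E / e / 2 * c)%:E * (e ^+ 2 / (c * E))%:E + ((2 * (E / e))^-1 * E)%:E)%E).
  by apply: leeD; [apply: lee_wpmul2l; [rewrite lee_fin|exact: ltW]|exact: lexx].
rewrite -EFinM -EFinD lee_fin le_eqVlt; apply/orP; left; apply/eqP.
by field; rewrite !gt_eqF.
Qed.

Lemma plan_cost_avg mu P f g (c : \bar R) : nnL2 mu f -> nnL2 mu g ->
  (c <= plan_cost P f)%E -> (c <= plan_cost P g)%E -> (c <= plan_cost P (fun z => (f z + g z) / 2)%R)%E.
Proof.
move=> [mf f0 _] [mg g0 _] cf cg.
have h20 : 0 <= 2^-1 :> R by rewrite invr_ge0.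
have aux (x y : \bar R) : (c <= x -> c <= y -> c <= (2^-1)%:E * x + (2^-1)%:E * y)%E.
  move=> cx cy; have -> : c = ((2^-1)%:E * c + (2^-1)%:E * c)%E.
    have h2 : (2^-1 + 2^-1 = 1 :> R) by field.
    by case: (c) => [z| |]; rewrite ?gt0_muley ?gt0_muleNy ?lte_fin ?invr_gt0 // -!EFinM -EFinD -mulrDl h2 mul1r.
  by apply: leeD; apply: lee_wpmul2l.
have -> : plan_cost P (fun z => (f z + g z) / 2) = ((2^-1)%:E * plan_cost P f + (2^-1)%:E * plan_cost P g)%E.
  have mZ (u : borel Z -> R) : measurable_fun setT u -> measurable_fun setT (fun z => 2^-1 * u z).
    by move=> mu'; exact: measurable_funM (measurable_cst _) mu'.
  have u0 (u : borel Z -> R) : (forall z, 0 <= u z) -> forall z, 0 <= 2^-1 * u z.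
    by move=> h z; rewrite mulr_ge0.
  have e3 := plan_costD P (mZ f mf) (mZ g mg) (u0 f f0) (u0 g g0).
  apply: (etrans _ (etrans e3 (congr2 _ (plan_costZ P h20 mf f0) (plan_costZ P h20 mg g0)))).
  by congr (plan_cost P _); apply/funext => z; rewrite -mulrDr mulrC.
exact: (aux _ _ cf cg).
Qed.

(** Test plans without normalisation: restrictions to sets of curves and lifts over sets of
    parameters remain in this class. *)
Definition finite_plan (mu : set (borel Z) -> \bar R) P : Prop :=
  [/\ exists c : R, 0 < c /\
        forall (t : unit_itv R) (A : set (borel Z)), measurable A ->
          (pushforward P (fun g : C => (g : Cpath Z) t : borel Z) A <= c%:E * mu A)%E,
      {ae P, forall g : Cpath Z, abs_cont 2 g} &
      (\int[leb01]_t \int[P]_g (speed (g : Cpath Z) t ^+ 2) < +oo)%E].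

Lemma finite_plan_bound mu P : finite_plan mu P ->
  exists n : nat, plan_bound mu n.+1%:R n.+1%:R P.
Proof.
move=> [[c [c0 Pc]] _ PE].
have Pf : P setT \is a fin_num by exact: fin_num_measure.
have E0 : (0 <= \int[leb01]_t \int[P]_g (speed (g : Cpath Z) t ^+ 2))%E.
  by apply: integral_ge0 => t _; apply: integral_ge0 => g _; rewrite sqre_ge0.
have Ef : (\int[leb01]_t \int[P]_g (speed (g : Cpath Z) t ^+ 2))%E \is a fin_num.
  by rewrite ge0_fin_numE.
pose K : R := c + fine (P setT) + fine (\int[leb01]_t \int[P]_g (speed (g : Cpath Z) t ^+ 2))%E.
have p0 : 0 <= fine (P setT) by exact: fine_ge0.
have q0 := fine_ge0 E0.
have K0 : 0 <= K by rewrite /K !addr_ge0 // ltW.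
exists (Num.truncn K).
have KN : K <= (Num.truncn K).+1%:R by rewrite ltW // truncnS_gt.
set N := (_.+1%:R) in KN *; split => //.
- by rewrite -(fineK Pf) lee_fin (le_trans _ KN) // /K -addrA addrCA lerDl addr_ge0 // ltW.
- move=> t A mA; apply: (le_trans (Pc t A mA)); apply: lee_wpmul2r => //.
  by rewrite lee_fin (le_trans _ KN) // /K -addrA lerDl addr_ge0.
- by rewrite -(fineK Ef) lee_fin (le_trans _ KN) // /K lerDr addr_ge0 // ltW.
Qed.

(** The inequality is homogeneous in the plan, so it can be read off the normalised plan; for a plan
    of mass 0 the left side vanishes. *)
Lemma finite_plan_wug mu P (f G : borel Z -> R) : weak_upper_gradient mu f G ->
  measurable_fun setT f -> finite_plan mu P -> (plan_osc P f <= plan_cost P G)%E.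
Proof.
move=> [G0 [mG _] HG] mf [[c [c0 Pc]] Pac PE].
have Pf : P setT \is a fin_num by exact: fin_num_measure.
have [P0|P0] := eqVneq (P setT) 0%E.
  rewrite /plan_osc (_ : \int[P]_g _ = 0)%E.
    apply: integral_ge0 => g _; apply: integral_ge0 => s _.
    by rewrite mule_ge0 ?lee_fin // speed_ge0.
  apply: null_set_integral => //; exact: measurable_osc.
(* The Dirac mass is the default of [mnormalize] for mass 0 or infinite mass, both excluded here. *)
pose Q : probability C R := mnormalize P (dirac (point : C)).
pose k : R := fine (P setT).
have k0 : 0 < k by rewrite /k fine_gt0 // lt_def P0 measure_ge0 /= ltey_eq Pf.
have QE (A : set C) : Q A = (P A * (k^-1)%:E)%E.
  rewrite /Q /= /mnormalize (negbTE P0) /=; case: ifPn => // /eqP h; move: Pf; by rewrite h.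
have iQ (h : C -> \bar R) : measurable_fun setT h -> (forall g, (0 <= h g)%E) ->
    (\int[Q]_g h g = (k^-1)%:E * \int[P]_g h g)%E.
  move=> mh h0; have kk : 0 <= k^-1 by rewrite invr_ge0 ltW.
  have -> : (\int[Q]_g h g = \int[mscale (NngNum kk) P]_g h g)%E.
    apply: eq_measure_integral => A mA _.
    have E1 : mscale (NngNum kk) P A = Q A by rewrite QE muleC.
    first [exact: E1|exact: esym E1].
  by rewrite ge0_integral_mscale.
have Qtp : test_plan mu Q.
  split.
  - exists (c / k); split; first by rewrite divr_gt0.
    move=> t A mA; rewrite /pushforward QE.
    rewrite (_ : (c / k)%:E * mu A = (c%:E * mu A) * (k^-1)%:E)%E; last first.
      by rewrite EFinM -muleA [((k^-1)%:E * _)%E]muleC muleA.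
    apply: lee_wpmul2r; first by rewrite lee_fin invr_ge0 ltW.
    exact: Pc.
  - have [N [mN N0 NS]] := Pac; exists N; split => //.
    by rewrite QE N0 mul0e.
  - rewrite (_ : (\int[leb01]_t _) = (k^-1)%:E * \int[leb01]_t \int[P]_g (speed (g : Cpath Z) t ^+ 2))%E.
      by rewrite lte_mul_pinfty // lee_fin invr_ge0 ltW.
    rewrite -ge0_integralZl_EFin //; last 3 first.
    + by move=> t _; apply: integral_ge0 => g _; rewrite sqre_ge0.
    + apply: (@measurable_fun_fubini_tonelli_G _ _ C T R P (fun p => speed (p.1 : Cpath Z) p.2 ^+ 2)%E) => //.
        exact: speed_sqr_measurable.
      by move=> p; rewrite sqre_ge0.
    + by rewrite invr_ge0 ltW.
    apply: eq_integral => t _; apply: iQ; last by move=> g; rewrite sqre_ge0.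
    exact: (measurable_fun_pair1 t (@speed_sqr_measurable R Z)).
have := HG Q Qtp; rewrite iQ //; last exact: measurable_osc.
rewrite iQ //.
- by rewrite lee_pmul2l ?lte_fin ?invr_gt0.
- exact: measurable_int_cost.
- by move=> g; apply: integral_ge0 => s _; rewrite mule_ge0 ?lee_fin // speed_ge0.
Qed.

End plan_functionals.

Section countably_many_plans.
Context (R : realType) (Z : pmetricType R) (mu : {measure set (borel Z) -> \bar R}).
Variable W : nat -> set (borel Z).
Hypothesis mW : forall j, measurable (W j).
Hypothesis Wfin : forall j, (mu (W j) < +oo)%E.
Hypothesis Wapprox : forall A, measurable A -> (mu A < +oo)%E -> forall e : R, 0 < e ->
      exists j, (mu (symdiff A (W j)) < e%:E)%E.
Implicit Types (f G : borel Z -> R) (P : {finite_measure set (borel (Cpath Z)) -> \bar R}).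

Lemma signed_simple_dense f : measurable_fun setT f -> (sqint mu f < +oo)%E ->
  forall e : R, 0 < e -> exists s : seq (rat * nat) * seq (rat * nat),
    (sqint mu (fun z => f z - (simple_of R W s.1 z - simple_of R W s.2 z))%R < e%:E)%E.
Proof.
move=> mf f2 e e0.
pose fp := fun z => Num.max (f z) 0; pose fn := fun z => Num.max (- f z) 0.
have mfp : measurable_fun setT fp by apply: measurable_maxr.
have mfn : measurable_fun setT fn by apply: measurable_maxr => //; exact: measurableT_comp.
have fp0 z : 0 <= fp z by rewrite /fp le_max lexx orbT.
have fn0 z : 0 <= fn z by rewrite /fn le_max lexx orbT.
have fE z : f z = fp z - fn z.
  by rewrite /fp /fn !maxEle; case: leP => h1; case: leP => h2; lra.
have fpf : (sqint mu fp < +oo)%E.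
  apply: le_lt_trans f2; apply: sqint_le => // z; by rewrite (ger0_norm (fp0 z)) /fp ge_max ler_norm normr_ge0.
have fnf : (sqint mu fn < +oo)%E.
  apply: le_lt_trans f2; apply: sqint_le => // z; rewrite (ger0_norm (fn0 z)) /fn ge_max normr_ge0 andbT.
  by rewrite -normrN ler_norm.
have e4 : 0 < e / 4 by rewrite divr_gt0.
have [s1 h1] := simple_dense mW Wapprox mfp fp0 fpf e4.
have [s2 h2] := simple_dense mW Wapprox mfn fn0 fnf e4.
have ms s : measurable_fun setT (simple_of R W s) by exact: measurable_simple_of.
exists (s1, s2) => /=.
have h := @sqintD _ _ _ mu (fun z => fp z - simple_of R W s1 z) (fun z => fn z - simple_of R W s2 z)
  (fun z => f z - (simple_of R W s1 z - simple_of R W s2 z)).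
apply: le_lt_trans (h _ _ _ _) _.
- exact: measurable_funB.
- exact: measurable_funB.
- by apply: measurable_funB => //; exact: measurable_funB.
- move=> z; rewrite fE; set a := simple_of _ _ _ _; set b := simple_of _ _ _ _.
  rewrite (_ : fp z - fn z - (a - b) = (fp z - a) + - (fn z - b)); last by ring.
  by apply: le_trans (sqrD_le2 _ _) _; rewrite sqrrN.
rewrite (_ : e = 2 * (e / 4) + 2 * (e / 4)); last by field.
have -> : (2 * (e / 4) + 2 * (e / 4))%:E = (2%:E * (e / 4)%:E + 2%:E * (e / 4)%:E)%E by [].
by apply: lteD; apply: lt_le_trans (_ : _ < 2%:E * (e / 4)%:E)%E _ => //; rewrite lte_pmul2l.
Qed.

Lemma finite_plan_mzero : finite_plan mu (mzero : {finite_measure set (borel (Cpath Z)) -> \bar R}).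
Proof.
split.
- exists 1; split => // t A mA; rewrite /pushforward /= /mzero mule_ge0 ?lee_fin //.
- by exists setT; split.
- rewrite (_ : (\int[leb01]_t _) = 0)%E // integral0_eq // => t _.
  by rewrite integral_measure_zero.
Qed.

(* One plan is chosen for each bound on plans, each pair of simple functions near
   [f] and [G], and each pair of rationals between which the inequality may fail;
   a plan violating the inequality forces a chosen one to violate it. *)
Let code := (nat * (seq (rat * nat) * seq (rat * nat)) * seq (rat * nat) * rat * rat)%type.

Let selected (x : code) P := let: (n, s, s', q, r) := x in
  [/\ finite_plan mu P, plan_bound mu n.+1%:R n.+1%:R P,
      ((ratr q)%:E < plan_osc P (fun z => simple_of R W s.1 z - simple_of R W s.2 z)%R)%E &
      (plan_cost P (simple_of R W s') < (ratr r)%:E)%E].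

Let gap_contradiction (a b q r : R) : b < a -> a - 3 * ((a - b) / 8) < q ->
  r < b + 2 * ((a - b) / 8) -> ~ (q < r + (a - b) / 8 + (a - b) / 8).
Proof. by move=> *; lra. Qed.

Lemma countable_plans :
  exists M : nat -> {finite_measure set (borel (Cpath Z)) -> \bar R},
    (forall k, finite_plan mu (M k)) /\
    forall f G, measurable_fun setT f -> (sqint mu f < +oo)%E -> nnL2 mu G ->
      (forall k, (plan_osc (M k) f <= plan_cost (M k) G)%E) ->
      forall P, finite_plan mu P -> (plan_osc P f <= plan_cost P G)%E.
Proof.
have /choice[M HM] : forall k : nat, exists P, finite_plan mu P /\
    forall x : code, unpickle k = Some x -> (exists P', selected x P') -> selected x P.
  move=> k; have [[x [xk [P xP]]]|no] := pselect (exists x : code, unpickle k = Some x /\ exists P', selected x P').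
    exists P; split; first by move: xP; case: x {xk} => [[[[n s] s'] q] r] [].
    by move=> y yk _; move: yk; rewrite xk => -[<-].
  (* Numbers that code nothing, and codes that no plan realises, receive the zero plan. *)
  exists mzero; split; first exact: finite_plan_mzero.
  by move=> x xk xP; case: no; exists x.
exists M; split; first by move=> k; have [] := HM k.
move=> f G mf f2 GG osc_le P FP; rewrite leNgt; apply/negP => lt.
have [n Pb] := finite_plan_bound FP.
have n0 : 0 < n.+1%:R :> R by [].
have [mG G0 G2] := GG.
have cost_fin : plan_cost P G \is a fin_num.
  rewrite ge0_fin_numE ?plan_cost_ge0 //.
  apply: le_lt_trans (plan_cost_le Pb ltr01 mG G0) _.
  by rewrite -(fineK (_ : sqint mu G \is a fin_num)) ?ge0_fin_numE ?sqint_ge0 // -EFinM -EFinD ltry.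
have osc_fin : plan_osc P f \is a fin_num.
  rewrite ge0_fin_numE; last by apply: integral_ge0 => g _.
  apply: le_lt_trans (plan_osc_le Pb ltr01 mf) _.
  by rewrite -(fineK (_ : sqint mu f \is a fin_num)) ?ge0_fin_numE ?sqint_ge0 // -EFinM -EFinD ltry.
pose a := fine (plan_osc P f); pose b := fine (plan_cost P G).
have ab : b < a by rewrite -lte_fin !fineK.
(* q is above a - 3e, r is below b + 2e, and passing from the simple functions back to f and G costs
   e twice. The chosen plan would give q < r + 2e, hence a - b < 7e, against a - b = 8e. *)
pose e := (a - b) / 8.
have e0 : 0 < e by rewrite divr_gt0 // subr_gt0.
have [d1 [d10 H1]] := @plan_osc_cont R Z mu n.+1%:R n.+1%:R n0 e e0.
have [d2 [d20 H2]] := @plan_cost_cont R Z mu n.+1%:R n.+1%:R n0 n0 e e0.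
have [s hs] := signed_simple_dense mf f2 d10.
have [s' hs'] := simple_dense mW Wapprox mG G0 G2 d20.
set d := fun z => (simple_of R W s.1 z - simple_of R W s.2 z)%R in hs.
set h := simple_of R W s' in hs'.
have md : measurable_fun setT d by apply: measurable_funB; exact: measurable_simple_of.
have hh : nnL2 mu h.
  split; [exact: measurable_simple_of|exact: simple_of_ge0|].
  exact: sqint_simple_of_lty.
have symm (u v : borel Z -> R) (dl : R) : (sqint mu (fun z => u z - v z)%R < dl%:E)%E -> (sqint mu (fun z => v z - u z)%R < dl%:E)%E.
  rewrite (_ : sqint mu (fun z => v z - u z) = sqint mu (fun z => u z - v z)) //.
  by apply: eq_integral => z _; rewrite -sqrrN opprB.
have [q /andP[q1 q2]] : exists q : rat, a - 3 * e < ratr q < a - 2 * e.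
  have lt3 : a - 3 * e < a - 2 * e by lra.
  by have [q] := rat_in_itvoo lt3; rewrite in_itv; exists q.
have [r /andP[r1 r2]] : exists q : rat, b + e < ratr q < b + 2 * e.
  have lt3 : b + e < b + 2 * e by lra.
  by have [q'] := rat_in_itvoo lt3; rewrite in_itv; exists q'.
have sel : selected (n, s, s', q, r) P.
  split => //.
  - have := H1 P Pb f d mf md hs; rewrite -(fineK osc_fin) -/a -leeBlDr // => h1.
    by apply: lt_le_trans h1; rewrite -EFinB lte_fin (lt_trans q2) //; lra.
  - apply: le_lt_trans (H2 P Pb h G hh GG (symm _ _ _ hs')) _.
    by rewrite -(fineK cost_fin) -/b -EFinD lte_fin.
have [_ Hk] := HM (pickle (n, s, s', q, r)).
have [Fk Pk qk rk] := Hk _ (pickleK _) (ex_intro _ P sel).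
set k := pickle _ in Hk Fk Pk qk rk.
have u1 : ((ratr q)%:E < plan_osc (M k) f + e%:E)%E.
  by apply: lt_le_trans qk _; apply: (H1 (M k) Pk d f md mf); exact: symm.
have u2 : (plan_cost (M k) G < (ratr r)%:E + e%:E)%E.
  apply: le_lt_trans (H2 (M k) Pk G h GG hh hs') _; exact: lte_leD.
have : ((ratr q)%:E < (ratr r)%:E + e%:E + e%:E)%E.
  by apply: lt_le_trans u1 _; apply: leeD => //; exact: le_trans (osc_le k) (ltW u2).
by rewrite -!EFinD lte_fin; exact: (gap_contradiction ab q1 r2).
Qed.

End countably_many_plans.

(** * From integral inequalities to almost everywhere inequalities *)

Section finite_measures.
Context d (T : measurableType d) (R : realType).

Lemma finite_measure_of (M : {measure set T -> \bar R}) : (M setT < +oo)%E ->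
  exists N : {finite_measure set T -> \bar R}, (N : set T -> \bar R) = M.
Proof.
move=> Mfin; exists (mfrestr measurableT Mfin).
by apply/funext => A; change (M (A `&` setT) = M A); rewrite setIT.
Qed.

(** On the set where u exceeds v by 1/(n+1), the integral of v can be cancelled because it is
    finite, and the set is null. This localises inequalities known for every restriction of a
    measure. *)
Lemma ae_le_of_integral_le (P : {measure set T -> \bar R}) (u v : T -> \bar R) :
  measurable_fun setT u -> measurable_fun setT v -> (forall x, (0 <= u x)%E) -> (forall x, (0 <= v x)%E) ->
  (\int[P]_x v x < +oo)%E ->
  (forall A, measurable A -> (\int[P]_(x in A) u x <= \int[P]_(x in A) v x)%E) ->
  {ae P, forall x, (u x <= v x)%E}.
Proof.
move=> mu mv u0 v0 vfin uv.
pose A n := [set x | (v x + (n.+1%:R^-1)%:E <= u x)%E].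
have mA n : measurable (A n) by apply: measurable_leeT => //; exact: emeasurable_funD.
have A0 n : P (A n) = 0%E.
  have n0 : 0 < n.+1%:R^-1 :> R by rewrite invr_gt0.
  have vA : (\int[P]_(x in A n) v x < +oo)%E.
    by apply: le_lt_trans vfin; apply: ge0_subset_integral => //.
  have vAf : (\int[P]_(x in A n) v x \is a fin_num)%E by rewrite ge0_fin_numE // integral_ge0.
  have h : (\int[P]_(x in A n) v x + (n.+1%:R^-1)%:E * P (A n) <= \int[P]_(x in A n) v x)%E.
    apply: le_trans (uv _ (mA n)).
    rewrite -integral_cst // -ge0_integralD //; last 2 first.
    - exact: measurable_funTS.
    - by move=> x _; rewrite lee_fin ltW.
    apply: ge0_le_integral => //.
    - by move=> x _; rewrite adde_ge0 // lee_fin ltW.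
    - by apply: emeasurable_funD => //; exact: measurable_funTS.
    - exact: measurable_funTS.
  have : ((n.+1%:R^-1)%:E * P (A n) <= 0)%E by rewrite -(@leeD2lE _ _ _ _ vAf) adde0.
  rewrite pmule_rle0 ?lte_fin // => h'.
  by apply/eqP; rewrite eq_le h' measure_ge0.
have : {ae P, forall x, forall n, ~ A n x}.
  by apply/ae_foralln => n; exists (A n); split; [exact: mA|exact: (A0 n)|move=> x /= /contrapT].
apply: filterS => x nA; rewrite leNgt; apply/negP => vu.
suff [n] : exists n, A n x by exact: nA.
move: (u0 x) (v0 x) vu; rewrite /A /=.
move=> ux0 vx0 vu.
have vf : v x \is a fin_num by rewrite ge0_fin_numE // (lt_le_trans vu) // leey.
case E : (u x) (vu) => [y| |] // vu'.
- have h : 0 < y - fine (v x) by rewrite subr_gt0 -lte_fin fineK.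
  have [n hn] := archi_lt h; exists n => //=.
  by rewrite -(fineK vf) -EFinD lee_fin addrC -lerBrDr ltW.
- by exists 0%N => //=; rewrite leey.
- by move: ux0; rewrite E.
Qed.

End finite_measures.

(** * The minimum of two weak upper gradients *)

Section dyadic.
Context (R : realType).
Let T := borel (unit_itv R).

Definition grid (n j : nat) : unit_itv R := clip (j%:R / 2 ^+ n).
(** Open cells, so that none contains a grid point; the grid points left out are null. *)
Definition gcell (n j : nat) : set T :=
  [set r | j%:R / 2 ^+ n < set_val r < j.+1%:R / 2 ^+ n].
(** The radius equals the mesh of the grid to which the centre belongs, so the ends of a ball are
    grid points at every finer level. A number that codes no pair gives the pair (0, 0), again a
    ball. *)
Definition dball (p : nat) : set T :=
  let x : nat * nat := if (unpickle p : option (nat * nat)) is Some x then x else (0, 0)%N in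
  [set r | `|set_val r - x.2%:R / 2 ^+ x.1| < 1 / 2 ^+ x.1].

Let pow2 n : 0 < 2 ^+ n :> R. Proof. exact: exprn_gt0. Qed.

Lemma gridE n j : (j <= 2 ^ n)%N -> set_val (grid n j) = j%:R / 2 ^+ n :> R.
Proof.
move=> jn; rewrite clipE // divr_ge0 ?(ltW (pow2 n)) //= ler_pdivrMr // mul1r.
by rewrite -natrX ler_nat.
Qed.

Lemma measurable_gcell n j : measurable (gcell n j).
Proof.
rewrite (_ : gcell n j = (set_val : unit_itv R -> R) @^-1` `]j%:R / 2 ^+ n, j.+1%:R / 2 ^+ n[%classic).
  have := @continuous_borel_real R (unit_itv R) set_val (@set_val_continuous R _) measurableT _ (measurable_itv `]j%:R / 2 ^+ n, j.+1%:R / 2 ^+ n[).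
  by rewrite setTI.
by apply/seteqP; split => r; rewrite /gcell /= in_itv.
Qed.

Lemma dball_base : countable_base (dball : nat -> set (unit_itv R)).
Proof.
split.
  move=> p; rewrite /dball /=; case: (if _ is Some _ then _ else _) => m k /=.
  have -> : [set r : unit_itv R | `|set_val r - k%:R / 2 ^+ m| < 1 / 2 ^+ m] =
      (set_val : unit_itv R -> R) @^-1` (ball (k%:R / 2 ^+ m : R) (1 / 2 ^+ m)).
    by apply/seteqP; split => r /=; rewrite -ball_normE /= distrC.
  apply: open_comp; last exact: ball_open.
  by move=> x _; exact: set_val_continuous.
move=> U r oU Ur.
have /nbhs_ballP[e /= e0 eU] : nbhs r U by exact: open_nbhs_nbhs.
have e2 : 0 < e / 2 by rewrite divr_gt0.
have [m hm] := archi_lt e2.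
have hm2 : 1 / 2 ^+ m < e / 2.
  rewrite mul1r; case: m hm => [|m] hm; first by rewrite expr0; move: hm.
  apply: le_lt_trans hm; rewrite lef_pV2 ?posrE // -natrX ler_nat; exact: ltn_expl.
pose k := Num.truncn (set_val r * 2 ^+ m : R).
have r0 : 0 <= set_val r * 2 ^+ m :> R by rewrite mulr_ge0 // ?unit_ge0 // ltW.
have /andP[k1 k2] := truncn_itv r0.
have d1 : `|set_val r - k%:R / 2 ^+ m| < 1 / 2 ^+ m.
  have e1 : set_val r - k%:R / 2 ^+ m = (set_val r * 2 ^+ m - k%:R) / 2 ^+ m :> R.
    by field; rewrite gt_eqF.
  rewrite e1 ger0_norm; last by rewrite divr_ge0 // ?subr_ge0 // ltW.
  by rewrite ltr_pM2r ?invr_gt0 // ltrBlDr addrC natr1.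
exists (pickle (m, k)); rewrite /dball pickleK /=; split => // s /= d2.
apply: eU; rewrite /ball /=.
change (`|set_val r - set_val s : R| < e).
rewrite (_ : set_val r - set_val s = (set_val r - k%:R / 2 ^+ m) - (set_val s - k%:R / 2 ^+ m) :> R); last by ring.
apply: le_lt_trans (ler_normB _ _) _.
have := ltrD (lt_trans d1 hm2) (lt_trans d2 hm2).
by rewrite -splitr.
Qed.

(** At a level n >= m the ends of the ball are of the form (K - L) / 2^n and (K + L) / 2^n, and an
    open cell of level n meets no such point. *)
Lemma gcell_dball p : exists N, forall n, (N <= n)%N -> forall j,
  gcell n j `<=` dball p \/ gcell n j `<=` ~` dball p.
Proof.
rewrite /dball /=; case: (if _ is Some _ then _ else _) => m k /=; exists m => n mn j.
pose L := (2 ^ (n - m))%N; pose K := (k * L)%N.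
have nm : 2 ^+ n = 2 ^+ m * L%:R :> R by rewrite /L natrX -exprD subnKC.
have L0 : 0 < L%:R :> R by rewrite ltr0n expn_gt0.
have E1 : k%:R / 2 ^+ m = K%:R / 2 ^+ n :> R by rewrite nm /K natrM; field; rewrite !gt_eqF.
have E2 : 1 / 2 ^+ m = L%:R / 2 ^+ n :> R by rewrite nm; field; rewrite !gt_eqF.
rewrite E1 E2.
have memE (r : unit_itv R) : (`|set_val r - K%:R / 2 ^+ n| < L%:R / 2 ^+ n) =
    ((K%:R - L%:R) / 2 ^+ n < set_val r < (K%:R + L%:R) / 2 ^+ n).
  by rewrite ltr_norml mulrBl mulrDl; apply/idP/idP => /andP[? ?]; apply/andP; split; lra.
case: (boolP ((K <= j + L)%N && (j < K + L)%N)) => [/andP[h1 h2]|].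
  left => r /= /andP[r1 r2]; rewrite memE; apply/andP; split.
  - apply: le_lt_trans r1; rewrite ler_pM2r ?invr_gt0 // lerBlDr -natrD ler_nat //.
  - by apply: lt_le_trans r2 _; rewrite ler_pM2r ?invr_gt0 // -natrD ler_nat.
rewrite negb_and -ltnNge -leqNgt => h; right => r /= /andP[r1 r2]; rewrite memE => /andP[r3 r4].
case/orP: h => h.
- have := lt_trans r3 r2; rewrite ltr_pM2r ?invr_gt0 // ltrBlDr -natrD ltr_nat addSn ltnS.
  by rewrite leqNgt h.
- have := lt_trans r1 r4; rewrite ltr_pM2r ?invr_gt0 // -natrD ltr_nat ltnNge h //.
Qed.

Lemma gcell_tset t : exists N, forall n, (N <= n)%N -> forall j,
  gcell n j `<=` tset dball t \/ gcell n j `<=` ~` tset dball t.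
Proof.
have no : exists N, forall n, (N <= n)%N -> forall j,
    gcell n j `<=` (set0 : set T) \/ gcell n j `<=` ~` (set0 : set T).
  by exists 0%N => n _ j; right; rewrite setC0.
move: t; fix IH 1 => -[m|m [|x [|y [|z l]]]] //=.
- exact: gcell_dball.
- have [N HN] := IH x; exists N => n Nn j; rewrite setCK.
  by case: (HN n Nn j); [right|left].
- have [N HN] := IH x; have [N' HN'] := IH y; exists (maxn N N') => n; rewrite geq_max => /andP[h1 h2] j.
  case: (HN n h1 j) => [a|a]; first by left => r /a; left.
  case: (HN' n h2 j) => [b|b]; first by left => r /b; right.
  by right => r cr [/(a r cr)|/(b r cr)].
Qed.

Lemma leb01_point (s : unit_itv R) : leb01 ([set s] : set T) = 0%E :> \bar R.
Proof.
have -> : [set s] = seg s s :> set T.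
  apply/seteqP; split => r /=; rewrite /seg /= /unit_le; first by move=> ->; rewrite lexx.
  by move=> h; apply/itv_val_inj/eqP; rewrite eq_le andbC.
by rewrite leb01_seg /unit_le ?lexx // subrr.
Qed.

Lemma integral_setU_le (A B : set T) (h : T -> \bar R) : measurable A -> measurable B ->
  measurable_fun setT h -> (forall r, (0 <= h r)%E) ->
  (\int[leb01]_(r in A `|` B) h r <= \int[leb01]_(r in A) h r + \int[leb01]_(r in B) h r)%E.
Proof.
move=> mA mB mh h0; have mBA : measurable (B `\` A) by exact: measurableD.
have -> : A `|` B = A `|` (B `\` A).
  apply/seteqP; split => x; last by case=> [?|[]]; [left|right].
  by case=> [?|Bx]; [left|have [?|?] := pselect (A x); [left|right]].
rewrite ge0_integral_setU //; last 2 first.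
- exact: measurable_funTS.
- by apply/disj_setPS => x [Ax []].
apply: leeD => //; apply: ge0_subset_integral => //.
exact: measurable_funTS.
Qed.

Lemma integral_gcell n j (h : T -> \bar R) : (j < 2 ^ n)%N -> measurable_fun setT h ->
  (forall r, (0 <= h r)%E) ->
  (\int[leb01]_(r in seg (grid n j) (grid n j.+1)) h r <= \int[leb01]_(r in gcell n j) h r)%E.
Proof.
move=> jn mh h0.
have p0 (s : unit_itv R) : (\int[leb01]_(r in [set s]) h r = 0)%E.
  apply: null_set_integral; last exact: leb01_point.
    have -> : [set s] = seg s s :> set T.
      apply/seteqP; split => r /=; rewrite /seg /= /unit_le; first by move=> ->; rewrite lexx.
      by move=> h'; apply/itv_val_inj/eqP; rewrite eq_le andbC.
    exact: measurable_seg.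
  exact: measurable_funTS.
have m1 (s : unit_itv R) : measurable ([set s] : set T).
  have -> : [set s] = seg s s :> set T.
    apply/seteqP; split => r /=; rewrite /seg /= /unit_le; first by move=> ->; rewrite lexx.
    by move=> h'; apply/itv_val_inj/eqP; rewrite eq_le andbC.
  exact: measurable_seg.
apply: (@le_trans _ _ (\int[leb01]_(r in [set grid n j] `|` (gcell n j `|` [set grid n j.+1])) h r)%E).
  apply: ge0_subset_integral => //.
  - exact: measurable_seg.
  - by apply: measurableU => //; apply: measurableU => //; exact: measurable_gcell.
  - exact: measurable_funTS.
  - move=> r; rewrite /seg /= /unit_le /gcell /= gridE; last exact: ltnW.
    rewrite gridE // => /andP[]; rewrite le_eqVlt => /orP[/eqP rE _|r1].
      by left; apply: itv_val_inj; rewrite gridE ?rE // ltnW.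
    rewrite le_eqVlt => /orP[/eqP rE|r2]; right; last by left; rewrite r1 r2.
    by right; apply: itv_val_inj; rewrite gridE.
apply: le_trans (integral_setU_le _ _ mh h0) _ => //.
  by apply: measurableU => //; exact: measurable_gcell.
rewrite p0 add0e; apply: le_trans (integral_setU_le _ _ mh h0) _ => //; first exact: measurable_gcell.
by rewrite p0 adde0.
Qed.

(** The hypotheses concern grid segments only: they are countably many, so along almost every curve
    they hold together. On a fine grid each cell lies inside or outside a Boolean combination F of
    dyadic balls, and the bound by a or by b is used accordingly. *)
Lemma osc_le_min (a b : T -> \bar R) (phi : unit_itv R -> R) :
  measurable_fun setT a -> measurable_fun setT b -> (forall r, (0 <= a r)%E) -> (forall r, (0 <= b r)%E) ->
  (\int[leb01]_r a r < +oo)%E -> (\int[leb01]_r b r < +oo)%E ->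
  (forall n j, (`|phi (grid n j.+1) - phi (grid n j)|%:E <= \int[leb01]_(r in seg (grid n j) (grid n j.+1)) a r)%E) ->
  (forall n j, (`|phi (grid n j.+1) - phi (grid n j)|%:E <= \int[leb01]_(r in seg (grid n j) (grid n j.+1)) b r)%E) ->
  (`|phi i1 - phi i0|%:E <= \int[leb01]_r mine (a r) (b r))%E.
Proof.
move=> ma mb a0 b0 afin bfin Ha Hb.
have mE : measurable [set r | (a r <= b r)%E] by exact: measurable_leeT.
set E := [set r | _] in mE.
have ab0 r : (0 <= a r + b r)%E by rewrite adde_ge0.
have mab : measurable_fun setT (fun r => a r + b r)%E by exact: emeasurable_funD.
(* The error of replacing E by F is measured with the density a + b: the function h, equal to a on F
   and to b elsewhere, exceeds the minimum only on the symmetric difference, and by at most a +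
   b. *)
have [nu nuE] := @wpush_measure _ _ T T R leb01 id (fun r => a r + b r)%E (@measurable_id _ T setT) mab ab0.
have nuT : (nu setT < +oo)%E.
  by rewrite nuE /wpush preimage_setT ge0_integralD // lte_add_pinfty.
apply/lee_addgt0Pr => e e0.
have [t ht] := @tset_approx _ T R dball (countable_base_borel dball_base) nu setT measurableT nuT E mE e e0.
set F := tset dball t in ht.
have mF : measurable F by exact: (measurable_tset (countable_base_borel dball_base)).
have mD : measurable (symdiff E F) by exact: measurable_symdiff.
pose h r := if r \in F then a r else b r.
have mh : measurable_fun setT h.
  apply: measurable_fun_ifT => //.
  apply: (@measurable_fun_bool _ _ _ _ true); rewrite setTI (_ : _ @^-1` _ = F) //.
  by apply/seteqP; split => r /= rF; [exact: set_mem|exact: mem_set].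
have h0 r : (0 <= h r)%E by rewrite /h; case: ifP.
have hle : (\int[leb01]_r h r <= \int[leb01]_r mine (a r) (b r) + e%:E)%E.
  apply: (@le_trans _ _ (\int[leb01]_r (mine (a r) (b r) + (\1_(symdiff E F) r)%:E * (a r + b r)))%E).
    apply: ge0_le_integral => //.
    - apply: emeasurable_funD; first exact: measurable_mine.
      by apply: emeasurable_funM => //; apply/measurable_EFinP; exact: measurable_indic.
    - move=> r _; rewrite /h indicE.
      case: (boolP (r \in F)) => rF; case: (boolP (r \in symdiff E F)) => rD.
      + by rewrite mulr1n mul1e; apply: le_trans (_ : _ <= a r + b r)%E _; [rewrite leeDl|rewrite leeDr // le_min a0 b0].
      + rewrite mulr0n mul0e adde0; have : r \in E.
          apply/contraT => rE; case/negP: rD; rewrite inE; right; split; [exact: set_mem|].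
          by move/mem_set; rewrite (negbTE rE).
        by rewrite inE /E /= => rE; rewrite (min_idPl rE).
      + by rewrite mulr1n mul1e; apply: le_trans (_ : _ <= a r + b r)%E _; [rewrite leeDr|rewrite leeDr // le_min a0 b0].
      + rewrite mulr0n mul0e adde0; have : r \notin E.
          apply/negP => rE; case/negP: rD; rewrite inE; left; split; [exact: set_mem|].
          by move/mem_set; rewrite (negbTE rF).
        by rewrite notin_setE /E /= => /negP; rewrite -ltNge => /ltW rE; rewrite (min_idPr rE).
  rewrite ge0_integralD //; last 4 first.
  - by move=> r _; rewrite le_min a0 b0.
  - exact: measurable_mine.
  - by move=> r _; rewrite mule_ge0 // lee_fin.
  - by apply: emeasurable_funM => //; apply/measurable_EFinP; exact: measurable_indic.
  apply: leeD; first exact: lexx.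
  apply: le_trans (ltW ht); rewrite setIT nuE /wpush preimage_id [leRHS]integral_mkcond.
  rewrite le_eqVlt; apply/orP; left; apply/eqP; apply: eq_integral => r _.
  by rewrite /patch indicE; case: ifP => _; rewrite ?mul1e ?mul0e.
apply: le_trans hle.
have [n /(_ n (leqnn n)) Hn] := gcell_tset t.
have cellh j : (j < 2 ^ n)%N -> (`|phi (grid n j.+1) - phi (grid n j)|%:E <= \int[leb01]_(r in gcell n j) h r)%E.
  move=> jn; case: (Hn j) => sub.
  - have -> : (\int[leb01]_(r in gcell n j) h r = \int[leb01]_(r in gcell n j) a r)%E.
      by apply: eq_integral => r /set_mem /sub Fr; rewrite /h mem_set.
    by apply: le_trans (Ha n j) _; exact: integral_gcell.
  - have -> : (\int[leb01]_(r in gcell n j) h r = \int[leb01]_(r in gcell n j) b r)%E.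
      by apply: eq_integral => r /set_mem /sub Fr; rewrite /h memNset.
    by apply: le_trans (Hb n j) _; exact: integral_gcell.
pose below k : set T := \bigcup_(j < k) gcell n j.
have ind k : (k <= 2 ^ n)%N -> (`|phi (grid n k) - phi (grid n 0)|%:E <= \int[leb01]_(r in below k) h r)%E.
  elim: k => [|k IH] kn; first by rewrite subrr normr0; exact: integral_ge0.
  have -> : below k.+1 = below k `|` gcell n k.
    apply/seteqP; split => r.
    - move=> [j /= ]; rewrite ltnS leq_eqVlt => /orP[/eqP -> |jk] rj; [by right|by left; exists j].
    - by move=> [[j /= jk rj]|rk]; [exists j => //=; exact: ltnW|exists k => /=].
  rewrite ge0_integral_setU //; last 4 first.
  - by apply: bigcup_measurable => j _; exact: measurable_gcell.
  - exact: measurable_gcell.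
  - exact: measurable_funTS.
  - apply/disj_setPS => r [[j /= jk /andP[_ r1]]] /andP[r2 _].
    have := lt_trans r2 r1; rewrite ltr_pM2r ?invr_gt0 // ltr_nat ltnS => kj.
    by have := leq_trans jk kj; rewrite ltnn.
  rewrite (_ : phi (grid n k.+1) - phi (grid n 0) = (phi (grid n k.+1) - phi (grid n k)) + (phi (grid n k) - phi (grid n 0))); last by ring.
  apply: (@le_trans _ _ (`|phi (grid n k.+1) - phi (grid n k)|%:E + `|phi (grid n k) - phi (grid n 0)|%:E)%E).
    by rewrite -EFinD lee_fin ler_normD.
  by rewrite [X in (X <= _)%E]addeC; apply: leeD; [exact: (IH (ltnW kn))|exact: cellh].
have g0 : grid n 0 = i0 by apply: itv_val_inj; rewrite gridE // mul0r.
have g1 : grid n (2 ^ n) = i1 by apply: itv_val_inj; rewrite gridE // natrX divff // gt_eqF.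
have := ind _ (leqnn _); rewrite g0 g1 => /le_trans; apply.
apply: ge0_subset_integral => //.
by apply: bigcup_measurable => j _; exact: measurable_gcell.
Qed.
End dyadic.

(** * Plans obtained as images of weighted measures *)

Section plan_transport.
Context (R : realType) (Z : pmetricType R) (mu : set (borel Z) -> \bar R).
Context d (T1 : measurableType d) (m : {sigma_finite_measure set T1 -> \bar R}).
Variables (Phi : T1 -> borel (Cpath Z)) (w : T1 -> R).
Hypothesis mPhi : measurable_fun setT Phi.
Hypothesis mw : measurable_fun setT w.
Hypothesis w0 : forall x, 0 <= w x.
Hypothesis wfin : (\int[m]_x (w x)%:E < +oo)%E.
Hypothesis Phi_le : exists c : R, 0 < c /\ forall (t : unit_itv R) (A : set (borel Z)), measurable A ->
  (\int[m]_(x in [set x | A ((Phi x : Cpath Z) t)]) (w x)%:E <= c%:E * mu A)%E.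
Hypothesis Phi_good : {ae m, forall x, good_curve (Phi x : Cpath Z) \/ w x = 0}.
Hypothesis Phi_energy : (\int[leb01]_t \int[m]_x (speed (Phi x : Cpath Z) t ^+ 2 * (w x)%:E) < +oo)%E.

(** A criterion common to the two constructions of plans below: clamping the curves of a restricted
    plan, and lifting curves over a set of parameters. *)
Lemma transport_plan : exists M : {finite_measure set (borel (Cpath Z)) -> \bar R},
  finite_plan mu M /\
  forall h : borel (Cpath Z) -> \bar R, measurable_fun setT h -> (forall g, (0 <= h g)%E) ->
    (\int[M]_g h g = \int[m]_x (h (Phi x) * (w x)%:E))%E.
Proof.
have mwE : measurable_fun setT (fun x => (w x)%:E) by exact/measurable_EFinP.
have w0E x : (0 <= (w x)%:E)%E by rewrite lee_fin.
have [M0 M0E] := @wpush_measure _ _ _ _ R m Phi _ mPhi mwE w0E.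
have M0fin : (M0 setT < +oo)%E by rewrite M0E /wpush preimage_setT.
have [M ME] := finite_measure_of M0fin.
have intE := @integral_wpush _ _ _ _ R m Phi _ mPhi mwE w0E M (etrans ME M0E).
exists M; split; last exact: intE.
split.
- have [c [c0 Pc]] := Phi_le; exists c; split => // t A mA.
  rewrite /pushforward ME M0E /wpush; exact: Pc.
(* The null set has to be measurable, so the complement of [good_curve] is used; it contains every
   curve that is not [abs_cont 2]. *)
- have mbad : measurable (~` @good_curve R Z : set (borel (Cpath Z))).
    by apply: measurableC; exact: good_curve_measurable.
  exists (~` @good_curve R Z); split => //.
    have mpre : measurable (Phi @^-1` (~` @good_curve R Z)) by rewrite -[X in measurable X]setTI; exact: mPhi.
    rewrite ME M0E /wpush (@ge0_ae_eq_integral _ _ _ m _ _ (cst 0%E)) ?integral0 //.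
      exact: measurable_funTS.
    by apply: filterS Phi_good => x [gx|->] // nx.
  by move=> g /= nac; apply: contra_not nac; exact: good_curve_ac.
- apply: le_lt_trans Phi_energy; rewrite le_eqVlt; apply/orP; left; apply/eqP.
  apply: eq_integral => t _; apply: intE; last by move=> g; rewrite sqre_ge0.
  exact: (measurable_fun_pair1 t (@speed_sqr_measurable R Z)).
Qed.

End plan_transport.

(** * Clamping on the line and clamped curves *)

Section real_clamp.
Context (R : realType).
Implicit Types a b x y : R.
Local Notation cl a b x := (Num.max a (Num.min x b)).

Lemma real_clamp_mono a b x y : x <= y -> cl a b x <= cl a b y.
Proof.
move=> xy; rewrite ge_max !le_max lexx /= (_ : Num.min x b <= Num.min y b) ?orbT //.
by rewrite le_min !ge_min xy lexx orbT.
Qed.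

Lemma real_clamp_lip_le a b x y : x <= y -> cl a b y - cl a b x <= y - x.
Proof.
move=> xy; have xy0 : 0 <= y - x by rewrite subr_ge0.
rewrite lerBlDl ge_max; apply/andP; split.
  by apply: (le_trans (_ : a <= cl a b x)); [rewrite le_max lexx|rewrite lerDl].
apply: (le_trans (_ : _ <= Num.min x b + (y - x))); last by rewrite lerD2r le_max lexx orbT.
rewrite addr_minl le_min addrC subrK ge_min lexx /= ge_min; apply/orP; right.
by rewrite lerDl.
Qed.

Lemma real_clamp_lip a b x y : `|cl a b x - cl a b y| <= `|x - y|.
Proof.
wlog xy : x y / x <= y => [hw|].
  have [h|/ltW h] := leP x y; first exact: hw.
  by rewrite distrC [leRHS]distrC; exact: hw.
rewrite distrC [leRHS]distrC !ger0_norm ?subr_ge0 // ?real_clamp_mono //.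
exact: real_clamp_lip_le.
Qed.

(** It shows that the segment between two distinct clamped times lies inside the original segment,
    so a majorant of a curve is also one of the clamped curve. *)
Lemma real_clamp_sub a b x y : cl a b x < cl a b y -> x <= cl a b x /\ cl a b y <= y.
Proof.
move=> lt; split.
  rewrite leNgt; apply/negP => h; move: lt; rewrite ltNge => /negP; apply.
  move: h; rewrite gt_max gt_min ltxx /= => /andP[ax bx].
  by rewrite (min_r (ltW bx)) ge_max !le_max lexx /= !ge_min (lexx b) !orbT.
rewrite leNgt; apply/negP => h; move: lt; rewrite ltNge => /negP; apply.
move: h; rewrite lt_max lt_min ltxx /= orbF => ya.
by rewrite ge_max !le_max lexx /= ge_min (ltW ya).
Qed.

End real_clamp.

Section clamped_curves.
Context (R : realType) (Z : pmetricType R).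
Let T := borel (unit_itv R).
Let C := borel (Cpath Z).
Implicit Types (s t r : unit_itv R) (g : Cpath Z).

Definition clamp s t r : unit_itv R := clip (Num.max (set_val s) (Num.min (set_val r) (set_val t))).

Lemma clampE s t r : set_val (clamp s t r) = Num.max (set_val s) (Num.min (set_val r) (set_val t)) :> R.
Proof.
rewrite clipE //; apply/andP; split; first by rewrite le_max unit_ge0.
by rewrite ge_max unit_le1 /= ge_min unit_le1.
Qed.

Lemma clamp_lip s t r r' : `|set_val (clamp s t r) - set_val (clamp s t r')| <= `|set_val r - set_val r'| :> R.
Proof.
by rewrite !clampE; exact: real_clamp_lip.
Qed.

Lemma clamp_continuous s t : continuous (clamp s t).
Proof.
move=> r W /nbhs_ballP[e /= e0 eW]; apply/nbhs_ballP; exists e => // r' rr'; apply: eW.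
rewrite /ball /=; apply: le_lt_trans (clamp_lip s t r r') _; exact: rr'.
Qed.

Lemma clamp_in s t r : unit_le s t -> seg s t r -> clamp s t r = r.
Proof.
rewrite /seg /unit_le /= => st /andP[sr rt]; apply: itv_val_inj; rewrite clampE.
by rewrite min_l // max_r.
Qed.

Lemma clamp0 s t : unit_le s t -> clamp s t i0 = s.
Proof.
rewrite /unit_le => st; apply: itv_val_inj; rewrite clampE max_l //.
by rewrite ge_min (_ : (set_val i0 : R) = 0) // unit_ge0.
Qed.

Lemma clamp1 s t : unit_le s t -> clamp s t i1 = t.
Proof.
rewrite /unit_le => st; apply: itv_val_inj; rewrite clampE.
by rewrite min_r ?max_r // (_ : (set_val i1 : R) = 1) // unit_le1.
Qed.

(** The curve stands still outside the segment instead of being reparametrised: its speed can only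
    drop, and its value at time r is the value of g at time [clamp s t r]. Thus neither the
    compression constant nor the energy of a plan increases. *)
Definition clamp_path s t g : Cpath Z :=
  mkcts (continuous_compT (@clamp_continuous s t) (@Cpath_continuous R Z g)).

Lemma clamp_pathE s t g r : clamp_path s t g r = g (clamp s t r).
Proof. by []. Qed.

Lemma clamp_path_continuous s t : continuous (clamp_path s t).
Proof.
move=> g P /Cpath_nbhs[e e0 H]; apply/Cpath_nbhs; exists e => // h hh; apply: H => r.
exact: hh.
Qed.

Lemma measurable_clamp_path s t : measurable_fun setT (clamp_path s t : C -> C).
Proof. exact: continuous_borel (@clamp_path_continuous s t). Qed.

(** Only an inequality, since at an end of the segment the clamped curve moves on one side at
    most. *)
Lemma speed_clamp_in s t g r : unit_le s t -> seg s t r ->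
  (speed (clamp_path s t g) r <= speed g r)%E.
Proof.
move=> st sr; rewrite leNgt; apply/negP => /speed_lt[q [q1 [n Hn]]].
(* The slope q found below the clamped speed is a local slope of g, and, as clamping is 1-Lipschitz,
   of the clamped curve; its speed would then be smaller than itself. *)
have : (speed (clamp_path s t g) r < speed (clamp_path s t g) r)%E.
  apply/speed_lt; exists q; split => //; exists n => r' rr'.
  rewrite !clamp_pathE (clamp_in st sr).
  have q0 := Hn r' rr'; have := mdist_ge0 (g r) (g r') => /le_trans /(_ q0).
  have [->|ne] := eqVneq r' r; first by rewrite (clamp_in st sr) mdistxx subrr normr0 mulr0.
  have p0 : 0 < `|set_val r' - set_val r| :> R.
    by rewrite normr_gt0 subr_eq0; apply: contra_neq ne => /itv_val_inj.
  rewrite pmulr_lge0 // => qq.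
  have cr : `|set_val (clamp s t r') - set_val r| <= `|set_val r' - set_val r| :> R.
    by rewrite -{1}(clamp_in st sr) clamp_lip.
  apply: le_trans (Hn (clamp s t r') (le_lt_trans cr rr')) _.
  by rewrite ler_wpM2l.
by rewrite ltxx.
Qed.

Lemma speed_clamp_out s t g r : unit_le s t -> ~ seg s t r -> speed (clamp_path s t g) r = 0%E.
Proof.
move=> st nsr; apply/eqP; rewrite eq_le speed_ge0 andbT leNgt; apply/negP => gt0.
have [n Hn] : exists n : nat, forall r' : unit_itv R, `|set_val r' - set_val r| < n.+1%:R^-1 :> R -> clamp s t r' = clamp s t r.
  move: nsr => /negP; rewrite /seg /unit_le /= negb_and -!ltNge => /orP[h|h].
  - have d0 : 0 < set_val s - set_val r :> R by rewrite subr_gt0.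
    have [n hn] := archi_lt d0; exists n => r' rr'.
    have : set_val r' < set_val s :> R.
      have := lt_trans (le_lt_trans (ler_norm _) rr') hn; by rewrite ltrBlDr subrK.
    move=> r's; apply: itv_val_inj; rewrite !clampE !max_l // ge_min ?(ltW h) ?(ltW r's) //.
  - have d0 : 0 < set_val r - set_val t :> R by rewrite subr_gt0.
    have [n hn] := archi_lt d0; exists n => r' rr'.
    have : set_val t < set_val r' :> R.
      move: rr'; rewrite distrC => rr'.
      have := lt_trans (le_lt_trans (ler_norm _) rr') hn.
      by rewrite ltrBlDr addrC -ltrBlDr opprB addrC subrK.
    by move=> r't; apply: itv_val_inj; rewrite !clampE !min_r // ltW.
have : (speed (clamp_path s t g) r < speed (clamp_path s t g) r)%E.
  apply/speed_lt; exists 0; split; first by rewrite rmorph0.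
  by exists n => r' rr'; rewrite !clamp_pathE (Hn _ rr') mdistxx rmorph0 mul0r.
by rewrite ltxx.
Qed.

Lemma speed_clamp s t g r : unit_le s t -> (speed (clamp_path s t g) r <= speed g r)%E.
Proof.
move=> st; have [sr|nsr] := pselect (seg s t r); first exact: speed_clamp_in.
by rewrite speed_clamp_out // speed_ge0.
Qed.

Lemma measurable_speed_sqr g : measurable_fun setT (fun r : T => speed g r ^+ 2)%E.
Proof. exact: (measurable_fun_pair2 (f := fun p : C * T => (speed (p.1 : Cpath Z) p.2 ^+ 2)%E) g (@speed_sqr_measurable R Z)). Qed.

Lemma clamp_good s t g (a : T -> R) : unit_le s t -> ac_bound g a ->
  (\int[leb01]_r (speed g r ^+ 2) < +oo)%E -> good_curve (clamp_path s t g).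
Proof.
move=> st [a0 ma afin gle] efin; apply: (@ac_good_curve _ _ _ a).
  split => // r r' rr'; rewrite !clamp_pathE.
  have cc : unit_le (clamp s t r) (clamp s t r').
    by rewrite /unit_le !clampE; exact: real_clamp_mono.
  have [->|ne] := eqVneq (clamp s t r) (clamp s t r').
    by rewrite mdistxx; apply: integral_ge0 => x _; rewrite lee_fin.
  apply: le_trans (gle _ _ cc) _; apply: ge0_subset_integral => //.
  - exact: measurable_seg.
  - exact: measurable_seg.
  - by apply: measurable_funTS; exact/measurable_EFinP.
  - by move=> x _; rewrite lee_fin.
  have lt : set_val (clamp s t r) < set_val (clamp s t r') :> R.
    rewrite lt_neqAle (cc : _ <= _) andbT; apply: contra_neq ne; exact: itv_val_inj.
  move: lt; rewrite !clampE => /real_clamp_sub; rewrite -!clampE => -[h1 h2] x /andP[x1 x2].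
  by apply/andP; split; [exact: le_trans x1|exact: le_trans h2].
apply: le_lt_trans efin; apply: ge0_le_integral => //.
- by move=> x _; rewrite sqre_ge0.
- exact: (measurable_speed_sqr (clamp_path s t g)).
- exact: (measurable_speed_sqr g).
- by move=> x _; rewrite expe2 expe2; apply: lee_pmul; rewrite ?speed_ge0 ?speed_clamp.
Qed.

End clamped_curves.

Section almost_everywhere_lemmas.
Context d (T : measurableType d) (R : realType) (P : {measure set T -> \bar R}).

Lemma ae_imp (A B : T -> Prop) : (forall x, A x -> B x) -> {ae P, forall x, A x} -> {ae P, forall x, B x}.
Proof. by move=> AB; apply: filterS. Qed.

Lemma ae_imp2 (A B D : T -> Prop) : (forall x, A x -> B x -> D x) ->
  {ae P, forall x, A x} -> {ae P, forall x, B x} -> {ae P, forall x, D x}.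
Proof. by move=> ABD; apply: filterS2. Qed.

Lemma ae_and (A B : T -> Prop) :
  {ae P, forall x, A x} -> {ae P, forall x, B x} -> {ae P, forall x, A x /\ B x}.
Proof. exact: ae_imp2. Qed.

End almost_everywhere_lemmas.

Lemma mine_mulr (R : realType) (x y : R) (v : \bar R) : (0 <= v)%E ->
  mine (x%:E * v)%E (y%:E * v)%E = ((Num.min x y)%:E * v)%E.
Proof.
move=> v0; have [h|/ltW h] := leP x y.
  by rewrite (min_idPl _) //; apply: lee_wpmul2r => //; rewrite lee_fin.
by rewrite (min_idPr _) //; apply: lee_wpmul2r => //; rewrite lee_fin.
Qed.

Lemma clip_mono (R : realType) (x y : R) : x <= y -> unit_le (clip x) (clip y).
Proof.
move=> xy; rewrite /unit_le /clip !itv_mkE.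
have h : Num.max 0 x <= Num.max 0 y by rewrite ge_max !le_max lexx xy !orbT.
by rewrite le_min !ge_min lexx h orbT.
Qed.

(** * Weak upper gradients along almost every curve *)

Section lattice.
Context (R : realType) (Z : pmetricType R) (mu : {measure set (borel Z) -> \bar R}).
Let T := borel (unit_itv R).
Let C := borel (Cpath Z).
Implicit Types (s t r : unit_itv R) (g : Cpath Z) (f G : borel Z -> R).
Implicit Types (P : {finite_measure set (borel (Cpath Z)) -> \bar R}).

Lemma finite_plan_good P : finite_plan mu P -> {ae P, forall g : Cpath Z, good_curve g}.
Proof.
move=> [_ Pac PE].
pose E (g : C) : \bar R := (\int[leb01]_t (speed (g : Cpath Z) t ^+ 2))%E.
have E0 g : (0 <= E g)%E by apply: integral_ge0 => t _; rewrite sqre_ge0.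
have mE : measurable_fun setT E.
  apply: (@measurable_fun_integral_section _ _ C T R (@leb01 R) setT
    (fun p => speed (p.1 : Cpath Z) p.2 ^+ 2)%E) => //; first exact: speed_sqr_measurable.
  by move=> p; rewrite sqre_ge0.
have Efin : (\int[P]_g E g < +oo)%E.
  apply: le_lt_trans PE; rewrite le_eqVlt; apply/orP; left; apply/eqP.
  have := @fubini_tonelli _ _ C T R P (@leb01 R) (fun p => speed (p.1 : Cpath Z) p.2 ^+ 2)%E (@speed_sqr_measurable R Z).
  by apply=> p; rewrite sqre_ge0.
have Eint : (P : set C -> \bar R).-integrable setT E.
  by apply/integrableP; split => //; under eq_integral do rewrite gee0_abs //.
apply: (ae_imp2 _ Pac (integrable_ae measurableT Eint)) => g ac /(_ Logic.I) Eg.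
have [a ag] := @abs_cont_bound R Z 2 g (or_intror erefl) ac.
by apply: ac_good_curve ag _; rewrite -ge0_fin_numE //; exact: E0.
Qed.

Lemma int_cost_clamp G s t g : measurable_fun setT G -> (forall z, 0 <= G z) -> unit_le s t ->
  (\int[leb01]_r ((G (clamp_path s t g r))%:E * speed (clamp_path s t g) r) <=
   \int[leb01]_(r in seg s t) ((G (g r))%:E * speed g r))%E.
Proof.
move=> mG G0 st; rewrite [leRHS]integral_mkcond; apply: ge0_le_integral => //.
- by move=> r _; rewrite mule_ge0 ?lee_fin // speed_ge0.
- exact: (measurable_cost_section (clamp_path s t g) mG).
- apply/(measurable_restrict _ (measurable_seg s t)) => //.
  by rewrite setTI; apply: measurable_funTS; exact: (measurable_cost_section g mG).
- move=> r _; rewrite patchE; case: ifPn => [/set_mem sr|/negP nsr].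
    by rewrite clamp_pathE clamp_in //; apply: lee_wpmul2l; [rewrite lee_fin|exact: speed_clamp_in].
  rewrite speed_clamp_out ?mule0 // => sr; apply: nsr; exact: mem_set.
Qed.

(* Test the weak upper gradient on the curves clamped to [seg s t], restricted to
   an arbitrary Borel set of curves. *)
Lemma segment_wug P f G s t : finite_plan mu P -> weak_upper_gradient mu f G ->
  measurable_fun setT f -> unit_le s t ->
  {ae P, forall g : Cpath Z, (`|f (g t) - f (g s)|%:E <=
     \int[leb01]_(r in seg s t) ((G (g r))%:E * speed g r))%E}.
Proof.
move=> FP wG mf st; have [G0 [mG G2] _] := wG.
have [n Pb] := finite_plan_bound FP.
have mosc : measurable_fun setT (fun g : C => `|f ((g : Cpath Z) t) - f ((g : Cpath Z) s)|%:E).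
  apply/measurable_EFinP; apply: measurableT_comp => //.
  by apply: measurable_funB; exact: measurable_eval_fun.
have mcost := measurable_int_cost (measurable_seg s t) mG G0.
have P1 : (P setT < +oo)%E by rewrite -ge0_fin_numE //; exact: fin_num_measure.
apply: ae_le_of_integral_le => //.
- by move=> g; exact: int_cost_ge0.
- have : (plan_cost P G < +oo)%E.
    apply: le_lt_trans (plan_cost_le Pb ltr01 mG G0) _.
    by rewrite -(fineK (_ : sqint mu G \is a fin_num)) ?ge0_fin_numE ?sqint_ge0 // -EFinM -EFinD ltry.
  apply: le_lt_trans; apply: ge0_le_integral => //.
  + by move=> g _; exact: int_cost_ge0.
  + exact: measurable_int_cost.
  + move=> g _; apply: ge0_subset_integral => //; first exact: measurable_seg.
      exact: measurable_cost_section.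
    by move=> r _; exact: cost_ge0.
move=> A mA.
have m1 : measurable_fun setT (\1_A : C -> R) by exact: measurable_indic.
have i1 (x : C) : (0 : R) <= \1_A x by [].
have le1 (x : \bar R) (g : C) : (0 <= x -> x * (\1_A g)%:E <= x)%E.
  by move=> x0; rewrite indicE; case: (_ \in _); rewrite ?mulr1n ?mule1 // mulr0n mule0.
have [M [FM iM]] : exists M : {finite_measure set (borel (Cpath Z)) -> \bar R}, finite_plan mu M /\
    forall h : borel (Cpath Z) -> \bar R, measurable_fun setT h -> (forall g, (0 <= h g)%E) ->
    (\int[M]_g h g = \int[P]_x (h (clamp_path s t x) * (\1_A x)%:E))%E.
  have [[c [c0 Pc]] Pac PE] := FP.
  apply: (@transport_plan R Z mu _ C P (clamp_path s t) (\1_A)).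
  - exact: measurable_clamp_path.
  - exact: m1.
  - exact: i1.
  - by rewrite integral_indic // setIT; apply: le_lt_trans P1; apply: le_measure; rewrite ?inE.
  - exists c; split => // r B mB; apply: le_trans (Pc (clamp s t r) B mB).
    have mS : measurable [set x : C | B (clamp_path s t (x : Cpath Z) r)].
      by rewrite -[X in measurable X]setTI; exact: (eval_measurable (clamp s t r)).
    apply: (@le_trans _ _ (\int[P]_(x in [set x : C | B (clamp_path s t (x : Cpath Z) r)]) 1)%E).
      apply: ge0_le_integral => //.
      + by apply: measurable_funTS; exact/measurable_EFinP.
      + by move=> x _; rewrite lee_fin indicE; case: (_ \in _).
    by rewrite integral_cst // mul1e.
  - apply: (ae_imp _ (finite_plan_good FP)) => g gg; left.
    have [a ag] := @abs_cont_bound R Z 2 g (or_intror erefl) (good_curve_ac gg).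
    by apply: clamp_good ag _ => //; case: gg.
  - apply: le_lt_trans PE; apply: ge0_le_integral => //.
    + by move=> r _; apply: integral_ge0 => g _; rewrite mule_ge0 // ?sqre_ge0 // lee_fin.
    + have mS : measurable_fun setT (fun p : C * T => speed (clamp_path s t (p.1 : Cpath Z)) p.2 ^+ 2 * (\1_A p.1)%:E)%E.
        apply: emeasurable_funM; last by apply/measurable_EFinP; exact: (measurableT_comp m1 measurable_fst).
        apply: (measurableT_comp (@speed_sqr_measurable R Z) (g := fun p : C * T => (clamp_path s t (p.1 : Cpath Z) : C, p.2))).
        apply/measurable_fun_pairP; split; last exact: measurable_snd.
        exact: (measurableT_comp (measurable_clamp_path s t) measurable_fst).
      apply: (@measurable_fun_fubini_tonelli_G _ _ C T R P _ mS).
      by move=> p; rewrite mule_ge0 // ?sqre_ge0 // lee_fin.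
    + apply: (@measurable_fun_fubini_tonelli_G _ _ C T R P _ (@speed_sqr_measurable R Z)).
      by move=> p; rewrite sqre_ge0.
    + move=> r _; apply: ge0_le_integral => //.
      * by move=> g _; rewrite mule_ge0 // ?sqre_ge0 // lee_fin.
      * apply: emeasurable_funM; last exact/measurable_EFinP.
        have h := measurable_fun_pair1 r (@speed_sqr_measurable R Z).
        exact: (measurableT_comp h (measurable_clamp_path s t)).
      * exact: (measurable_fun_pair1 r (@speed_sqr_measurable R Z)).
      * move=> g _; apply: le_trans (le1 _ _ _) _; first by rewrite sqre_ge0.
        by rewrite !expe2; apply: lee_pmul; rewrite ?speed_ge0 ?speed_clamp.
have := finite_plan_wug wG mf FM; rewrite /plan_osc /plan_cost iM //; last exact: measurable_osc.
rewrite iM; last 2 first.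
- exact: measurable_int_cost.
- by move=> g; exact: int_cost_ge0.
have patch1 (h : C -> \bar R) : (\int[P]_(x in A) h x = \int[P]_x (h x * (\1_A x)%:E))%E.
  rewrite integral_mkcond; apply: eq_integral => x _; rewrite patchE indicE.
  by case: ifP => _; rewrite ?mule1 ?mule0.
rewrite !patch1 => le12.
have -> : (\int[P]_x (`|f ((x : Cpath Z) t) - f ((x : Cpath Z) s)|%:E * (\1_A x)%:E) =
   \int[P]_x (`|f (clamp_path s t x Defs.i1) - f (clamp_path s t x i0)|%:E * (\1_A x)%:E))%E.
  by apply: eq_integral => x _; rewrite !clamp_pathE clamp0 // clamp1.
apply: le_trans le12 _; apply: ge0_le_integral.
- exact: measurableT.
- by move=> x _; apply: mule_ge0; [exact: (int_cost_ge0 (clamp_path s t x) setT G0)|rewrite lee_fin].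
- apply: emeasurable_funM; last exact/measurable_EFinP.
  exact: (measurableT_comp (measurable_int_cost measurableT mG G0) (measurable_clamp_path s t)).
- by apply: emeasurable_funM; [exact: mcost|exact/measurable_EFinP].
- move=> x _; apply: lee_wpmul2r; first by rewrite lee_fin.
  exact: int_cost_clamp.
Qed.

Lemma wug_min f G1 G2 : measurable_fun setT f -> weak_upper_gradient mu f G1 ->
  weak_upper_gradient mu f G2 -> weak_upper_gradient mu f (fun z => Num.min (G1 z) (G2 z)).
Proof.
move=> mf w1 w2; have [G10 [mG1 L1] _] := w1; have [G20 [mG2 L2] _] := w2.
have min0 z : 0 <= Num.min (G1 z) (G2 z) by rewrite le_min G10 G20.
have mmin : measurable_fun setT (fun z => Num.min (G1 z) (G2 z)) by exact: measurable_minr.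
split => //.
  split => //; apply: le_lt_trans L1; apply: (@sqint_le _ _ _ mu) => // z.
  by rewrite !ger0_norm // ge_min lexx.
(* [test_plan] and [finite_plan] unfold to the same conditions. *)
move=> P tP; have FP : finite_plan mu P by [].
have [n Pb] := finite_plan_bound FP.
have cfin G : measurable_fun setT G -> (forall z, 0 <= G z) -> (sqint mu G < +oo)%E ->
    {ae P, forall g : C, (\int[leb01]_r ((G ((g : Cpath Z) r))%:E * speed (g : Cpath Z) r) < +oo)%E}.
  move=> mG G0 G2fin.
  have int : (P : set C -> \bar R).-integrable setT (fun g : C => \int[leb01]_r ((G ((g : Cpath Z) r))%:E * speed (g : Cpath Z) r))%E.
    apply/integrableP; split; first exact: measurable_int_cost.
    under eq_integral do rewrite gee0_abs ?int_cost_ge0 //.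
    apply: le_lt_trans (plan_cost_le Pb ltr01 mG G0) _.
    by rewrite -(fineK (_ : sqint mu G \is a fin_num)) ?ge0_fin_numE ?sqint_ge0 // -EFinM -EFinD ltry.
  apply: (ae_imp _ (integrable_ae measurableT int)) => g /(_ Logic.I).
  by rewrite ge0_fin_numE //; exact: int_cost_ge0.
have grid_le m j : unit_le (grid R m j) (grid R m j.+1).
  by apply: clip_mono; rewrite ler_pM2r ?invr_gt0 ?exprn_gt0 // ler_nat leqnSn.
have cells G : weak_upper_gradient mu f G -> {ae P, forall g : Cpath Z, forall m j,
    (`|f (g (grid R m j.+1)) - f (g (grid R m j))|%:E <=
     \int[leb01]_(r in seg (grid R m j) (grid R m j.+1)) ((G (g r))%:E * speed g r))%E}.
  by move=> wG; apply/ae_foralln => m; apply/ae_foralln => j; exact: segment_wug.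
apply: ae_ge0_le_integral => //.
- exact: measurable_osc.
- by move=> g _; exact: (int_cost_ge0 g setT min0).
- exact: (measurable_int_cost measurableT mmin min0).
have := ae_and (ae_and (cells _ w1) (cells _ w2)) (ae_and (cfin _ mG1 G10 L1) (cfin _ mG2 G20 L2)).
apply: ae_imp => g [[c1 c2] [f1 f2]] _.
have := @osc_le_min R (fun r => (G1 ((g : Cpath Z) r))%:E * speed (g : Cpath Z) r)%E
  (fun r => (G2 ((g : Cpath Z) r))%:E * speed (g : Cpath Z) r)%E (fun r => f ((g : Cpath Z) r)).
move=> /(_ (measurable_cost_section g mG1) (measurable_cost_section g mG2)) /(_ (fun r => cost_ge0 g r G10)
  (fun r => cost_ge0 g r G20) f1 f2 c1 c2) /le_trans; apply.
rewrite le_eqVlt; apply/orP; left; apply/eqP; apply: eq_integral => r _.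
exact: mine_mulr (speed_ge0 (g : Cpath Z) r).
Qed.

Lemma minimal_wug_of_min_norm f G : measurable_fun setT f -> weak_upper_gradient mu f G ->
  (forall G', weak_upper_gradient mu f G' -> (sqint mu G <= sqint mu G')%E) ->
  minimal_weak_upper_gradient mu f G.
Proof.
move=> mf wG hmin; split => // G' wG'.
have [G0 [mG G2] _] := wG; have [G'0 [mG' G'2] _] := wG'.
pose H z := Num.min (G z) (G' z).
have wH : weak_upper_gradient mu f H by exact: wug_min.
have [H0 [mH H2] _] := wH.
have HG z : H z <= G z by rewrite /H ge_min lexx.
have sqHG z : H z ^+ 2 <= G z ^+ 2 by rewrite ler_sqr ?nnegrE.
have md : measurable_fun setT (fun z => (G z ^+ 2 - H z ^+ 2)%:E).
  by apply/measurable_EFinP; apply: measurable_funB; exact: measurable_funX.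
have d0 z : (0 <= (G z ^+ 2 - H z ^+ 2)%:E)%E by rewrite lee_fin subr_ge0.
have Hfin : sqint mu H \is a fin_num by rewrite ge0_fin_numE ?sqint_ge0.
have h1 : sqint mu G = (sqint mu H + \int[mu]_z (G z ^+ 2 - H z ^+ 2)%:E)%E.
  rewrite /sqint -ge0_integralD //; last 2 first.
  - by move=> z _; rewrite lee_fin sqr_ge0.
  - exact: measurable_sqr.
  by apply: eq_integral => z _; rewrite -EFinD addrC subrK.
have h2 : (\int[mu]_z (G z ^+ 2 - H z ^+ 2)%:E = 0)%E.
  apply/eqP; rewrite eq_le integral_ge0 // andbT -(@leeD2lE _ _ _ _ Hfin) adde0 -h1.
  exact: hmin.
have [h3 _] := @ae_eq_integral_abs _ _ _ mu setT measurableT _ md.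
have h4 : ae_eq mu setT (fun z => (G z ^+ 2 - H z ^+ 2)%:E) (cst 0%E).
  by apply: h3; rewrite -[RHS]h2; apply: eq_integral => z _; rewrite gee0_abs.
apply: (ae_imp _ h4) => z /(_ Logic.I) [] /eqP; rewrite subr_eq0 => /eqP sq.
have -> : G z = H z by apply/eqP; rewrite -(@eqrXn2 _ 2) // sq.
by rewrite /H ge_min lexx orbT.
Qed.

End lattice.

(** * Sobolev regularity of almost every section *)

Section sigma_finite_packing.
Context d (T : measurableType d) (R : realType).

(** An alias that depends on the proof of sigma-finiteness, so that this proof can be attached to a
    measure obtained from an existential statement. *)
Definition sf_measure (M : {measure set T -> \bar R}) of sigma_finite setT M : set T -> \bar R := M.

Variables (M : {measure set T -> \bar R}) (h : sigma_finite setT M).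
HB.instance Definition _ := Measure.copy (sf_measure h) M.
HB.instance Definition _ := Measure_isSigmaFinite.Build _ _ _ (sf_measure h) h.
End sigma_finite_packing.

Lemma sigma_finite_product d1 d2 (T1 : measurableType d1) (T2 : measurableType d2) (R : realType)
    (m1 : {sigma_finite_measure set T1 -> \bar R}) (m2 : {sigma_finite_measure set T2 -> \bar R}) :
  exists m : {sigma_finite_measure set (T1 * T2)%type -> \bar R},
    (m : set (T1 * T2) -> \bar R) = (m1 \x m2)%E.
Proof.
suff h : sigma_finite setT (m1 \x m2)%E by exists (sf_measure h).
have [F FT Ffin] := sigma_finiteT m1; have [G GT Gfin] := sigma_finiteT m2.
pose H i := if (unpickle i : option (nat * nat)) is Some (n, k) then F n `*` G k else set0.
exists H.
  apply/seteqP; split => // -[x y] _.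
  have [n _ Fx] : (\bigcup_n F n) x by rewrite -FT.
  have [k _ Gy] : (\bigcup_n G n) y by rewrite -GT.
  by exists (pickle (n, k)) => //; rewrite /H pickleK.
move=> i; rewrite /H; case: unpickle => [[n k]|]; last by rewrite measure0.
have [mF mFoo] := Ffin n; have [mG mGoo] := Gfin k.
split; first exact: measurableX.
by rewrite product_measure1E // lte_mul_pinfty // ge0_fin_numE.
Qed.

Lemma nbhs_sub (T : topologicalType) (x : T) (A B : set T) : A `<=` B -> nbhs x A -> nbhs x B.
Proof. by move=> AB; apply: filterS. Qed.

(** * Lifting curves and plans along a family of Lipschitz maps *)

Section lifted_curves.
Context (R : realType) (Z Y V : pmetricType R).
Variable BY : nat -> set Y.
Hypothesis bY : countable_base BY.
Variables (iota : Z -> Y -> V) (c : Y -> R) (kappa : Z -> R).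
Hypothesis c0 : forall y, 0 <= c y.
Hypothesis kappa0 : forall z, 0 <= kappa z.
Hypothesis c_cont : continuous c.
Hypothesis kappa_cont : continuous kappa.
(** The triangle inequality through [iota z y']: Lipschitz in the first variable with constant c y',
    in the second with constant kappa z. The second part makes [iota] and the lift of curves jointly
    continuous, hence jointly measurable. *)
Hypothesis iota_le : forall z y z' y',
  mdist (iota z y) (iota z' y') <= c y' * mdist z z' + kappa z * mdist y y'.
Let T := borel (unit_itv R).
Let CZ := borel (Cpath Z).
Let CV := borel (Cpath V).
Implicit Types (g : Cpath Z) (y : Y) (r : unit_itv R).

Lemma iota_le1 y z z' : mdist (iota z y) (iota z' y) <= c y * mdist z z'.
Proof. by have := iota_le z y z' y; rewrite mdistxx mulr0 addr0. Qed.

Let small (K k e a a' b b' : R) : 0 < e -> 0 <= K -> 0 <= k -> 0 <= a -> 0 <= b -> a' <= K + 1 -> b' <= k ->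
  0 <= a' -> 0 <= b' -> a < e / (2 * (K + 1)) -> b < e / (2 * (k + 1)) -> a' * a + b' * b < e.
Proof.
move=> e0 K0 k0 a0 b0 aK bk a'0 b'0 ha hb.
have K1 : 0 < K + 1 by lra.
have k1 : 0 < k + 1 by lra.
have h1 : a' * a <= (K + 1) * a by rewrite ler_wpM2r.
have h2 : (K + 1) * a < e / 2.
  have : (K + 1) * a < (K + 1) * (e / (2 * (K + 1))) by rewrite ltr_pM2l.
  by have -> : (K + 1) * (e / (2 * (K + 1))) = e / 2 by field; rewrite gt_eqF.
have h3 : b' * b <= (k + 1) * b by rewrite ler_wpM2r // (le_trans bk) // lerDl.
have h4 : (k + 1) * b < e / 2.
  have : (k + 1) * b < (k + 1) * (e / (2 * (k + 1))) by rewrite ltr_pM2l.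
  by have -> : (k + 1) * (e / (2 * (k + 1))) = e / 2 by field; rewrite gt_eqF.
have : a' * a + b' * b < e / 2 + e / 2 by apply: ltrD; [exact: le_lt_trans h2|exact: le_lt_trans h4].
by rewrite -splitr.
Qed.

Let ball_mdist (M : pmetricType R) (x x' : M) (e : R) : ball x e x' <-> mdist x x' < e.
Proof. by rewrite ballEmdist. Qed.

Let near_c y (e : R) : 0 < e -> nbhs y [set y' | c y' <= c y + 1 /\ mdist y y' < e].
Proof.
move=> e0; have h1 : nbhs y (c @^-1` (ball (c y) 1)) by apply: (@c_cont y); exact: nbhsx_ballx.
have h2 : nbhs y (ball y e) by exact: nbhsx_ballx.
apply: filterS2 h1 h2 => y' /=; rewrite -ball_normE /= => h3 /ball_mdist h4; split => //.
have := le_lt_trans (ler_norm _) (_ : `|c y' - c y| < 1); rewrite distrC => /(_ h3).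
by rewrite ltrBlDl => /ltW.
Qed.

Lemma iota_continuous : continuous (fun p : Z * Y => iota p.1 p.2).
Proof.
move=> [z y] W /nbhs_ballP[e /= e0 eW].
pose d1 := e / (2 * (c y + 1)); pose d2 := e / (2 * (kappa z + 1)).
have d10 : 0 < d1 by rewrite divr_gt0 // mulr_gt0 // ltr_wpDl.
have d20 : 0 < d2 by rewrite divr_gt0 // mulr_gt0 // ltr_wpDl.
exists (ball z d1, [set y' | c y' <= c y + 1 /\ mdist y y' < d2]).
  by split => /=; [exact: nbhsx_ballx|exact: near_c].
move=> [z' y'] /= [/ball_mdist h1 [h2 h3]]; apply: eW; apply/ball_mdist.
apply: le_lt_trans (iota_le z y z' y') _.
by apply: (@small (c y) (kappa z)) => //; exact: mdist_ge0.
Qed.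

Lemma iota_measurable : measurable_fun setT (fun p : borel Z * borel Y => iota p.1 p.2 : borel V).
Proof.
apply: (@measurability _ _ _ (borel V) setT _ (@open V)) => //.
move=> _ [U oU <-]; rewrite setTI.
apply: (@open_prod_borel Z Y BY) => //.
by apply: open_comp => // x _; exact: iota_continuous.
Qed.

Lemma lift_curve_continuous g y : continuous (fun r => iota (g r) y).
Proof.
move=> r W /nbhs_ballP[e /= e0 eW].
have d0 : 0 < e / (2 * (c y + 1)) by rewrite divr_gt0 // mulr_gt0 // ltr_wpDl.
have : nbhs r [set r' | mdist (g r) (g r') < e / (2 * (c y + 1))].
  have := @Cpath_continuous R Z g r (ball (g r) (e / (2 * (c y + 1)))) (nbhsx_ballx _ _ d0).
  by apply: nbhs_sub => r' /= /ball_mdist.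
apply: (@nbhs_sub _ _ _ ((fun r' => iota (g r') y) @^-1` W)) => r' /= h; apply: eW; apply/ball_mdist.
apply: le_lt_trans (iota_le _ _ _ _) _; rewrite mdistxx.
apply: (@small (c y) (kappa (g r)) e) => //; rewrite ?mdist_ge0 ?lerDl //.
by rewrite divr_gt0 // mulr_gt0 // ltr_wpDl.
Qed.

Definition lift_curve g y : Cpath V := mkcts (@lift_curve_continuous g y).

Lemma lift_curveE g y r : lift_curve g y r = iota (g r) y.
Proof. by []. Qed.

(** Uniform closeness of lifted curves for nearby parameters requires kappa to be bounded along the
    whole curve. *)
Lemma path_bounded g : exists K : R, forall r, kappa (g r) <= K.
Proof.
have gc : continuous (fun x : R => kappa (g (clip x))).
  exact: continuous_compT (continuous_compT (@clip_continuous R) (@Cpath_continuous R Z g)) kappa_cont.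
have [x _ hx] := @EVT_max R (fun x => kappa (g (clip x))) 0 1 ler01 (continuous_subspaceT gc).
exists (kappa (g (clip x))) => r; rewrite -{1}(clipK r); apply: hx.
by rewrite in_itv /= unit_ge0 unit_le1.
Qed.

Lemma lift_continuous : continuous (fun p : Cpath Z * Y => lift_curve p.1 p.2).
Proof.
move=> [g y] W /Cpath_nbhs[e e0 eW].
have [K0 HK0] := path_bounded g.
pose K := Num.max K0 0.
have K_ge0 : 0 <= K by rewrite le_max lexx orbT.
have HK r : kappa (g r) <= K by rewrite le_max HK0.
pose d1 := e / (2 * (c y + 1)); pose d2 := e / (2 * (K + 1)).
have d10 : 0 < d1 by rewrite divr_gt0 // mulr_gt0 // ltr_wpDl.
have d20 : 0 < d2 by rewrite divr_gt0 // mulr_gt0 // ltr_wpDl.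
exists ([set h : Cpath Z | forall r, mdist (g r) (h r) < d1], [set y' | c y' <= c y + 1 /\ mdist y y' < d2]).
  by split => /=; [apply/Cpath_nbhs; exists d1|exact: near_c].
move=> [h y'] /= [h1 [h2 h3]]; apply: eW => r /=.
apply: le_lt_trans (iota_le (g r) y (h r) y') _.
by apply: (@small (c y) K) => //; exact: mdist_ge0.
Qed.

Lemma lift_measurable : measurable_fun setT (fun p : CZ * borel Y => lift_curve p.1 p.2 : CV).
Proof.
apply: (@measurability _ _ _ CV setT _ (@open (Cpath V))) => //.
move=> _ [U oU <-]; rewrite setTI.
apply: (@open_prod_borel (Cpath Z) Y BY) => //.
by apply: open_comp => // x _; exact: lift_continuous.
Qed.

Lemma speed_lift g y r : (speed (lift_curve g y) r <= (c y)%:E * speed g r)%E.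
Proof.
have contra : (speed (lift_curve g y) r < speed (lift_curve g y) r)%E -> False by rewrite ltxx.
rewrite leNgt; apply/negP => lt; apply: contra.
(* For c y = 0 no division is possible, and the claim is that the speed is 0 even where g has
   infinite speed; it holds because [iota] no longer separates points. *)
have := c0 y; rewrite le_eqVlt => /orP[/eqP cy0|cy].
  rewrite -cy0 mul0e in lt; apply/speed_lt; exists 0; split; first by rewrite rmorph0.
  exists 0%N => s _; rewrite rmorph0 mul0r !lift_curveE.
  by apply: le_trans (iota_le1 _ _ _) _; rewrite -cy0 mul0r.
have : (speed g r < ((c y)^-1)%:E * speed (lift_curve g y) r)%E by rewrite lte_pdivlMl.
move=> /speed_lt[q [q1 [n Hn]]].
have q2 : ((c y * ratr q)%:E < speed (lift_curve g y) r)%E by rewrite EFinM -lte_pdivlMl.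
have [q' [h1 h2]] := rat_between q2.
apply/speed_lt; exists q'; split => //; exists n => s rs; rewrite !lift_curveE.
apply: le_trans (iota_le1 _ _ _) _.
apply: (@le_trans _ _ (c y * (ratr q * `|set_val s - set_val r|))).
  by rewrite ler_pM2l //; exact: Hn.
by rewrite mulrA ler_wpM2r.
Qed.

Lemma speed_sqr_lift g y r : (speed (lift_curve g y) r ^+ 2 <= ((c y) ^+ 2)%:E * speed g r ^+ 2)%E.
Proof.
have -> : (((c y) ^+ 2)%:E * speed g r ^+ 2 = ((c y)%:E * speed g r) ^+ 2)%E by rewrite !expe2 EFin_expe expe2 muleACA.
by rewrite !expe2; apply: lee_pmul; rewrite ?speed_ge0 ?speed_lift.
Qed.

Lemma good_lift g y : good_curve g -> good_curve (lift_curve g y).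
Proof.
move=> gg; have [efin _] := gg.
have [a [a0 ma afin gle]] := @abs_cont_bound R Z 2 g (or_intror erefl) (good_curve_ac gg).
apply: (@ac_good_curve _ _ _ (fun t => c y * a t)).
  split.
  - by move=> t; rewrite mulr_ge0.
  - exact: measurable_funM (measurable_cst _) ma.
  - under eq_integral do rewrite EFinM.
    rewrite ge0_integralZl_EFin //; last 2 first.
    + by move=> t _; rewrite lee_fin.
    + exact/measurable_EFinP.
    by rewrite lte_mul_pinfty // lee_fin.
  - move=> s t st; rewrite !lift_curveE.
    under eq_integral do rewrite EFinM.
    rewrite ge0_integralZl_EFin //; last 3 first.
    + exact: measurable_seg.
    + by move=> x _; rewrite lee_fin.
    + by apply: measurable_funTS; exact/measurable_EFinP.
    apply: (@le_trans _ _ ((c y)%:E * (mdist (g s) (g t))%:E)%E).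
      by rewrite -EFinM lee_fin; exact: iota_le1.
    by apply: lee_wpmul2l; [rewrite lee_fin|exact: gle].
apply: (@le_lt_trans _ _ (\int[leb01]_t (((c y) ^+ 2)%:E * speed g t ^+ 2))%E).
  apply: ge0_le_integral => //.
  - by move=> x _; rewrite sqre_ge0.
  - exact: measurable_speed_sqr.
  - by apply: measurable_funeM; exact: measurable_speed_sqr.
  - by move=> x _; exact: speed_sqr_lift.
rewrite ge0_integralZl_EFin //; last 3 first.
- by move=> t _; rewrite sqre_ge0.
- exact: measurable_speed_sqr.
- by rewrite sqr_ge0.
by rewrite lte_mul_pinfty // lee_fin sqr_ge0.
Qed.

Lemma iota_measurable1 y : measurable_fun setT (fun z : borel Z => iota z y : borel V).
Proof. exact: (measurable_fun_pair1 (y : borel Y) iota_measurable). Qed.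

Section lifted_plans.
Variables (mu : {sigma_finite_measure set (borel Z) -> \bar R}).
Variables (nu : {sigma_finite_measure set (borel Y) -> \bar R}).
Variables (muV : {measure set (borel V) -> \bar R}).
Hypothesis muVE : forall A : set (borel V), measurable A ->
  muV A = (\int[nu]_y mu [set z | A (iota z y)])%E.

(** Compression: for fixed y, the measure of the curves that [iota] brings into B at time r is at
    most k times the mu-measure of the preimage of B; integrating over y gives k times the
    [muV]-measure of B, with the same k. The energy is at most n^2 times nu A times that of M. *)
Lemma lifted_plan (M : {finite_measure set (borel (Cpath Z)) -> \bar R}) (A : set (borel Y)) (n : R) :
  finite_plan mu M -> measurable A -> (nu A < +oo)%E -> (forall y, A y -> c y <= n) ->
  exists N : {finite_measure set (borel (Cpath V)) -> \bar R}, finite_plan muV N /\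
    forall h : CV -> \bar R, measurable_fun setT h -> (forall u, (0 <= h u)%E) ->
      (\int[N]_u h u = \int[M \x nu]_p (h (lift_curve p.1 p.2) * (\1_A p.2)%:E))%E.
Proof.
move=> FM mA nuA cA.
have [[k [k0 Mk]] Mac ME] := FM.
have m2 : measurable_fun setT (fun p : CZ * borel Y => \1_A p.2 : R).
  by apply: (measurableT_comp (f := fun y : borel Y => \1_A y : R)); [exact: measurable_indic|exact: measurable_snd].
have m2E : measurable_fun setT (fun p : CZ * borel Y => (\1_A p.2 : R)%:E) by exact/measurable_EFinP.
have ind0 (y : borel Y) : (0 : R) <= \1_A y by [].
have ind0E (y : borel Y) : (0 <= (\1_A y : R)%:E)%E by rewrite lee_fin.
have Mfin : (M setT < +oo)%E by rewrite -ge0_fin_numE //; exact: fin_num_measure.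
have mliftr r : measurable_fun setT (fun p : CZ * borel Y => lift_curve p.1 p.2 r : borel V).
  exact: (measurableT_comp (@eval_measurable R V r) lift_measurable).
have mspeed r : measurable_fun setT (fun p : CZ * borel Y => speed (lift_curve p.1 p.2) r ^+ 2)%E.
  have h : measurable_fun setT (fun g : CV => speed (g : Cpath V) r ^+ 2)%E.
    exact: (measurable_fun_pair1 (r : T) (@speed_sqr_measurable R V)).
  exact: (measurableT_comp h lift_measurable).
have [MN MNE] := sigma_finite_product M nu.
rewrite -MNE.
apply: (@transport_plan R V muV _ (CZ * borel Y)%type MN (fun p => lift_curve p.1 p.2) (fun p => \1_A p.2)).
- exact: lift_measurable.
- exact: m2.
- by move=> x; exact: ind0.
- rewrite MNE (@fubini_tonelli1 _ _ CZ (borel Y) R M nu _ m2E); last by move=> x; exact: ind0E.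
  rewrite /fubini_F /=.
  under eq_integral do rewrite integral_indic // setIT.
  by rewrite integral_cst // lte_mul_pinfty // ge0_fin_numE.
- exists k; split => // r B mB.
  have mBr : measurable [set x : CZ * borel Y | B (lift_curve x.1 x.2 r)].
    by rewrite -[X in measurable X]setTI; exact: (mliftr r).
  pose S : set (CZ * borel Y)%type := [set x | B (lift_curve x.1 x.2 r)].
  have SE x : \1_S x = (x \in S)%:R :> R by rewrite indicE.
  pose h (x : (CZ * borel Y)%type) : \bar R := ((\1_A x.2 : R) * (\1_S x : R))%:E.
  have -> : (\int[MN]_(x in [set x | B (lift_curve x.1 x.2 r)]) (\1_A x.2)%:E = \int[MN]_x h x)%E.
    rewrite integral_mkcond; apply: eq_integral => x _; rewrite patchE /h SE.
    by case: ifP => _; rewrite ?mulr1 ?mulr0.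
  have mp : measurable_fun setT h.
    by apply/measurable_EFinP; apply: measurable_funM => //; exact: measurable_indic.
  have hp0 x : (0 <= h x)%E by rewrite lee_fin mulr_ge0.
  rewrite MNE (@fubini_tonelli2 _ _ CZ (borel Y) R M nu _ mp hp0).
  rewrite /fubini_G muVE //.
  have mz y : measurable ([set z | B (iota z y)] : set (borel Z)).
    by rewrite -[X in measurable X]setTI; exact: (iota_measurable1 y).
  have mmu : measurable_fun setT (fun y : borel Y => mu [set z | B (iota z y)]).
    have mS : measurable [set p : borel Z * borel Y | B (iota p.1 p.2)].
      by rewrite -[X in measurable X]setTI; exact: iota_measurable.
    have := measurable_fun_ysection mu mS.
    by apply: eq_measurable_fun => y _; rewrite /= ysectionE.
  rewrite -ge0_integralZl_EFin //; last exact: ltW.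
  apply: ge0_le_integral => //.
  + by move=> y _; exact: integral_ge0.
  + exact: (@measurable_fun_fubini_tonelli_G _ _ CZ (borel Y) R M _ mp).
  + exact: measurable_funeM.
  + move=> y _; apply: le_trans (Mk r _ (mz y)).
    have mgy : measurable ([set x | B (iota ((x : Cpath Z) r) y)] : set CZ).
      have h1 : measurable_fun setT (fun x : CZ => iota ((x : Cpath Z) r) y : borel V).
        exact: (measurableT_comp (iota_measurable1 y) (@eval_measurable R Z r)).
      by have := h1 measurableT _ mB; rewrite setTI.
    rewrite /pushforward /preimage /=.
    pose E : set CZ := [set x : CZ | B (iota ((x : Cpath Z) r) y)].
    have EE x : \1_E x = (x \in E)%:R :> R by rewrite indicE.
    have -> : (M [set t | B (iota ((t : Cpath Z) r) y)] = \int[M]_x (\1_E x : R)%:E)%E.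
      by rewrite integral_indic // setIT.
    apply: ge0_le_integral => //.
    * exact: (measurable_fun_pair1 y mp).
    * by apply/measurable_EFinP; exact: measurable_indic.
    * move=> x _; rewrite /h SE EE lee_fin /=.
      have -> : ((x, y) \in S) = (x \in E) by apply/idP/idP; rewrite !inE.
      by case: (x \in E); rewrite ?mulr0 // mulr1 indicE; case: (_ \in _).
- have mgood : measurable (~` @good_curve R Z : set CZ).
    by apply: measurableC; exact: good_curve_measurable.
  have M0 : M (~` @good_curve R Z) = 0%E.
    have [B [mB MB sub]] := finite_plan_good FM.
    by apply: (@subset_measure0 _ _ _ M _ B).
  exists ((~` @good_curve R Z) `*` setT); split.
  + exact: measurableX.
  + rewrite MNE; transitivity (M (~` @good_curve R Z) * nu setT)%E.
      exact: product_measure1E.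
    by rewrite M0 mul0e.
  + move=> p /= np; split => //; apply: contra_not np => gp; left; exact: good_lift.
- have mw : measurable_fun setT (fun p : (CZ * borel Y) * T => speed (lift_curve p.1.1 p.1.2) p.2 ^+ 2 * (\1_A p.1.2 : R)%:E)%E.
    apply: emeasurable_funM; last by exact: (measurableT_comp m2E measurable_fst).
    apply: (measurableT_comp (@speed_sqr_measurable R V) (g := fun p : (CZ * borel Y) * T => (lift_curve p.1.1 p.1.2 : CV, p.2))).
    apply/measurable_fun_pairP; split; last exact: measurable_snd.
    exact: (measurableT_comp lift_measurable measurable_fst).
  have mE : measurable_fun setT (fun t : T => \int[M]_g (speed (g : Cpath Z) t ^+ 2))%E.
    apply: (@measurable_fun_fubini_tonelli_G _ _ CZ T R M _ (@speed_sqr_measurable R Z)).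
    by move=> p; rewrite sqre_ge0.
  apply: (@le_lt_trans _ _ (\int[leb01]_t ((n ^+ 2)%:E * nu A * \int[M]_g (speed (g : Cpath Z) t ^+ 2)))%E).
    have nuAf : nu A \is a fin_num by rewrite ge0_fin_numE.
    have nA0 : (0 <= (n ^+ 2)%:E * nu A)%E by rewrite mule_ge0 ?lee_fin ?sqr_ge0.
    have mS t : measurable_fun setT (fun g : CZ => speed (g : Cpath Z) t ^+ 2)%E.
      exact: (measurable_fun_pair1 (t : T) (@speed_sqr_measurable R Z)).
    apply: ge0_le_integral => //.
    + move=> t _; apply: integral_ge0 => p _; rewrite mule_ge0 ?sqre_ge0 //; exact: ind0E.
    + apply: (@measurable_fun_fubini_tonelli_G _ _ (CZ * borel Y)%type T R MN _ mw).
      move=> p; rewrite mule_ge0 ?sqre_ge0 //; exact: ind0E.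
    + rewrite -(fineK nuAf) -EFinM; exact: measurable_funeM.
    + move=> t _.
      have mwt : measurable_fun setT (fun p : CZ * borel Y => speed (lift_curve p.1 p.2) t ^+ 2 * (\1_A p.2 : R)%:E)%E.
        by apply: emeasurable_funM.
      rewrite MNE (@fubini_tonelli1 _ _ CZ (borel Y) R M nu _ mwt); last first.
        move=> x; rewrite mule_ge0 ?sqre_ge0 //; exact: ind0E.
      rewrite /fubini_F -(fineK nuAf) -EFinM.
      have e1 : (\int[M]_g ((n ^+ 2 * fine (nu A))%:E * speed (g : Cpath Z) t ^+ 2) =
          (n ^+ 2 * fine (nu A))%:E * \int[M]_g (speed (g : Cpath Z) t ^+ 2))%E.
        apply: ge0_integralZl_EFin; [exact: measurableT|by move=> g _; rewrite sqre_ge0|exact: mS|].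
        by rewrite mulr_ge0 ?sqr_ge0 // fine_ge0.
      rewrite -e1.
      apply: ge0_le_integral => //.
      * by move=> g _; apply: integral_ge0 => y _; rewrite mule_ge0 ?sqre_ge0 //; exact: ind0E.
      * apply: (@measurable_fun_fubini_tonelli_F _ _ CZ (borel Y) R nu _ mwt).
        by move=> x; rewrite mule_ge0 ?sqre_ge0 //; exact: ind0E.
      * by apply: measurable_funeM; exact: mS.
      * move=> g _.
        have xx0 : (0 <= (n ^+ 2)%:E * speed (g : Cpath Z) t ^+ 2)%E by rewrite mule_ge0 ?sqre_ge0 // lee_fin sqr_ge0.
        have mA1 : measurable_fun setT (fun y : borel Y => (\1_A y : R)%:E).
          by apply/measurable_EFinP; exact: measurable_indic.
        have e2 : (\int[nu]_y ((n ^+ 2)%:E * speed (g : Cpath Z) t ^+ 2 * (\1_A y : R)%:E) =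
            (n ^+ 2 * fine (nu A))%:E * speed (g : Cpath Z) t ^+ 2)%E.
          rewrite (@ge0_integralZl _ _ _ nu _ measurableT _ mA1 _ (fun y _ => ind0E y) xx0).
          have iA : (\int[nu]_x (\1_A x : R)%:E = (fine (nu A))%:E)%E by rewrite integral_indic // setIT fineK.
          by rewrite iA muleAC -EFinM.
        rewrite -[leRHS]e2.
        apply: ge0_le_integral => //.
        -- by move=> y _; rewrite mule_ge0 ?sqre_ge0 //; exact: ind0E.
        -- exact: (measurable_fun_pair2 g mwt).
        -- exact: emeasurable_funM (measurable_cst _) mA1.
        -- move=> y _; rewrite indicE; case: (boolP (y \in A)) => yA; last by rewrite mulr0n !mule0.
           rewrite mulr1n !mule1; apply: le_trans (speed_sqr_lift g y t) _.
           apply: lee_wpmul2r; first by rewrite sqre_ge0.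
           have n0 : 0 <= n by apply: le_trans (c0 y) (cA y (set_mem yA)).
           rewrite lee_fin ler_sqr ?nnegrE //; exact: cA (set_mem yA).
  rewrite ge0_integralZl //; last 2 first.
  - by move=> t _; apply: integral_ge0 => g _; rewrite sqre_ge0.
  - by rewrite mule_ge0 ?lee_fin ?sqr_ge0.
  rewrite lte_mul_pinfty //; first by rewrite mule_ge0 ?lee_fin ?sqr_ge0.
  by rewrite fin_numM // ge0_fin_numE.
Qed.

End lifted_plans.
End lifted_curves.

(** * Almost every section is Sobolev *)

Section sections.
Context (R : realType) (Z Y V : pmetricType R).
Variables (BY : nat -> set Y) (BZ : nat -> set Z).
Hypothesis bY : countable_base BY.
Hypothesis bZ : countable_base BZ.
Variables (iota : Z -> Y -> V) (c : Y -> R) (kappa : Z -> R).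
Hypothesis c0 : forall y, 0 <= c y.
Hypothesis kappa0 : forall z, 0 <= kappa z.
Hypothesis c_cont : continuous c.
Hypothesis kappa_cont : continuous kappa.
Hypothesis iota_le : forall z y z' y',
  mdist (iota z y) (iota z' y') <= c y' * mdist z z' + kappa z * mdist y y'.
Variables (mu : {sigma_finite_measure set (borel Z) -> \bar R}).
Variables (nu : {sigma_finite_measure set (borel Y) -> \bar R}).
Variables (muV : {measure set (borel V) -> \bar R}).
Hypothesis muVE : forall A : set (borel V), measurable A ->
  muV A = (\int[nu]_y mu [set z | A (iota z y)])%E.
Variables (f G : borel V -> R).
Hypothesis mf : measurable_fun setT f.
Hypothesis wG : weak_upper_gradient muV f G.
Hypothesis f_int : (\int[nu]_y sqint mu (fun z => f (iota z y))%R < +oo)%E.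
Hypothesis G_int : (\int[nu]_y sqint mu (fun z => G (iota z y))%R < +oo)%E.
Let T := borel (unit_itv R).
Let CZ := borel (Cpath Z).
Let CV := borel (Cpath V).
Local Notation lift := (lift_curve c0 kappa0 iota_le).
Implicit Types (M : {finite_measure set (borel (Cpath Z)) -> \bar R}).

Let G0 : forall x, 0 <= G x. Proof. by case: wG. Qed.
Let mG : measurable_fun setT G. Proof. by case: wG => _ []. Qed.

Let miota := iota_measurable bY c0 kappa0 c_cont iota_le.
Let mlift := lift_measurable bY c0 kappa0 c_cont kappa_cont iota_le.
Let mc : measurable_fun setT (c : borel Y -> R). Proof. exact: continuous_borel_real. Qed.

Lemma measurable_section (h : borel V -> R) (y : Y) : measurable_fun setT h ->
  measurable_fun setT (fun z : borel Z => h (iota z y)).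
Proof. by move=> mh; exact: (measurableT_comp mh (measurable_fun_pair1 (y : borel Y) miota)). Qed.

Lemma measurable_sqint_section (h : borel V -> R) : measurable_fun setT h ->
  measurable_fun setT (fun y : borel Y => sqint mu (fun z => h (iota z y))).
Proof.
move=> mh.
have m2 : measurable_fun setT (fun p : borel Z * borel Y => (h (iota p.1 p.2) ^+ 2)%:E).
  by apply/measurable_EFinP; apply: measurable_funX; exact: (measurableT_comp mh miota).
apply: (@measurable_fun_fubini_tonelli_G _ _ (borel Z) (borel Y) R mu _ m2).
by move=> p; rewrite lee_fin sqr_ge0.
Qed.

Let osc_at M (y : borel Y) := plan_osc M (fun z => f (iota z y)).
Let cost_at M (y : borel Y) := plan_cost M (fun z => c y * G (iota z y)).

Let osc_joint (p : CZ * borel Y) : \bar R := `|f (lift p.1 p.2 i1) - f (lift p.1 p.2 i0)|%:E.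
Let cost_joint (p : CZ * borel Y) : \bar R :=
  (\int[leb01]_s ((c p.2 * G (lift p.1 p.2 s))%:E * speed (p.1 : Cpath Z) s))%E.

Let osc_joint0 p : (0 <= osc_joint p)%E. Proof. by rewrite lee_fin. Qed.

Let cost_joint0 p : (0 <= cost_joint p)%E.
Proof. by apply: integral_ge0 => s _; rewrite mule_ge0 ?speed_ge0 // lee_fin mulr_ge0. Qed.

Let mosc_joint : measurable_fun setT osc_joint.
Proof. exact: (measurableT_comp (measurable_osc mf) mlift). Qed.

Let mcost_joint : measurable_fun setT cost_joint.
Proof.
apply: (@measurable_fun_integral_section _ _ (CZ * borel Y)%type T R (@leb01 R) setT
  (fun q => (c q.1.2 * G (lift q.1.1 q.1.2 q.2))%:E * speed (q.1.1 : Cpath Z) q.2)%E) => //; last first.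
  by move=> q; rewrite mule_ge0 ?speed_ge0 // lee_fin mulr_ge0.
have m1 : measurable_fun setT (fun q : (CZ * borel Y) * T => (lift q.1.1 q.1.2 : CV, q.2)).
  apply/measurable_fun_pairP; split; last exact: measurable_snd.
  exact: (measurableT_comp mlift measurable_fst).
have m2 : measurable_fun setT (fun q : (CZ * borel Y) * T => (q.1.1, q.2)).
  apply/measurable_fun_pairP; split; last exact: measurable_snd.
  exact: (measurableT_comp measurable_fst measurable_fst).
have m3 : measurable_fun setT (fun q : (CZ * borel Y) * T => c q.1.2).
  exact: (measurableT_comp mc (measurableT_comp measurable_snd measurable_fst)).
apply: emeasurable_funM; last exact: (measurableT_comp (@speed_measurable R Z) m2).
apply/measurable_EFinP; apply: measurable_funM; first exact: m3.
exact: (measurableT_comp (measurable_joint_fun mG) m1).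
Qed.

Lemma measurable_osc_at M : measurable_fun setT (osc_at M).
Proof. exact: (@measurable_fun_fubini_tonelli_G _ _ CZ (borel Y) R M _ mosc_joint). Qed.

Let measurable_cost_at M : measurable_fun setT (cost_at M).
Proof. exact: (@measurable_fun_fubini_tonelli_G _ _ CZ (borel Y) R M _ mcost_joint). Qed.

Let slice M (h : CZ * borel Y -> \bar R) (A : set (borel Y)) : measurable A ->
  measurable_fun setT h -> (forall p, (0 <= h p)%E) ->
  (\int[M \x nu]_p (h p * (\1_A p.2 : R)%:E) = \int[nu]_(y in A) \int[M]_g h (g, y))%E.
Proof.
move=> mA mh h0.
have m1 : measurable_fun setT (fun p : CZ * borel Y => h p * (\1_A p.2 : R)%:E)%E.
  apply: emeasurable_funM => //; apply/measurable_EFinP.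
  by apply: (measurableT_comp (f := fun y : borel Y => \1_A y : R)); [exact: measurable_indic|exact: measurable_snd].
rewrite (@fubini_tonelli2 _ _ CZ (borel Y) R M nu _ m1); last first.
  by move=> p; rewrite mule_ge0 // lee_fin.
rewrite [RHS]integral_mkcond; apply: eq_integral => y _; rewrite patchE /fubini_G /=.
have AE : \1_A y = (y \in A)%:R :> R by rewrite indicE.
rewrite AE; case: (y \in A); first by apply: eq_integral => g _; rewrite mule1.
by rewrite integral0_eq // => g _; rewrite mule0.
Qed.

Let cost_lift_le (p : CZ * borel Y) :
  (\int[leb01]_s ((G (lift p.1 p.2 s))%:E * speed (lift p.1 p.2) s) <= cost_joint p)%E.
Proof.
case: p => g y; rewrite /cost_joint /=; apply: ge0_le_integral => //.
- by move=> s _; rewrite mule_ge0 ?speed_ge0 ?lee_fin.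
- exact: (measurable_cost_section (lift g y) mG).
- have mcG : measurable_fun setT (fun z : borel Z => c y * G (iota z y)).
    by apply: measurable_funM => //; exact: measurable_section.
  exact: (measurable_cost_section g mcG).
- move=> s _; rewrite mulrC EFinM -muleA; apply: lee_wpmul2l; first by rewrite lee_fin.
  exact: speed_lift.
Qed.

Lemma section_osc_cost M : finite_plan mu M ->
  {ae nu, forall y, (plan_osc M (fun z => f (iota z y)) <= plan_cost M (fun z => (c y * G (iota z y))%R))%E}.
Proof.
move=> FM; have [k Mk] := finite_plan_bound FM.
have [F FT Ffin] := sigma_finiteT nu.
have mGi := measurable_sqint_section mG.
(* Finite measure and c <= n are what [lifted_plan] asks for; the bound on the norm of G makes the
   cost integrable over y, as [ae_le_of_integral_le] asks. These sets cover almost every y. *)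
pose E i n : set (borel Y) := F i `&` [set y | c y <= n%:R] `&` [set y | (sqint mu (fun z => G (iota z y)) <= (n%:R)%:E)%E].
have mE i n : measurable (E i n).
  apply: measurableI; last by apply: measurable_leeT.
  apply: measurableI; first by have [] := Ffin i.
  have -> : [set y : borel Y | c y <= n%:R] = [set y | ((c y)%:E <= (n%:R)%:E)%E].
    by apply/seteqP; split => y /=; rewrite lee_fin.
  by apply: measurable_leeT => //; exact/measurable_EFinP.
have Efin i n : (nu (E i n) < +oo)%E.
  have [mFi Fi] := Ffin i; apply: le_lt_trans Fi; apply: le_measure; rewrite ?inE //.
  by move=> y [[]].
have Gfin : {ae nu, forall y, (sqint mu (fun z => G (iota z y)) < +oo)%E}.
  have int : (nu : set (borel Y) -> \bar R).-integrable setT (fun y => sqint mu (fun z => G (iota z y))).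
    apply/integrableP; split => //; under eq_integral do rewrite gee0_abs ?sqint_ge0 //.
    exact: G_int.
  apply: (ae_imp _ (integrable_ae measurableT int)) => y /(_ Logic.I).
  by rewrite ge0_fin_numE // sqint_ge0.
suff h i n : {ae nu, forall y, E i n y -> (osc_at M y <= cost_at M y)%E}.
  have h' : {ae nu, forall y, forall i n, E i n y -> (osc_at M y <= cost_at M y)%E}.
    by apply/ae_foralln => i; apply/ae_foralln => n; exact: h.
  apply: (ae_imp2 _ h' Gfin) => y hy Gy.
  have [i _ Fi] : (\bigcup_i F i) y by rewrite -FT.
  have sf : sqint mu (fun z => G (iota z y)) \is a fin_num by rewrite ge0_fin_numE ?sqint_ge0.
  pose n := (Num.truncn (c y) + Num.truncn (fine (sqint mu (fun z => G (iota z y))))).+1.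
  apply: (hy i n); split; first split => //=.
    by rewrite ltW // (lt_le_trans (truncnS_gt _)) // ler_nat ltnS leq_addr.
  rewrite /= -(fineK sf) lee_fin ltW // (lt_le_trans (truncnS_gt _)) // ler_nat ltnS leq_addl //.
have [mFi _] := Ffin i.
have m1 : measurable_fun setT (fun y : borel Y => (\1_(E i n) y : R)%:E).
  by apply/measurable_EFinP; exact: measurable_indic.
have i0E y : (0 <= (\1_(E i n) y : R)%:E)%E by rewrite lee_fin.
have osc0 y : (0 <= osc_at M y)%E by apply: integral_ge0 => g _; rewrite lee_fin.
have cG0 (y : Y) z : 0 <= c y * G (iota z y) by rewrite mulr_ge0.
have cost0 y : (0 <= cost_at M y)%E by apply: plan_cost_ge0 => z; exact: cG0.
have EE y : \1_(E i n) y = (y \in E i n)%:R :> R by rewrite indicE.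
have restr (u : borel Y -> \bar R) (A : set (borel Y)) :
    (\int[nu]_(y in A) (u y * (\1_(E i n) y : R)%:E) = \int[nu]_(y in A `&` E i n) u y)%E.
  rewrite [RHS]integral_mkcondr; apply: eq_integral => y _; rewrite patchE EE.
  by case: (y \in E i n); rewrite ?mule1 ?mule0.
suff : {ae nu, forall y, (osc_at M y * (\1_(E i n) y : R)%:E <= cost_at M y * (\1_(E i n) y : R)%:E)%E}.
  apply: ae_imp => y + Ey; rewrite EE mem_set //= !mule1; exact.
apply: ae_le_of_integral_le.
- exact: (emeasurable_funM (measurable_osc_at M) m1).
- exact: (emeasurable_funM (measurable_cost_at M) m1).
- by move=> y; rewrite mule_ge0.
- by move=> y; rewrite mule_ge0.
- rewrite restr setTI.
  (* The bound of [plan_cost_le] with l = 1 on [E i n], where the squared norm of c y * G (iota _ y)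
     is at most n^2 * n. *)
  pose K : R := 1 / 2 * k.+1%:R * (n%:R ^+ 2 * n%:R) + (2 * 1)^-1 * k.+1%:R.
  apply: (@le_lt_trans _ _ (\int[nu]_(y in E i n) (cst K%:E y))%E); last first.
    have iK : (\int[nu]_(y in E i n) cst K%:E y = K%:E * nu (E i n))%E by exact: integral_cst.
    by rewrite iK lte_mul_pinfty // lee_fin /K addr_ge0 // ?mulr_ge0 ?divr_ge0 ?invr_ge0 ?mulr_ge0 ?exprn_ge0.
  apply: ge0_le_integral => //.
  + exact: measurable_funTS.
  + move=> y [[_ cn] sn].
    have mcG : measurable_fun setT (fun z : borel Z => c y * G (iota z y)).
      by apply: measurable_funM => //; exact: measurable_section.
    apply: le_trans (plan_cost_le Mk ltr01 mcG (cG0 y)) _.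
    rewrite /cst /K EFinD; apply: leeD; last exact: lexx.
    rewrite [X in (_ <= X)%E]EFinM; apply: lee_wpmul2l; first by rewrite lee_fin mulr_ge0.
    have -> : sqint mu (fun z => c y * G (iota z y)) = ((c y ^+ 2)%:E * sqint mu (fun z => G (iota z y)))%E.
      rewrite /sqint -ge0_integralZl_EFin ?sqr_ge0 //; last 2 first.
      - by move=> z _; rewrite lee_fin sqr_ge0.
      - by apply: measurable_sqr; exact: measurable_section.
      by apply: eq_integral => z _; rewrite exprMn EFinM.
    rewrite [X in (_ <= X)%E]EFinM; apply: lee_pmul => //; rewrite ?sqint_ge0 ?lee_fin ?sqr_ge0 //.
    by rewrite ler_sqr ?nnegrE.
move=> A mA; rewrite !restr.
have mAE : measurable (A `&` E i n) by exact: measurableI.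
have AEfin : (nu (A `&` E i n) < +oo)%E.
  by apply: le_lt_trans (Efin i n); apply: le_measure; rewrite ?inE // => y [].
have cAE y : (A `&` E i n) y -> c y <= n%:R by move=> [_ [[]]].
have [N [FN iN]] := lifted_plan bY c0 kappa0 c_cont kappa_cont iota_le muVE FM mAE AEfin cAE.
pose cl (p : CZ * borel Y) : \bar R :=
  (\int[leb01]_s ((G (lift p.1 p.2 s))%:E * speed (lift p.1 p.2) s))%E.
have mcl : measurable_fun setT cl.
  exact: (measurableT_comp (measurable_int_cost measurableT mG G0) mlift).
have cl0 p : (0 <= cl p)%E by exact: (int_cost_ge0 (lift p.1 p.2) setT G0).
have e1 : plan_osc N f = (\int[nu]_(y in A `&` E i n) osc_at M y)%E.
  rewrite /plan_osc iN; [|exact: measurable_osc|by []].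
  exact: (slice M mAE mosc_joint osc_joint0).
have e2 : plan_cost N G = (\int[nu]_(y in A `&` E i n) \int[M]_g cl (g, y))%E.
  rewrite /plan_cost iN; [|exact: measurable_int_cost|by move=> u; exact: int_cost_ge0].
  exact: (slice M mAE mcl cl0).
have := finite_plan_wug wG mf FN; rewrite e1 e2 => le1.
apply: (le_trans le1).
apply: (@ge0_le_integral _ _ _ nu (A `&` E i n) mAE).
- by move=> y _; apply: integral_ge0 => g _; exact: cl0.
- apply: measurable_funTS.
  exact: (@measurable_fun_fubini_tonelli_G _ _ CZ (borel Y) R M _ mcl cl0).
- by apply: measurable_funTS; exact: measurable_cost_at.
- move=> y _; apply: (@ge0_le_integral _ _ _ M setT measurableT (fun g => cl (g, y)) (fun g => cost_joint (g, y))).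
  + by move=> g _; exact: cl0.
  + exact: (measurable_fun_pair1 y mcl).
  + exact: (measurable_fun_pair1 y mcost_joint).
  + by move=> g _; exact: (cost_lift_le (g, y)).
Qed.

Lemma sections_sobolev : exists D : borel Y * borel Z -> R,
  [/\ measurable_fun setT D, forall p, 0 <= D p &
    {ae nu, forall y, [/\ W12 mu (fun z => f (iota z y)),
      minimal_weak_upper_gradient mu (fun z => f (iota z y)) (fun z => D (y, z)) &
      {ae mu, forall z, D (y, z) <= c y * G (iota z y)}]}].
Proof.
have [W [mW Wfin Wapprox]] := finite_measure_approx (countable_base_borel bZ) mu.
have [M [FM HM]] := countable_plans mW Wfin Wapprox.
(* A number that codes no list gives the empty list, that is, the zero function. *)
pose h i := simple_of R W (odflt [::] (unpickle i : option (seq (rat * nat)))).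
have hE s : h (pickle s) = simple_of R W s by rewrite /h pickleK.
have h_nn i : nnL2 mu (h i).
  by split; [exact: measurable_simple_of|exact: simple_of_ge0|exact: sqint_simple_of_lty].
have h_dense u : nnL2 mu u -> forall e : R, 0 < e -> exists i, (sqint mu (fun z => u z - h i z)%R < e%:E)%E.
  move=> [mu' u0 u2] e e0; have [s hs] := simple_dense mW Wapprox mu' u0 u2 e0.
  by exists (pickle s); rewrite hE.
have h_avg i j : exists k, h k = (fun z => (h i z + h j z) / 2).
  pose s := odflt [::] (unpickle i : option (seq (rat * nat))).
  pose s' := odflt [::] (unpickle j : option (seq (rat * nat))).
  exists (pickle (halve (s ++ s'))); rewrite hE; apply/funext => z.
  by rewrite simple_of_halve simple_of_cat.
have B_avg k u v a : nnL2 mu u -> nnL2 mu v -> (a <= plan_cost (M k) u)%E -> (a <= plan_cost (M k) v)%E ->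
    (a <= plan_cost (M k) (fun z => (u z + v z) / 2)%R)%E.
  exact: plan_cost_avg.
have B_cont k (e : R) : 0 < e -> exists dl : R, 0 < dl /\
    forall u v, nnL2 mu u -> nnL2 mu v -> (sqint mu (fun z => u z - v z)%R < dl%:E)%E ->
      (plan_cost (M k) u <= plan_cost (M k) v + e%:E)%E.
  move=> e0; have [n Mn] := finite_plan_bound (FM k).
  have n0 : 0 < n.+1%:R :> R by [].
  have [dl [dl0 H]] := @plan_cost_cont R Z mu n.+1%:R n.+1%:R n0 n0 e e0.
  by exists dl; split => // u v; exact: H.
have ma k : measurable_fun setT (osc_at (M k)) by exact: measurable_osc_at.
(* The k-th constraint is the inequality of the plan [M k]. For almost every y the section of f is
   square integrable, and then the admissible functions are exactly its weak upper gradients. *)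
have [D [mD D0 HD]] := @minimal_selection _ _ R mu _ (borel Y) h (fun k => plan_cost (M k)) (fun k => osc_at (M k))
  h_nn h_dense h_avg B_avg B_cont ma.
have finite_ae (u : borel V -> R) : measurable_fun setT u ->
    (\int[nu]_y sqint mu (fun z => u (iota z y))%R < +oo)%E ->
    {ae nu, forall y, (sqint mu (fun z => u (iota z y)) < +oo)%E}.
  move=> mu' ufin; have mui := measurable_sqint_section mu'.
  have int : (nu : set (borel Y) -> \bar R).-integrable setT (fun y => sqint mu (fun z => u (iota z y))).
    by apply/integrableP; split => //; under eq_integral do rewrite gee0_abs ?sqint_ge0 //.
  apply: (ae_imp _ (integrable_ae measurableT int)) => y /(_ Logic.I).
  by rewrite ge0_fin_numE // sqint_ge0.
exists D; split => //.
have plans : {ae nu, forall y, forall k, (osc_at (M k) y <= cost_at (M k) y)%E}.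
  by apply/ae_foralln => k; exact: section_osc_cost.
apply: (ae_imp2 _ plans (ae_and (finite_ae f mf f_int) (finite_ae G mG G_int))) => y pl [f2 G2].
have mfy : measurable_fun setT (fun z : borel Z => f (iota z y)) by exact: measurable_section.
have mGy : measurable_fun setT (fun z : borel Z => c y * G (iota z y)).
  by apply: measurable_funM => //; exact: measurable_section.
have cG0 z : 0 <= c y * G (iota z y) by rewrite mulr_ge0.
have cG2 : (sqint mu (fun z => c y * G (iota z y))%R < +oo)%E.
  have -> : sqint mu (fun z => c y * G (iota z y)) = ((c y ^+ 2)%:E * sqint mu (fun z => G (iota z y)))%E.
    rewrite /sqint -ge0_integralZl_EFin ?sqr_ge0 //; last 2 first.
    - by move=> z _; rewrite lee_fin sqr_ge0.
    - by apply: measurable_sqr; exact: measurable_section.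
    by apply: eq_integral => z _; rewrite exprMn EFinM.
  by rewrite lte_mul_pinfty // ?lee_fin ?sqr_ge0.
have wug_of_adm u : admissible mu (fun k => plan_cost (M k)) (fun k => osc_at (M k)) y u ->
    weak_upper_gradient mu (fun z => f (iota z y)) u.
  move=> [nu2 osc_le]; have [mu' u0 u2] := nu2; split => // P tP.
  exact: (HM _ _ mfy f2 nu2 osc_le P tP).
have adm_of_wug u : weak_upper_gradient mu (fun z => f (iota z y)) u ->
    admissible mu (fun k => plan_cost (M k)) (fun k => osc_at (M k)) y u.
  move=> wu; have [u0 [mu' u2] _] := wu; split; first by split.
  by move=> k; exact: (finite_plan_wug wu mfy (FM k)).
have admG : admissible mu (fun k => plan_cost (M k)) (fun k => osc_at (M k)) y (fun z => c y * G (iota z y)).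
  by split; [split|exact: pl].
have [admD minD] := HD y (ex_intro _ _ admG).
have min_wug : minimal_weak_upper_gradient mu (fun z => f (iota z y)) (fun z => D (y, z)).
  apply: minimal_wug_of_min_norm => //; first exact: wug_of_adm.
  by move=> u /adm_of_wug; exact: minD.
split => //.
- split; split => //; by exists (fun z => D (y, z)); case: min_wug.
- exact: (proj2 min_wug (fun z => c y * G (iota z y)) (wug_of_adm _ admG)).
Qed.

End sections.

(** * Distances in the warped product *)

Section lipschitz_curves.
Context (R : realType) (Z : pmetricType R).
Variables (g : unit_itv R -> Z) (L : R).
Hypothesis L0 : 0 <= L.
Hypothesis gL : forall s t, unit_le s t -> mdist (g s) (g t) <= L * (set_val t - set_val s).

Let gL' s t : mdist (g s) (g t) <= L * `|set_val t - set_val s|.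
Proof.
have [st|ts] := unit_le_total s t.
  by rewrite ger0_norm ?subr_ge0 //; exact: gL.
by rewrite metric_sym distrC ger0_norm ?subr_ge0 //; exact: gL.
Qed.

Lemma speed_lipschitz t : (speed g t <= L%:E)%E.
Proof.
rewrite leNgt; apply/negP => lt; have [q [Lq qg]] := rat_between lt.
have : (speed g t < speed g t)%E.
  apply/speed_lt; exists q; split => //; exists 0%N => s _.
  by apply: le_trans (gL' t s) _; rewrite ler_wpM2r.
by rewrite ltxx.
Qed.

Lemma abs_cont_lipschitz : abs_cont 1 g.
Proof.
exists (cst L); split => //.
- rewrite (_ : (\int[leb01]_t _) = L%:E)%E ?ltry //.
  under eq_integral do rewrite expr1.
  have -> : (\int[leb01]_(t in [set: borel (unit_itv R)]) (cst L t)%:E = L%:E * leb01 [set: borel (unit_itv R)])%E.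
    exact: (integral_cst (@leb01 R) measurableT L%:E).
  by rewrite [X in (_ * X)%E](@leb01T R) mule1.
- move=> s t st; rewrite (_ : (\int[leb01]_(r in _) _) = (L * (set_val t - set_val s))%:E)%E.
    by rewrite lee_fin; exact: gL.
  exact: integral_seg_cst.
Qed.

End lipschitz_curves.

(** * Lipschitz reparametrisation of curves of finite length *)

Section arclength_parametrization.
Context (R : realType) (Z : pmetricType R).
Variables (g : unit_itv R -> Z) (L : R).
Hypothesis gc : continuous g.
Hypothesis L0 : 0 < L.
Hypothesis gL : (curve_length g <= L%:E)%E.
Implicit Types s t u : unit_itv R.

(** Infinite monotone sequences of which only the first terms count, as in [curve_length], with the
    additional bound t. So [var t] is the length of g up to time t. *)
Let chain (t : unit_itv R) (n : nat) (tau : nat -> unit_itv R) :=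
  (forall k, unit_le (tau k) (tau k.+1)) /\ forall k, unit_le (tau k) t.

Let csum n (tau : nat -> unit_itv R) : R := \sum_(k < n) mdist (g (tau k)) (g (tau k.+1)).

Let sums t := [set l | exists n tau, chain t n tau /\ l = csum n tau].

Let var t : R := sup (sums t).

Let csum_le n tau : (forall k, unit_le (tau k) (tau k.+1)) -> csum n tau <= L.
Proof.
move=> mtau; rewrite -lee_fin; apply: le_trans gL; apply: ereal_sup_ubound.
by exists n, tau.
Qed.

Let sums_has_sup t : has_sup (sums t).
Proof.
split.
  exists (csum 0 (fun=> t)), 0%N, (fun=> t); split => //.
  by split => k; rewrite /unit_le lexx.
by exists L => _ [n [tau [[m1 _] ->]]]; exact: csum_le.
Qed.

Let var_le t : var t <= L.
Proof.
apply: ge_sup; first by have [] := sums_has_sup t.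
by move=> _ [n [tau [[m1 _] ->]]]; exact: csum_le.
Qed.

Let var_ge0 t : 0 <= var t.
Proof.
have -> : (0 : R) = csum 0 (fun=> t) by rewrite /csum big_ord0.
apply: (ub_le_sup (proj2 (sums_has_sup t))).
exists 0%N, (fun=> t); split => //.
by split => k; rewrite /unit_le lexx.
Qed.

Let var_diff s t : unit_le s t -> mdist (g s) (g t) <= var t - var s.
Proof.
move=> st; rewrite lerBrDr addrC -lerBrDr; apply: ge_sup; first by have [] := sums_has_sup s.
move=> _ [n [tau [[m1 m2] ->]]]; rewrite lerBrDr.
(* The chain up to s is continued by s and then t, where it stays; this adds the distance from g s
   to g t to its sum. *)
pose tau' k := if (k <= n)%N then tau k else if k == n.+1 then s else t.
have mt : chain t n.+2 tau'.
  split => k; rewrite /tau'.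
    have [kn|kn|->] := ltngtP k n.
    - exact: m1.
    - by rewrite eqSS (gtn_eqF kn); case: ifP => _; rewrite /unit_le ?lexx.
    - by rewrite eqxx; exact: m2.
  case: ifP => _; first exact: le_trans (m2 k) st.
  by case: ifP => // _; rewrite /unit_le lexx.
have e : csum n.+2 tau' = csum n tau + mdist (g (tau n)) (g s) + mdist (g s) (g t).
  rewrite /csum !big_ord_recr /=; congr (_ + _ + _).
  - by apply: eq_bigr => k _; rewrite /tau' ltnW ?ltn_ord // ltn_ord.
  - by rewrite /tau' leqnn ltnn eqxx.
  - by rewrite /tau' ltnn eqxx leqNgt ltnS leqnSn /= eqSS gtn_eqF.
apply: (@le_trans _ _ (csum n.+2 tau')); last first.
  by apply: (ub_le_sup (proj2 (sums_has_sup t))); exists n.+2, tau'.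
by rewrite e lerD2r lerDl mdist_ge0.
Qed.

Let var_mono s t : unit_le s t -> var s <= var t.
Proof. by move=> st; rewrite -subr_ge0; apply: le_trans (var_diff st); exact: mdist_ge0. Qed.

Let unit_le_i0 t : unit_le t i0 -> t = i0.
Proof.
rewrite /unit_le => h; apply: itv_val_inj; apply/eqP; rewrite eq_le h /=.
exact: unit_ge0.
Qed.

Let var0 : var i0 = 0.
Proof.
apply/eqP; rewrite eq_le var_ge0 andbT; apply: ge_sup; first by have [] := sums_has_sup i0.
move=> _ [n [tau [[_ m2] ->]]]; rewrite /csum big1 // => k _.
by rewrite (unit_le_i0 (m2 k)) (unit_le_i0 (m2 k.+1)) mdistxx.
Qed.

Let near_g t (e : R) : 0 < e -> exists dl : R, 0 < dl /\
  forall u, `|set_val t - set_val u| < dl -> mdist (g t) (g u) < e.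
Proof.
move=> e0; have h : nbhs (g t) (ball (g t) e) by exact: nbhsx_ballx.
have /nbhs_ballP[dl /= dl0 H] := gc h.
exists dl; split => // u tu; have : ball (g t) e (g u) by apply: H.
by rewrite ballEmdist.
Qed.

(* The generalized inverse of the variation [var], rescaled to the unit interval. *)
Let low s : set R := [set r | 0 <= r <= 1 /\ var (clip r) <= set_val s * L].

Let low0 s : low s 0.
Proof.
split; first by rewrite lexx ler01.
have -> : clip 0 = i0 :> unit_itv R by apply: itv_val_inj; rewrite clipE // lexx ler01.
by rewrite var0 mulr_ge0 ?unit_ge0 // ltW.
Qed.

Let low_has_sup s : has_sup (low s).
Proof. by split; [exists 0; exact: low0|exists 1 => r [/andP[]]]. Qed.

Let b s : R := sup (low s).

Let b01 s : 0 <= b s <= 1.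
Proof.
apply/andP; split; first exact: (ub_le_sup (proj2 (low_has_sup s)) (low0 s)).
by apply: ge_sup; [exact: (proj1 (low_has_sup s))|move=> r [/andP[]]].
Qed.

Let a s : unit_itv R := clip (b s).

Let aE s : set_val (a s) = b s :> R. Proof. by rewrite clipE. Qed.

Let above s u : b s < set_val u -> set_val s * L < var u.
Proof.
move=> bu; rewrite ltNge; apply/negP => h.
have : low s (set_val u) by split; [rewrite unit_ge0 unit_le1|rewrite clipK].
by move=> /(ub_le_sup (proj2 (low_has_sup s))); rewrite leNgt bu.
Qed.

Let below s (e : R) : 0 < e -> exists t, [/\ var t <= set_val s * L, b s - e < set_val t & set_val t <= b s].
Proof.
move=> e0; have [r lr br] := sup_adherent e0 (low_has_sup s).
have [r01 vr] := lr; exists (clip r); rewrite clipE //; split => //.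
exact: (ub_le_sup (proj2 (low_has_sup s)) lr).
Qed.

Let b_mono s s' : unit_le s s' -> b s <= b s'.
Proof.
move=> ss; apply: ge_sup; first exact: (proj1 (low_has_sup s)).
move=> r [r01 vr]; apply: (ub_le_sup (proj2 (low_has_sup s'))); split => //.
by apply: le_trans vr _; rewrite ler_pM2r.
Qed.

Let gap_aux (m x y z e : R) : e = (m - z) / 2 -> m <= x + (z + y) -> x < e -> y < e -> z < m -> False.
Proof. by move=> -> *; lra. Qed.

(** No continuity of the variation enters. Just to the right of b s it exceeds s L, and arbitrarily
    close to b s' on the left it is at most s' L; between two such times u and t, [var_diff] bounds
    the distance by L (s' - s). Continuity of g moves u and t to the ends. *)
Let a_lip s s' : unit_le s s' -> mdist (g (a s)) (g (a s')) <= L * (set_val s' - set_val s).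
Proof.
move=> ss; have := b_mono ss; rewrite le_eqVlt => /orP[/eqP bb|bb].
  by rewrite /a bb mdistxx mulr_ge0 ?subr_ge0 // ltW.
rewrite leNgt; apply/negP => h.
(* Half of the supposed excess, for an error of e at each of the two ends. *)
pose e := (mdist (g (a s)) (g (a s')) - L * (set_val s' - set_val s)) / 2.
have e0 : 0 < e by rewrite divr_gt0 // subr_gt0.
have [d1 [d10 H1]] := near_g (a s) e0; have [d2 [d20 H2]] := near_g (a s') e0.
have mid0 : 0 < (b s' - b s) / 2 by rewrite divr_gt0 // subr_gt0.
(* Strictly to the right of b s, within the radius d1, and at most at the midpoint of b s and b s';
   t is taken beyond the midpoint, so that u <= t. *)
pose x := b s + Num.min d1 ((b s' - b s) / 2) / 2.
have mm0 : 0 < Num.min d1 ((b s' - b s) / 2) by rewrite lt_min d10 mid0.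
have md1 : Num.min d1 ((b s' - b s) / 2) <= d1 by rewrite ge_min lexx.
have mm2 : Num.min d1 ((b s' - b s) / 2) <= (b s' - b s) / 2 by rewrite ge_min lexx orbT.
have mm20 : 0 < Num.min d2 ((b s' - b s) / 2) by rewrite lt_min d20 mid0.
have [t [vt bt tb]] := @below s' _ mm20.
have := bt; rewrite ltrBlDr => bt'.
have t1 : b s' < set_val t + d2 by apply: lt_le_trans bt' _; rewrite lerD2l ge_min lexx.
have t2 : b s' < set_val t + (b s' - b s) / 2 by apply: lt_le_trans bt' _; rewrite lerD2l ge_min lexx orbT.
have /andP[bs0 bs1] := b01 s; have /andP[bs'0 bs'1] := b01 s'.
have x01 : 0 <= x <= 1 by apply/andP; split; rewrite /x; move: (Num.min _ _) mm0 md1 mm2 => mn *; lra.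
pose u : unit_itv R := clip x.
have uE : set_val u = x :> R by rewrite clipE.
have bu : b s < set_val u by rewrite uE /x ltrDl divr_gt0.
have ut : unit_le u t.
  rewrite /unit_le uE /x; move: (Num.min _ _) mm0 md1 mm2 (set_val t : R) t2 => mn ? ? ? tt *; lra.
have h1 : mdist (g (a s)) (g u) < e.
  apply: H1; rewrite aE uE distrC /x addrAC subrr add0r gtr0_norm ?divr_gt0 //.
  move: (Num.min _ _) mm0 md1 => mn *; lra.
have h2 : mdist (g (a s')) (g t) < e.
  by apply: H2; rewrite aE ger0_norm ?subr_ge0 // ltrBlDr addrC.
have h3 : mdist (g u) (g t) <= L * (set_val s' - set_val s).
  apply: le_trans (var_diff ut) _; rewrite mulrBr ![L * _]mulrC; apply: lerB => //.
  by rewrite ltW // above.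
have h4 : mdist (g (a s)) (g (a s')) <= mdist (g (a s)) (g u) + (L * (set_val s' - set_val s) + mdist (g (a s')) (g t)).
  apply: le_trans (metric_triangle _ (g u) _) _; rewrite lerD2l.
  apply: le_trans (metric_triangle _ (g t) _) _; rewrite (metric_sym (g t)).
  by apply: lerD.
exact: (gap_aux (erefl e) h4 h1 h2 h).
Qed.

Lemma arclength_parametrization : exists eta : unit_itv R -> Z,
  [/\ eta i0 = g i0, eta i1 = g i1 &
    forall s t, unit_le s t -> mdist (eta s) (eta t) <= L * (set_val t - set_val s)].
Proof.
exists (fun s => g (a s)); split; last exact: a_lip.
(* [a i0] is not i0 if g stands still at first. It is the supremum of the times of variation 0, and
   continuity of g gives the same value there. *)
- apply/esym/mdist_positivity/eqP; rewrite eq_le mdist_ge0 andbT leNgt; apply/negP => h.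
  have [dl [dl0 H]] := near_g (a i0) h.
  have [t [vt bt tb]] := below i0 dl0.
  have h1 : mdist (g (a i0)) (g t) < mdist (g i0) (g (a i0)).
    by apply: H; rewrite aE ger0_norm ?subr_ge0 // ltrBlDr -ltrBlDl.
  have h2 : mdist (g i0) (g t) <= 0.
    have it : unit_le i0 t by exact: unit_ge0.
    by apply: le_trans (var_diff it) _; rewrite var0 subr0 (le_trans vt) // mul0r.
  have := metric_triangle (g i0) (g t) (g (a i0)); rewrite (metric_sym (g t)) => h3.
  have := le_lt_trans h3 (ler_ltD h2 h1).
  by rewrite add0r ltxx.
- congr g; apply: itv_val_inj; rewrite aE.
  have /andP[_ b1] := b01 i1; apply/eqP; rewrite eq_le b1 /=.
  apply: (ub_le_sup (proj2 (low_has_sup i1))); split; first by rewrite lexx ler01.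
  by rewrite mul1r; exact: var_le.
Qed.

End arclength_parametrization.

Lemma measurable_sqrte (R : realType) : measurable_fun setT (fun x : \bar R => sqrte x).
Proof.
have -> : (fun x : \bar R => sqrte x) = (fun x => if x == +oo%E then +oo%E else (Num.sqrt (fine x))%:E).
  by apply/funext => -[x| |] //=; rewrite sqrtr0.
apply: measurable_fun_ifT => //.
- apply: (@measurable_fun_bool _ _ _ _ true); rewrite setTI (_ : _ @^-1` _ = [set +oo%E]).
    exact: emeasurable_set1.
  by apply/seteqP; split => x /= /eqP.
- apply/measurable_EFinP.
  have ms : measurable_fun setT (@Num.sqrt R) by apply: continuous_measurable_fun; exact: sqrt_continuous.
  exact: (measurableT_comp ms (fine_measurable measurableT)).
Qed.

Section warped_geometry.
Context (R : realType) (X : pmetricType R) (I : closed_interval R).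
Variables (wd : itv_type I -> R).
Hypothesis wd0 : forall t, 0 <= wd t.
Hypothesis wdc : continuous wd.
Variables (Xw : completeMetricType R) (pr : itv_type I * X -> Xw).
Hypothesis hpr : is_warped_product wd pr.
Let T := borel (unit_itv R).

Let dist_inf p q gI gX : abs_cont 1 gI -> abs_cont 1 gX -> (gI i0, gX i0) = p ->
  (gI i1, gX i1) = q -> ((mdist (pr p) (pr q))%:E <= warped_length wd gI gX)%E.
Proof.
move=> aI aX g0 g1; have [-> _] := hpr; apply: ereal_inf_lbound.
by exists gI, gX.
Qed.

Let length_le (gI : unit_itv R -> itv_type I) (gX : unit_itv R -> X) (K : R) : 0 <= K ->
  (forall t, (speed gI t ^+ 2 + (wd (gI t) ^+ 2)%:E * speed gX t ^+ 2 <= (K ^+ 2)%:E)%E) ->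
  measurable_fun setT (fun t : T => sqrte (speed gI t ^+ 2 + (wd (gI t) ^+ 2)%:E * speed gX t ^+ 2)%E) ->
  (warped_length wd gI gX <= K%:E)%E.
Proof.
move=> K0 h mh; rewrite /warped_length.
apply: (@le_trans _ _ (\int[leb01]_(t in [set: T]) (cst K%:E t))%E).
  apply: ge0_le_integral => //.
    by move=> t _; exact: sqrte_ge0.
  move=> t _; rewrite /cst; have -> : K%:E = sqrte (K ^+ 2)%:E by rewrite /sqrte sqrtr_sqr ger0_norm.
  by rewrite lee_sqrt // lee_fin sqr_ge0.
have -> : (\int[leb01]_(t in [set: T]) (cst K%:E t) = K%:E * leb01 [set: T])%E.
  exact: (integral_cst (@leb01 R) measurableT K%:E).
by rewrite [X in (_ * X <= _)%E](@leb01T R) mule1.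
Qed.

Let sqre0 : (0 ^+ 2 = 0 :> \bar R)%E. Proof. by rewrite expe2 mul0e. Qed.

Let path_of (M : pmetricType R) (g : unit_itv R -> M) : abs_cont 1 g ->
  exists2 h : Cpath M, (h : unit_itv R -> M) = g & exists a, ac_bound g a.
Proof.
move=> ag; have [a ga] := @abs_cont_bound R M 1 g (or_introl erefl) ag.
by exists (mkcts (ac_bound_continuous ga)) => //; exists a.
Qed.

Lemma measurable_warped_speed (gI : unit_itv R -> itv_type I) (gX : unit_itv R -> X) : abs_cont 1 gI -> abs_cont 1 gX ->
  measurable_fun setT (fun t : T => sqrte (speed gI t ^+ 2 + (wd (gI t) ^+ 2)%:E * speed gX t ^+ 2)%E).
Proof.
move=> /path_of[hI <- _] /path_of[hX <- _].
have msq : measurable_fun setT (fun x : \bar R => sqrte x) by exact: measurable_sqrte.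
apply: (measurableT_comp msq).
apply: emeasurable_funD; first exact: (measurable_speed_sqr hI).
apply: emeasurable_funM; last exact: (measurable_speed_sqr hX).
apply/measurable_EFinP; apply: measurable_funX.
by apply: continuous_borel_real; apply: continuous_compT wdc; exact: Cpath_continuous.
Qed.

Lemma warped_dist_I t s x : mdist (pr (t, x)) (pr (s, x)) <= mdist t s.
Proof.
pose f (r : unit_itv R) : R := (1 - set_val r) * set_val t + set_val r * set_val s.
have fI r : citv I (f r).
  have := unit_ge0 r; have := unit_le1 r; have It := itv_val t; have Is := itv_val s.
  rewrite /f; move: (set_val t : R) (set_val s : R) (set_val r : R) It Is => a b q Ia Ib q1 q0.
  have [ab|ba] := leP a b.
    by apply: (citv_itv Ia Ib); apply/andP; split; nra.
  by apply: (citv_itv Ib Ia); apply/andP; split; nra.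
pose gI r : itv_type I := itv_mk (fI r).
have gL r r' : unit_le r r' -> mdist (gI r) (gI r') <= mdist t s * (set_val r' - set_val r).
  move=> rr; rewrite !itv_distE !itv_mkE /f.
  have -> : (1 - set_val r') * set_val t + set_val r' * set_val s - ((1 - set_val r) * set_val t + set_val r * set_val s)
     = (set_val s - set_val t) * (set_val r' - set_val r) :> R by ring.
  by rewrite normrM (ger0_norm (_ : 0 <= set_val r' - set_val r)) // subr_ge0.
have xL r r' : unit_le r r' -> mdist x x <= 0 * (set_val r' - set_val r) by rewrite mdistxx mul0r.
have aI := abs_cont_lipschitz (mdist_ge0 t s) gL.
have aX := @abs_cont_lipschitz R X (fun=> x) 0 (lexx _) xL.
have g0 : (gI i0, x) = (t, x).
  by congr (_, _); apply: itv_val_inj; rewrite itv_mkE /f (_ : set_val i0 = 0 :> R) // subr0 mul1r mul0r addr0.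
have g1 : (gI i1, x) = (s, x).
  by congr (_, _); apply: itv_val_inj; rewrite itv_mkE /f (_ : set_val i1 = 1 :> R) // subrr mul0r mul1r add0r.
rewrite -lee_fin; apply: le_trans (dist_inf aI aX g0 g1) _.
apply: length_le; [exact: mdist_ge0| |exact: measurable_warped_speed].
move=> r; have sX : speed (fun=> x) r = 0%E.
  by apply/eqP; rewrite eq_le speed_ge0 (@speed_lipschitz R X (fun=> x) 0).
rewrite sX sqre0 mule0 adde0 EFin_expe !expe2.
have h := speed_lipschitz gL r.
by apply: lee_pmul; rewrite ?speed_ge0.
Qed.

Lemma warped_dist_X t x y : length_space X -> mdist (pr (t, x)) (pr (t, y)) <= wd t * mdist x y.
Proof.
(* The distance is an infimum of lengths, possibly not attained, hence the slack e; it also makes L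
   positive, as the reparametrisation requires. *)
move=> hX; have key (e : R) : 0 < e -> mdist (pr (t, x)) (pr (t, y)) <= wd t * (mdist x y + e).
  move=> e0; pose L := mdist x y + e.
  have L0 : 0 < L by rewrite ltr_wpDl // mdist_ge0.
  have : (ereal_inf [set l | exists gamma, [/\ continuous gamma, gamma i0 = x, gamma i1 = y & l = curve_length gamma]] < L%:E)%E.
    by rewrite -hX lte_fin ltrDl.
  move=> /ereal_inf_lt[_ [g [gc g0 g1 ->]] gL].
  have [eta [e0' e1' etaL]] := arclength_parametrization gc L0 (ltW gL).
  have tL r r' : unit_le r r' -> mdist t t <= 0 * (set_val r' - set_val r) by rewrite mdistxx mul0r.
  have aI := @abs_cont_lipschitz R (itv_type I) (fun=> t) 0 (lexx _) tL.
  have aX := abs_cont_lipschitz (ltW L0) etaL.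
  have p0 : (t, eta i0) = (t, x) by rewrite e0' g0.
  have p1 : (t, eta i1) = (t, y) by rewrite e1' g1.
  rewrite -lee_fin; apply: le_trans (dist_inf aI aX p0 p1) _.
  apply: length_le; [by rewrite mulr_ge0 // ltW| |exact: measurable_warped_speed].
  move=> r; have sI : speed (fun=> t) r = 0%E.
    by apply/eqP; rewrite eq_le speed_ge0 (@speed_lipschitz R _ (fun=> t) 0).
  have -> : ((wd t * (mdist x y + e)) ^+ 2)%:E = ((wd t ^+ 2)%:E * ((mdist x y + e) ^+ 2)%:E)%E by rewrite exprMn EFinM.
  rewrite sI sqre0 add0e; apply: lee_wpmul2l; first by rewrite lee_fin sqr_ge0.
  rewrite EFin_expe !expe2; have h := speed_lipschitz etaL r.
  by apply: lee_pmul; rewrite ?speed_ge0.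
rewrite leNgt; apply/negP => lt.
have := wd0 t; rewrite le_eqVlt => /orP[/eqP w0|w0].
  by have := key 1 ltr01; rewrite -w0 mul0r leNgt; move: lt; rewrite -w0 mul0r => ->.
(* This slack, multiplied by wd t, is half of the supposed excess. *)
have d0 : 0 < (mdist (pr (t, x)) (pr (t, y)) - wd t * mdist x y) / (2 * wd t).
  by rewrite divr_gt0 ?subr_gt0 // mulr_gt0.
have := key _ d0; rewrite mulrDr.
have -> : wd t * ((mdist (pr (t, x)) (pr (t, y)) - wd t * mdist x y) / (2 * wd t)) =
   (mdist (pr (t, x)) (pr (t, y)) - wd t * mdist x y) / 2 by field; rewrite gt_eqF.
rewrite leNgt => /negP; apply.
move: lt; set a := wd t * _; set b := mdist _ _; clearbody a b => ab; lra.
Qed.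

Let sqrte_ge_l (a b : \bar R) : (0 <= a -> 0 <= b -> a <= sqrte (a ^+ 2 + b))%E.
Proof.
move=> a0 b0; rewrite -[leLHS](gee0_abs a0) -sqrte_sqr lee_sqrt ?leeDl //.
by rewrite adde_ge0 // sqre_ge0.
Qed.

Let sqrte_ge_r (a b : \bar R) (w u : R) : 0 < w -> w <= u ->
  (0 <= a -> 0 <= b -> w%:E * b <= sqrte (a ^+ 2 + (u ^+ 2)%:E * b ^+ 2))%E.
Proof.
move=> w0 wu a0 b0; have wb0 : (0 <= w%:E * b)%E by rewrite mule_ge0 // lee_fin ltW.
rewrite -[leLHS](gee0_abs wb0) -sqrte_sqr lee_sqrt.
  apply: (@le_trans _ _ ((u ^+ 2)%:E * b ^+ 2)%E).
    have -> : ((w%:E * b) ^+ 2 = (w ^+ 2)%:E * b ^+ 2)%E by rewrite EFin_expe !expe2 muleACA.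
    apply: lee_wpmul2r; first by rewrite sqre_ge0.
    by rewrite lee_fin ler_sqr ?nnegrE // ltW // (lt_le_trans w0).
  by rewrite leeDr // sqre_ge0.
by rewrite adde_ge0 ?sqre_ge0 // mule_ge0 ?sqre_ge0 // lee_fin sqr_ge0.
Qed.

(** A curve of warped length below rho keeps its component in I within dl of t0, where wd is at
    least half of wd t0. Only with this lower bound does the warped length control the component in
    X. *)
Lemma warped_local_inverse (U : set (itv_type I * X)%type) p : open U -> U p -> 0 < wd p.1 ->
  exists2 rho : R, 0 < rho & forall q, mdist (pr p) (pr q) < rho -> U q.
Proof.
case: p => t0 x0 oU Up /= w0.
have : nbhs (t0, x0) U by exact: open_nbhs_nbhs.
move=> [[A B] /= [/nbhs_ballP[e1 /= e10 eA] /nbhs_ballP[e2 /= e20 eB]] AB].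
have h2 : 0 < wd t0 / 2 by rewrite divr_gt0.
have : nbhs (wd t0) (ball (wd t0) (wd t0 / 2)) by exact: nbhsx_ballx.
move=> /wdc /nbhs_ballP[dl /= dl0 Hd].
have wlow t : mdist t0 t < dl -> wd t0 / 2 <= wd t.
  move=> td; have : ball t0 dl t by rewrite ballEmdist.
  move=> /Hd; rewrite /= -ball_normE /= => h.
  have := le_lt_trans (ler_norm _) h; rewrite ltrBlDr -ltrBlDl => h'.
  by apply: ltW; apply: le_lt_trans h'; rewrite {2}[wd t0]splitr addrK.
(* The first two bounds confine the component in I to the region where wd is bounded below and to
   the ball of radius e1; the third, divided by wd t0 / 2, leaves a distance below e2 in X. *)
pose rho := Num.min (Num.min dl e1) (wd t0 / 2 * e2).
have rho0 : 0 < rho by rewrite !lt_min dl0 e10 mulr_gt0.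
exists rho => // -[t1 x1].
have [hd _] := hpr; rewrite -lte_fin hd => /ereal_inf_lt[_ [gI [gX [aI aX g0 g1 ->]]] lt].
have mS := measurable_warped_speed aI aX.
have [hI hIE [aaI bI]] := path_of aI; have [hX hXE [aaX bX]] := path_of aX.
have [gI0 gX0] : gI i0 = t0 /\ gX i0 = x0 by case: g0.
have [gI1 gX1] : gI i1 = t1 /\ gX i1 = x1 by case: g1.
pose S (t : T) := sqrte (speed gI t ^+ 2 + (wd (gI t) ^+ 2)%:E * speed gX t ^+ 2)%E.
have S0 t : (0 <= S t)%E by exact: sqrte_ge0.
have term0 t : (0 <= (wd (gI t) ^+ 2)%:E * speed gX t ^+ 2)%E.
  by rewrite mule_ge0 ?sqre_ge0 // lee_fin sqr_ge0.
have closeI r : mdist t0 (gI r) < Num.min dl e1.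
  have r0 : unit_le i0 r by exact: unit_ge0.
  have mdI : ((mdist (gI i0) (gI r))%:E <= \int[leb01]_(u in seg i0 r) speed gI u)%E.
    by rewrite -hIE in bI *; exact: (mdist_le_int_speed bI r0).
  rewrite -gI0 -lte_fin; apply: le_lt_trans mdI _.
  apply: (@lt_le_trans _ _ rho%:E); last by rewrite lee_fin /rho ge_min lexx.
  apply: le_lt_trans lt; rewrite /warped_length.
  apply: (@le_trans _ _ (\int[leb01]_u speed gI u)%E).
    apply: ge0_subset_integral => //; first exact: measurable_seg.
      by rewrite -hIE; exact: speed_measurable1.
    by move=> u _; exact: speed_ge0.
  apply: ge0_le_integral => //.
  - by move=> u _; exact: speed_ge0.
  - by rewrite -hIE; exact: speed_measurable1.
  - by move=> u _; apply: sqrte_ge_l; [exact: speed_ge0|exact: term0].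
have wl r : wd t0 / 2 <= wd (gI r) by apply: wlow; apply: lt_le_trans (closeI r) _; rewrite ge_min lexx.
have closeX : mdist x0 x1 < e2.
  have i01 : unit_le (@i0 R) i1 by exact: unit_ge0.
  have mdX : ((mdist (gX i0) (gX i1))%:E <= \int[leb01]_(u in seg i0 i1) speed gX u)%E.
    by rewrite -hXE in bX *; exact: (mdist_le_int_speed bX i01).
  rewrite -gX0 -gX1 -(ltr_pM2l h2) -lte_fin EFinM.
  apply: (@le_lt_trans _ _ ((wd t0 / 2)%:E * \int[leb01]_u speed gX u)%E).
    apply: lee_wpmul2l; first by rewrite lee_fin ltW.
    apply: le_trans mdX _; apply: ge0_subset_integral => //; first exact: measurable_seg.
      by rewrite -hXE; exact: speed_measurable1.
    by move=> u _; exact: speed_ge0.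
  apply: (@lt_le_trans _ _ rho%:E); last by rewrite lee_fin /rho ge_min lexx orbT.
  apply: le_lt_trans lt; rewrite /warped_length.
  have mX : measurable_fun setT (fun u : T => speed gX u) by rewrite -hXE; exact: speed_measurable1.
  rewrite -ge0_integralZl_EFin //; last 2 first.
  - by move=> u _; exact: speed_ge0.
  - exact: ltW.
  apply: ge0_le_integral => //.
  - by move=> u _; rewrite mule_ge0 ?speed_ge0 // lee_fin ltW.
  - exact: measurable_funeM.
  - by move=> u _; exact: sqrte_ge_r h2 (wl u) (speed_ge0 gI u) (speed_ge0 gX u).
apply: AB; split => /=.
  apply: eA; rewrite ballEmdist /= -gI1; apply: lt_le_trans (closeI i1) _.
  by rewrite ge_min lexx orbT.
by apply: eB; rewrite ballEmdist.
Qed.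

End warped_geometry.

(** * Descent of Borel functions to the warped product *)

Section borel_factorization.
Context (R : realType) (S T V : pmetricType R).
Variables (BT : nat -> set T) (P : set (S * T)%type) (pr : S * T -> V).
Hypothesis bT : countable_base BT.
Hypothesis oP : open P.
Hypothesis pr_inv : forall (U : set (S * T)%type) p, open U -> U p -> P p ->
  exists2 rho : R, 0 < rho & forall q, mdist (pr p) (pr q) < rho -> U q.
Let M := (borel S * borel T)%type.

(** Closure under complements needs P itself to be the preimage of a Borel set, as the complement is
    taken within P; this is why P is open. *)
Let factor : set (set M) := [set A | exists2 B : set (borel V), measurable B & A `&` P = pr @^-1` B].

(** [B] is the union of the balls about points [pr p] whose preimages lie in the trace of U on P; by
    [pr_inv] every point of this trace has such a ball. *)
Let factor_open (U : set (S * T)%type) : open U -> factor U.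
Proof.
move=> oU; have oUP : open (U `&` P) by exact: openI.
pose B : set V := [set v | exists p rho, [/\ (U `&` P) p, 0 < rho,
  forall q, mdist (pr p) (pr q) < rho -> (U `&` P) q & ball (pr p) rho v]].
exists B.
  apply: open_borel; rewrite openE => v [p [rho [Up rho0 Hp]]]; rewrite ballEmdist /= => vb.
  have d0 : 0 < rho - mdist (pr p) v by rewrite subr_gt0.
  apply/nbhs_ballP; exists (rho - mdist (pr p) v) => // u; rewrite ballEmdist /= => vu.
  exists p, rho; split => //; rewrite ballEmdist /=.
  by apply: le_lt_trans (metric_triangle _ v _) _; rewrite addrC -ltrBrDr.
apply/seteqP; split => [p Up|q [p [rho [Up rho0 Hp]]]].
  have [rho rho0 Hp] := pr_inv oUP Up (proj2 Up).
  by exists p, rho; split => //; exact: ballxx.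
by rewrite ballEmdist /= => /Hp.
Qed.

Let factorC A : factor A -> factor (~` A).
Proof.
move=> [B mB AB]; have [BP mBP PB] := factor_open oP.
exists (BP `\` B); first exact: measurableD.
move: PB; rewrite setIid => PB.
apply/seteqP; split => p.
  move=> [nA Pp]; split; first by rewrite -[BP _]/((pr @^-1` BP) p) -PB.
  move=> Bp; apply: nA; have : (A `&` P) p by rewrite AB.
  by case.
move=> [BPp nBp]; have Pp : P p by rewrite PB.
split => // Ap; apply: nBp; rewrite -[B _]/((pr @^-1` B) p) -AB //.
Qed.

Let factor_bigcup (F : nat -> set M) : (forall i, factor (F i)) -> factor (\bigcup_i F i).
Proof.
move=> h; have /choice[B HB] : forall i, exists B : set (borel V), measurable B /\ F i `&` P = pr @^-1` B.
  by move=> i; have [B mB e] := h i; exists B.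
exists (\bigcup_i B i); first by apply: bigcupT_measurable => i; have [] := HB i.
rewrite setI_bigcupl preimage_bigcup; apply: eq_bigcupr => i _; by have [] := HB i.
Qed.

Let factor0 : factor set0.
Proof. by exists set0 => //; rewrite set0I preimage_set0. Qed.

Let factor_fst (A : set (borel S)) : measurable A -> factor (fst @^-1` A).
Proof.
pose G : set (set S) := [set A | factor (fst @^-1` A)].
suff : @measurable _ (borel S) `<=` G by move=> /[apply].
apply: smallest_sub.
  split.
  - by rewrite /G /= preimage_set0; exact: factor0.
  - move=> B GB; rewrite /G /= setTD preimage_setC; exact: factorC.
  - move=> F GF; rewrite /G /= preimage_bigcup; exact: factor_bigcup.
move=> U oU; apply: factor_open.
by apply: open_comp => // x _; exact: cvg_fst.
Qed.

Let factor_snd (A : set (borel T)) : measurable A -> factor (snd @^-1` A).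
Proof.
pose G : set (set T) := [set A | factor (snd @^-1` A)].
suff : @measurable _ (borel T) `<=` G by move=> /[apply].
apply: smallest_sub.
  split.
  - by rewrite /G /= preimage_set0; exact: factor0.
  - move=> B GB; rewrite /G /= setTD preimage_setC; exact: factorC.
  - move=> F GF; rewrite /G /= preimage_bigcup; exact: factor_bigcup.
move=> U oU; apply: factor_open.
by apply: open_comp => // x _; exact: cvg_snd.
Qed.

Lemma borel_factor_set (A : set M) : measurable A ->
  exists2 B : set (borel V), measurable B & A `&` P = pr @^-1` B.
Proof.
suff : @measurable _ M `<=` factor by move=> /[apply].
apply: smallest_sub.
  split; first exact: factor0.
  - by move=> B GB; rewrite setTD; exact: factorC.
  - by move=> F GF; exact: factor_bigcup.
move=> A' [[B mB <-]|[B mB <-]]; rewrite setTI.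
- exact: factor_fst.
- exact: factor_snd.
Qed.

Lemma borel_factor_fun (H : M -> R) : measurable_fun setT H -> (forall p, 0 <= H p) ->
  exists D : borel V -> R, measurable_fun setT D /\
    (forall p, P p -> D (pr p) = H p) /\ forall p, ~ P p -> D (pr p) = 0.
Proof.
move=> mH H0.
have /choice[B HB] : forall q : rat, exists B : set (borel V), measurable B /\
    [set p | ratr q < H p] `&` P = pr @^-1` B.
  move=> q; have mq : measurable [set p : M | ratr q < H p].
    have -> : [set p : M | ratr q < H p] = [set p | ((ratr q)%:E < (H p)%:E)%E].
      by apply/seteqP; split => p /=; rewrite lte_fin.
    by apply: measurable_lteT => //; exact/measurable_EFinP.
  by have [B mB e] := borel_factor_set mq; exists B.
pose Q n : rat := odflt 0 (unpickle n).
(* H p is the supremum of 0 and the rationals below it. Absolute values keep all terms nonnegative,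
   so the supremum is 0 at [pr p] for p outside P, where every term vanishes. *)
pose F (n : nat) (v : borel V) : \bar R := ((`|ratr (Q n)|) * \1_(B `|Q n|) v)%:E.
have mF n : measurable_fun setT (F n).
  apply/measurable_EFinP; apply: measurable_funM => //; apply: measurable_indic.
  by have [] := HB `|Q n|.
have F_ge0 n v : (0 <= F n v)%E by rewrite lee_fin mulr_ge0.
pose D v := fine (ereal_sup (range (F^~ v))).
have inB q p : B q (pr p) <-> (ratr q < H p /\ P p).
  by have [_ e] := HB q; rewrite -[B q _]/((pr @^-1` B q) p) -e.
exists D; split; last split.
- apply: (measurableT_comp (fine_measurable measurableT)).
  have -> : (fun v => ereal_sup (range (F^~ v))) = (fun v => esups (F^~ v) 0).
    by apply/funext => v; rewrite /esups /sdrop; congr ereal_sup; apply/seteqP; split => _ [n _ <-]; exists n.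
  exact: measurable_fun_esups.
- move=> p Pp; rewrite /D (_ : ereal_sup _ = (H p)%:E) //.
  apply/eqP; rewrite eq_le; apply/andP; split.
    apply: ge_ereal_sup => _ [n _ <-]; rewrite /F lee_fin indicE.
    case: (boolP (_ \in _)) => [/set_mem/inB[h _]|_]; last by rewrite mulr0.
    by rewrite mulr1 -ratr_norm ltW.
  apply/lee_addgt0Pr => e e0.
  have [He|He] := leP (H p) e.
    apply: (@le_trans _ _ e%:E); first by rewrite lee_fin.
    by rewrite leeDr //; apply: ereal_sup_ge; exists (F 0%N (pr p)) => //; exists 0%N.
  have lt : H p - e < H p by rewrite ltrBlDr ltrDl.
  have [q] := rat_in_itvoo lt; rewrite in_itv /= => /andP[q1 q2].
  have q0 : 0 < (ratr q : R) by apply: lt_trans q1; rewrite subr_gt0.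
  have q0' : 0 < q by rewrite -(ltr0q R).
  have -> : ((H p)%:E = (H p - e)%:E + e%:E)%E by rewrite -EFinD subrK.
  apply: leeD; last exact: lexx.
  apply: (@le_trans _ _ (F (pickle q) (pr p))); last by apply: ereal_sup_ubound; exists (pickle q).
  rewrite /F /Q pickleK /= (gtr0_norm q0') (gtr0_norm q0) lee_fin indicE mem_set; last exact/inB.
  by rewrite mulr1 ltW.
- move=> p nP; rewrite /D (_ : ereal_sup _ = 0%E) //.
  apply/eqP; rewrite eq_le; apply/andP; split.
    apply: ge_ereal_sup => _ [n _ <-]; rewrite /F indicE memNset ?mulr0 // => /inB[_].
    exact: nP.
  by apply: ereal_sup_ge; exists (F 0%N (pr p)) => //; exists 0%N.
Qed.

End borel_factorization.

(** * Image measures, densities, and the conclusion for the warped product *)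

Lemma pushforward_measure d1 d2 (T1 : measurableType d1) (T2 : measurableType d2) (R : realType)
    (m : {measure set T1 -> \bar R}) (f : T1 -> T2) : measurable_fun setT f ->
  exists M : {measure set T2 -> \bar R}, (M : set T2 -> \bar R) = pushforward m f.
Proof.
move=> mf.
by exists (measure_function_pushforward__canonical__measure_function_Measure m mf).
Qed.

Lemma ge0_integral_pushforwardT d1 d2 (T1 : measurableType d1) (T2 : measurableType d2) (R : realType)
    (m : {measure set T1 -> \bar R}) (f : T1 -> T2) (h : T2 -> \bar R) : measurable_fun setT f ->
  measurable_fun setT h -> (forall y, (0 <= h y)%E) ->
  (\int[pushforward m f]_y h y = \int[m]_x h (f x))%E.
Proof.
move=> mf mh h0.
by have := @ge0_integral_pushforward _ _ _ _ _ _ mf m setT h measurableT mh (in1W h0).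
Qed.

(** The density may be unbounded, so an exhaustion of m is cut further by the sets where w is at
    most k. *)
Lemma sigma_finite_density d (T : measurableType d) (R : realType)
    (m : {sigma_finite_measure set T -> \bar R}) (w : T -> R) :
  measurable_fun setT w -> (forall x, 0 <= w x) ->
  exists M : {sigma_finite_measure set T -> \bar R}, (M : set T -> \bar R) = density_measure w m.
Proof.
move=> mw w0; have mwE : measurable_fun setT (fun x => (w x)%:E) by exact/measurable_EFinP.
have w0E x : (0 <= (w x)%:E)%E by rewrite lee_fin.
have [M0 M0E] := @wpush_measure _ _ T T R m id _ (@measurable_id _ T setT) mwE w0E.
suff h : sigma_finite setT M0 by exists (sf_measure h).
have [F FT Ffin] := sigma_finiteT m.
pose H i := if (unpickle i : option (nat * nat)) is Some (n, k) then F n `&` [set x | w x <= k%:R] else set0.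
have mH n k : measurable (F n `&` [set x | w x <= k%:R]).
  apply: measurableI; first by have [] := Ffin n.
  have -> : [set x | w x <= k%:R] = [set x | ((w x)%:E <= (k%:R)%:E)%E].
    by apply/seteqP; split => x /=; rewrite lee_fin.
  exact: measurable_leeT.
exists H.
  apply/seteqP; split => // x _; have [n _ Fx] : (\bigcup_n F n) x by rewrite -FT.
  exists (pickle (n, (Num.truncn (w x)).+1)) => //; rewrite /H pickleK; split => //=.
  by rewrite ltW // truncnS_gt.
move=> i; rewrite /H; case: unpickle => [[n k]|]; last by rewrite measure0.
split; first exact: mH.
have [mF Foo] := Ffin n.
rewrite M0E /wpush preimage_id.
set A := F n `&` _; have mA : measurable A by exact: mH.
apply: (@le_lt_trans _ _ (\int[m]_(x in A) (cst (k%:R : R)%:E x))%E).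
  apply: ge0_le_integral => //; first exact: measurable_funTS.
  by move=> x [_ /= wk]; rewrite lee_fin.
rewrite integral_cst //; apply: lte_mul_pinfty => //.
by apply: le_lt_trans Foo; apply: le_measure; rewrite ?inE // => x [].
Qed.

Theorem proposition3p10
  (R : realType)
  (X : completeMetricType R)
  (hXsep : separable X)
  (hXlen : length_space X)
  (m : {finite_measure set (borel X) -> \bar R})
  (hm : msupport m = setT)
  (I : closed_interval R)
  (wd wm : itv_type I -> R)
  (hwd0 : forall t, 0 <= wd t) (hwm0 : forall t, 0 <= wm t)
  (hwdc : continuous wd) (hwmc : continuous wm)
  (hw : [set t | wd t = 0] `<=` [set t | wm t = 0])
  (Xw : completeMetricType R) (pr : itv_type I * X -> Xw)
  (hXw : is_warped_product wd pr) :
  W12 (warped_measure wm m pr) `<=` BL wd wm m pr.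
Proof.
have [BX bX] := separable_countable_base hXsep.
have [BI bI] := itv_countable_base I.
have dI := warped_dist_I hwdc hXw.
have dX t x y := warped_dist_X hwd0 hwdc hXw t x y hXlen.
pose one_I : itv_type I -> R := cst 1; pose one_X : X -> R := cst 1.
have oneI0 t : 0 <= one_I t by [].
have oneX0 x : 0 <= one_X x by [].
have cI : continuous one_I by move=> t; exact: cst_continuous.
have cX : continuous one_X by move=> t; exact: cst_continuous.
pose iX (x : X) (t : itv_type I) := pr (t, x).
pose iI (t : itv_type I) (x : X) := pr (t, x).
(* Through (t', x): the motion in X takes place at height t', so the constant is wd t'. *)
have iX_le x t x' t' : mdist (iX x t) (iX x' t') <= wd t' * mdist x x' + one_X x * mdist t t'.
  rewrite /iX mul1r addrC; apply: le_trans (metric_triangle _ (pr (t', x)) _) _.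
  by apply: lerD; [exact: dI|exact: dX].
(* Through (t, x'): now the motion in X takes place at height t, so wd plays the part of kappa. *)
have iI_le t x t' x' : mdist (iI t x) (iI t' x') <= one_X x' * mdist t t' + wd t * mdist x x'.
  rewrite /iI mul1r addrC; apply: le_trans (metric_triangle _ (pr (t, x')) _) _.
  by apply: lerD; [exact: dX|exact: dI].
have mwm : measurable_fun setT (wm : borel (itv_type I) -> R) by exact: continuous_borel_real.
have mwd : measurable_fun setT (wd : borel (itv_type I) -> R) by exact: continuous_borel_real.
have [WL WLE] := sigma_finite_density (@leb R I) mwm hwm0.
have {}WLE : (WL : set (borel (itv_type I)) -> \bar R) = weighted_leb wm by exact: WLE.
have [PM PME] := sigma_finite_product WL m.
have prodE : prod_measure wm m = PM by rewrite /prod_measure -WLE PME.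
have mpr : measurable_fun setT (pr : (borel (itv_type I) * borel X)%type -> borel Xw).
  have := @iota_measurable R (itv_type I) X Xw BX bX iI one_X wd oneX0 hwd0 cX iI_le.
  by apply: eq_measurable_fun => -[t x] _.
have [MV MVE] := pushforward_measure PM mpr.
have {}MVE : (MV : set (borel Xw) -> \bar R) = warped_measure wm m pr by rewrite MVE /warped_measure prodE.
have int_pr (h : borel Xw -> \bar R) : measurable_fun setT h -> (forall v, (0 <= h v)%E) ->
    (\int[MV]_v h v = \int[PM]_p h (pr p))%E.
  by move=> mh h0; rewrite MVE /warped_measure prodE; exact: ge0_integral_pushforwardT mpr mh h0.
have tonelli1 (h : (borel (itv_type I) * borel X)%type -> \bar R) : measurable_fun setT h -> (forall p, (0 <= h p)%E) ->
    (\int[PM]_p h p = \int[WL]_t \int[m]_x h (t, x))%E.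
  by move=> mh h0; rewrite PME (@fubini_tonelli1 _ _ _ _ R WL m h mh h0).
have tonelli2 (h : (borel (itv_type I) * borel X)%type -> \bar R) : measurable_fun setT h -> (forall p, (0 <= h p)%E) ->
    (\int[PM]_p h p = \int[m]_x \int[WL]_t h (t, x))%E.
  by move=> mh h0; rewrite PME (@fubini_tonelli2 _ _ _ _ R WL m h mh h0).
rewrite -MVE => f [[mf [G wG]] [_ f2]].
have [G0 [mG G2] _] := wG.
(* The warped measure is disintegrated in both orders: over t into images of m, and over x into
   images of the weighted Lebesgue measure. *)
have MVX (A : set (borel Xw)) : measurable A -> MV A = (\int[WL]_t m [set x | A (iX x t)])%E.
  move=> mA; rewrite MVE /warped_measure /pushforward prodE PME /product_measure1.
  by apply: eq_integral => t _ /=; rewrite xsectionE.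
have MVI (A : set (borel Xw)) : measurable A -> MV A = (\int[m]_x WL [set t | A (iI t x)])%E.
  move=> mA; have mpA : measurable (pr @^-1` A : set (borel (itv_type I) * borel X)%type).
    by rewrite -[X in measurable X]setTI; exact: mpr.
  rewrite MVE /warped_measure /pushforward prodE.
  transitivity (\int[PM]_p (\1_(pr @^-1` A) p : R)%:E)%E; first by rewrite integral_indic // setIT.
  rewrite tonelli2; [|by apply/measurable_EFinP; exact: measurable_indic|by []].
  apply: eq_integral => x _.
  transitivity (\int[WL]_t (\1_[set t | A (iI t x)] t : R)%:E)%E.
    by apply: eq_integral => t _; congr _%:E; rewrite !indicE; congr (_ : bool)%:R; apply/idP/idP; rewrite !inE.
  rewrite integral_indic ?setIT //.
  by have := measurable_ysection x mpA; rewrite ysectionE.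
have sq_pr (u : borel Xw -> R) : measurable_fun setT u ->
    measurable_fun setT (fun p : (borel (itv_type I) * borel X)%type => (u (pr p) ^+ 2)%:E).
  by move=> mu; apply/measurable_EFinP; apply: measurable_funX; exact: measurableT_comp mu mpr.
have sq0 (r : R) : (0 <= (r ^+ 2)%:E)%E by rewrite lee_fin sqr_ge0.
have sqX (u : borel Xw -> R) : measurable_fun setT u ->
    (\int[WL]_t sqint m (fun x => u (iX x t)) = sqint MV u)%E.
  by move=> mu; rewrite /sqint int_pr ?tonelli1 //; [exact: sq_pr|exact: measurable_sqr].
have sqI (u : borel Xw -> R) : measurable_fun setT u ->
    (\int[m]_x sqint WL (fun t => u (iI t x)) = sqint MV u)%E.
  by move=> mu; rewrite /sqint int_pr ?tonelli2 //; [exact: sq_pr|exact: measurable_sqr].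
have fX : (\int[WL]_t sqint m (fun x => f (iX x t)) < +oo)%E by rewrite sqX.
have fI : (\int[m]_x sqint WL (fun t => f (iI t x)) < +oo)%E by rewrite sqI.
have GX : (\int[WL]_t sqint m (fun x => G (iX x t)) < +oo)%E by rewrite sqX.
have GI : (\int[m]_x sqint WL (fun t => G (iI t x)) < +oo)%E by rewrite sqI.
have [DX [mDX DX0 HDX]] := @sections_sobolev R X (itv_type I) Xw BI BX bI bX iX wd one_X hwd0 oneX0 hwdc cX iX_le
  m WL MV MVX f G mf wG fX GX.
have [DI' [mDI' DI'0 HDI]] := @sections_sobolev R (itv_type I) X Xw BX BI bX bI iI one_X wd oneX0 hwd0 cX hwdc iI_le
  WL m MV MVI f G mf wG fI GI.
(* [sections_sobolev] puts the parameter first, here x, whereas [BL] asks for functions of (t,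
   x). *)
pose DI (p : (borel (itv_type I) * borel X)%type) := DI' (p.2, p.1).
have mDI : measurable_fun setT DI.
  apply: (measurableT_comp (f := DI') mDI' (g := fun p : (borel (itv_type I) * borel X)%type => (p.2, p.1))).
  by apply/measurable_fun_pairP; split; [exact: measurable_snd|exact: measurable_fst].
(* Where wd vanishes its inverse is 0 by convention, and so is AX; the bound of AX by G^2 thus holds
   there as well. *)
pose AX (p : (borel (itv_type I) * borel X)%type) := (wd p.1) ^- 2 * DX p ^+ 2.
have AX0 p : 0 <= AX p by rewrite mulr_ge0 ?sqr_ge0 // invr_ge0 sqr_ge0.
have mAX : measurable_fun setT AX.
  apply: measurable_funM; last exact: measurable_funX.
  have -> : (fun p : (borel (itv_type I) * borel X)%type => (wd p.1) ^- 2) = (fun p => powR (wd p.1) (- 2%:R)).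
    by apply/funext => p; rewrite powR_invn.
  have m1 : measurable_fun setT (fun p : (borel (itv_type I) * borel X)%type => wd p.1) by exact: (measurableT_comp mwd measurable_fst).
  exact: (measurableT_comp (measurable_powR (- 2%:R)) m1).
pose H p := Num.sqrt (AX p + DI p ^+ 2).
have H0 p : 0 <= H p by exact: sqrtr_ge0.
have H2 p : H p ^+ 2 = AX p + DI p ^+ 2 by rewrite sqr_sqrtr // addr_ge0 // sqr_ge0.
have mDI2 : measurable_fun setT (fun p => DI p ^+ 2) by exact: measurable_funX.
have mH : measurable_fun setT H.
  have ms : measurable_fun setT (@Num.sqrt R) by apply: continuous_measurable_fun; exact: sqrt_continuous.
  by apply: (measurableT_comp ms); exact: measurable_funD.
pose P : set (itv_type I * X)%type := [set p | 0 < wd p.1].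
have oP : open P.
  have -> : P = (fun p : itv_type I * X => wd p.1) @^-1` [set r | 0 < r] by [].
  apply: open_comp; last exact: open_gt.
  have cfst : continuous (fun q : itv_type I * X => q.1) by move=> q; exact: cvg_fst.
  by move=> p _; exact: (continuous_compT cfst hwdc).
have pr_inv (U : set (itv_type I * X)%type) p : open U -> U p -> P p ->
    exists2 rho : R, 0 < rho & forall q, mdist (pr p) (pr q) < rho -> U q.
  by move=> oU Up Pp; exact: (warped_local_inverse hwdc hXw oU Up Pp).
(* D agrees with H on {wd > 0} and is 0 at the images of the other points, so its square is bounded
   by that of H at every [pr p]. *)
have [D [mD [DP DnP]]] := @borel_factor_fun R (itv_type I) X Xw P pr oP pr_inv H mH H0.
have D_le p : D (pr p) ^+ 2 <= AX p + DI p ^+ 2.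
  rewrite -H2; have [Pp|nP] := pselect (P p); first by rewrite DP.
  by rewrite DnP // expr0n /= sqr_ge0.
have mAXE : measurable_fun setT (fun p => (AX p)%:E) by exact/measurable_EFinP.
have mDIE : measurable_fun setT (fun p => (DI p ^+ 2)%:E) by exact/measurable_EFinP.
have AXE0 p : (0 <= (AX p)%:E)%E by rewrite lee_fin.
have DIE0 p : (0 <= (DI p ^+ 2)%:E)%E by exact: sq0.
have AXfin : (\int[PM]_p (AX p)%:E < +oo)%E.
  rewrite (tonelli1 _ mAXE AXE0).
  apply: le_lt_trans GX; apply: ae_ge0_le_integral.
  - exact: measurableT.
  - by move=> t _; apply: integral_ge0 => x _; exact: AXE0.
  - exact: (@measurable_fun_fubini_tonelli_F _ _ _ _ R m (fun p => (AX p)%:E) mAXE AXE0).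
  - by move=> t _; exact: sqint_ge0.
  - exact: (@measurable_sqint_section R X (itv_type I) Xw BI bI iX wd one_X hwd0 oneX0 hwdc iX_le m G mG).
  - apply: (ae_imp _ HDX) => t [_ _ hD] _; apply: ae_ge0_le_integral.
    + exact: measurableT.
    + by move=> x _; exact: AXE0.
    + exact: (measurable_fun_pair2 t mAXE).
    + by move=> x _; exact: sq0.
    + exact: (measurable_fun_pair2 t (sq_pr G mG)).
    + apply: (ae_imp _ hD) => x hx _; rewrite lee_fin /AX.
      have := hwd0 t; rewrite le_eqVlt => /orP[/eqP w0|wt] /=.
        by rewrite -w0 expr0n /= invr0 mul0r sqr_ge0.
      rewrite mulrC ler_pdivrMr ?exprn_gt0 // -exprMn ler_sqr ?nnegrE ?mulr_ge0 //.
      by rewrite mulrC.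
have DIfin : (\int[PM]_p (DI p ^+ 2)%:E < +oo)%E.
  rewrite (tonelli2 _ mDIE DIE0).
  apply: le_lt_trans GI; apply: ae_ge0_le_integral.
  - exact: measurableT.
  - by move=> x _; apply: integral_ge0 => t _; exact: DIE0.
  - exact: (@measurable_fun_fubini_tonelli_G _ _ _ _ R WL (fun p => (DI p ^+ 2)%:E) mDIE DIE0).
  - by move=> x _; exact: sqint_ge0.
  - exact: (@measurable_sqint_section R (itv_type I) X Xw BX bX iI one_X wd oneX0 hwd0 cX iI_le WL G mG).
  - apply: (ae_imp _ HDI) => x [_ _ hD] _; apply: ae_ge0_le_integral.
    + exact: measurableT.
    + by move=> t _; exact: DIE0.
    + exact: (measurable_fun_pair1 x mDIE).
    + by move=> t _; exact: sq0.
    + exact: (measurable_fun_pair1 x (sq_pr G mG)).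
    + apply: (ae_imp _ hD) => t; rewrite /one_X /cst mul1r => ht _; rewrite lee_fin /DI.
      by rewrite ler_sqr ?nnegrE.
have D2 : (\int[MV]_v (D v ^+ 2)%:E < +oo)%E.
  rewrite (int_pr _ (measurable_sqr mD) (fun v => sq0 (D v))).
  apply: (@le_lt_trans _ _ (\int[PM]_p ((AX p)%:E + (DI p ^+ 2)%:E))%E).
    apply: ge0_le_integral.
    - exact: measurableT.
    - by move=> p _; exact: sq0.
    - exact: sq_pr.
    - exact: emeasurable_funD.
    - by move=> p _; rewrite -EFinD lee_fin.
  rewrite (ge0_integralD _ measurableT (fun p _ => AXE0 p) mAXE (fun p _ => DIE0 p) mDIE).
  exact: lte_add_pinfty.
rewrite /BL /= -WLE -MVE prodE; split => //.
- by apply: (ae_imp _ HDI) => x [].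
- by apply: (ae_imp _ HDX) => t [].
exists DI, DX, D; split => //.
- by apply: (ae_imp _ HDI) => x [].
- by apply: (ae_imp _ HDX) => t [].
pose Zs : set (borel (itv_type I)) := [set t | wd t = 0].
have mZ : measurable Zs.
  by rewrite -[X in measurable X]setTI; exact: (mwd measurableT _ (measurable_set1 0)).
(* D and H may differ only where wd = 0; there wm = 0 by [hw], so this set is null for the weighted
   measure. *)
have Z0 : WL Zs = 0%E.
  rewrite WLE /weighted_leb /density_measure integral0_eq // => t Zt.
  by have := hw t Zt; rewrite /= => ->.
exists (Zs `*` setT); split.
- exact: measurableX.
- rewrite PME; transitivity (WL Zs * m setT)%E; first exact: product_measure1E.
  by rewrite Z0 mul0e.
- move=> p /= np; split => //=; apply: contrapT => w0; apply: np.
  rewrite DP // /P /= lt_def hwd0 andbT; exact/eqP.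
Qed.
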